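(* Let $S\subset\mathbb{R}^n$ and let $f\in C(\mathbb{R}^n)$ be non-zero and exponentially decaying at infinity (i.e. $|f(x)|\le Ce^{-a|x|}$ for some $C,a>0$), with $R_Sf=0$. Then for every $p\in\mathbb{R}^n\setminus S$, $$\operatorname{dist}_S(p,\operatorname{supp} f)=\operatorname{dist}(p,\operatorname{supp} f).$$ The same conclusion holds for any $f\in C(\mathbb{R}^n)$ (without decay assumptions) with $R_Sf=0$ if $S$ is an algebraic hypersurface.
   Context: For a continuous function $f$ on $\mathbb{R}^n$, $Rf(p,r)=\int_{|y-p|=r}f(y)\,d\sigma(y)$ with $d\sigma$ the surface measure on the sphere of radius $r>0$ centered at $p$. ''$R_Sf=0$'' means $Rf(p,r)=0$ for all $p\in S$ and all $r>0$. $\operatorname{dist}$ is Euclidean point-to-set distance. For $p\in\mathbb{R}^n\setminus S$ and a set $A$, $\operatorname{dist}_S(p,A)$ is the infimum of lengths of piecewise $C^1$ paths starting at $p$, ending at a point of $A$, and lying in $\mathbb{R}^n\setminus S$ (except possibly for the endpoint); i.e. it is the distance induced by the path metric $d_S$ of $\mathbb{R}^n\setminus S$. Clearly $\operatorname{dist}_S\ge\operatorname{dist}$. *)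

(* Defs.v *)
From HB Require Import structures.
From mathcomp Require Import all_boot all_order all_algebra.
From mathcomp Require Import all_classical all_reals all_analysis.
From mathcomp Require mpoly.

Set Implicit Arguments.
Unset Strict Implicit.
Unset Printing Implicit Defensive.

Import Order.TTheory GRing.Theory Num.Theory.
Import numFieldNormedType.Exports.
Local Open Scope classical_set_scope.
Local Open Scope ring_scope.

Section Defs.
Variables (R : realType) (n : nat).

Definition e2norm (x : 'rV[R]_n) : R := Num.sqrt (\sum_(i < n) (x ord0 i) ^+ 2).

(* Lebesgue integral on R^n, realised as the iterated one-dimensional
   Lebesgue integral (Fubini); coordinate 0 is the outermost variable. *)
Fixpoint iter_int (k : nat) (g : (nat -> R) -> R) : R :=
  match k with
  | 0 => g (fun _ => 0)
  | k'.+1 => Rintegral (@lebesgue_measure R) setT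
      (fun t => iter_int k' (fun x => g (fun i => if i is j.+1 then x j else t)))
  end.

Definition int_Rn (F : 'rV[R]_n -> R) : R :=
  iter_int n (fun x => F (\row_(i < n) x (nat_of_ord i))).

Definition shell_int (f : 'rV[R]_n -> R) (p : 'rV[R]_n) (r h : R) : R :=
  int_Rn (fun y => if (r <= e2norm (y - p) < r + h) then f y else 0).

(* Spherical integral  Rf(p,r) = \int_{|y-p|=r} f dsigma, with the surface
   measure given by its Minkowski-content description:
   lim_{h -> 0+} h^-1 \int_{r <= |y-p| < r+h} f. *)
Definition Rsph (f : 'rV[R]_n -> R) (p : 'rV[R]_n) (r : R) : R :=
  lim ((fun h => h^-1 * shell_int f p r h) @ 0^'+).

Definition RS_zero (S : set 'rV[R]_n) (f : 'rV[R]_n -> R) : Prop :=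
  forall p, S p -> forall r, 0 < r -> Rsph f p r = 0.

Definition supp (f : 'rV[R]_n -> R) : set 'rV[R]_n :=
  closure [set x | f x != 0].

(* Euclidean point-to-set distance, with dist(p, empty) = +oo *)
Definition dist (p : 'rV[R]_n) (A : set 'rV[R]_n) : \bar R :=
  ereal_inf [set (e2norm (p - a))%:E | a in A].

Definition piecewise_C1 (g : R -> 'rV[R]_n) : Prop :=
  {within `[0, 1]%classic, continuous g} /\
  exists (k : nat) (t : nat -> R),
    [/\ t 0%N = 0, t k = 1, (forall i, (i < k)%N -> t i < t i.+1) &
     forall i, (i < k)%N ->
       [/\ (forall x, t i < x < t i.+1 -> derivable g x 1),
           {in `](t i), (t i.+1)[, continuous (derive1 g)},
           cvg ((derive1 g) @ (t i)^'+) & cvg ((derive1 g) @ (t i.+1)^'-)]].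

Definition path_length (g : R -> 'rV[R]_n) : R :=
  Rintegral (@lebesgue_measure R) `[0, 1]%classic (fun t => e2norm ((derive1 g) t)).

Definition admissible_path (S : set 'rV[R]_n) (p : 'rV[R]_n)
    (A : set 'rV[R]_n) (g : R -> 'rV[R]_n) : Prop :=
  [/\ piecewise_C1 g, g 0 = p, A (g 1) & forall t, 0 <= t < 1 -> ~ S (g t)].

Definition dist_S (S : set 'rV[R]_n) (p : 'rV[R]_n) (A : set 'rV[R]_n) : \bar R :=
  ereal_inf [set (path_length g)%:E | g in admissible_path S p A].

Definition exp_decaying (f : 'rV[R]_n -> R) : Prop :=
  exists C a : R, [/\ 0 < C, 0 < a &
    forall x, `|f x| <= C * expR (- (a * e2norm x))].

Definition algebraic_hypersurface (S : set 'rV[R]_n) : Prop :=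
  exists P : mpoly.mpoly n R,
    (exists m : mpoly.multinom n, (0 < mpoly.mdeg m)%N /\ mpoly.mcoeff m P != 0) /\
    S = [set x | mpoly.meval (fun i => x ord0 i) P = 0].

End Defs.

(* Main.v *)
(* The vanishing of the spherical means of f about x makes the integrals of f over
   all balls about x vanish. Let N be a closed set of such centres, p a point off
   N, and suppose that f vanishes at the end of every polygonal chain of length
   < rho which starts at p and avoids N. The claim is that f = 0 on the Euclidean
   ball B(p, rho); applied to N = S this gives dist_S <= dist when S is closed.

   Let u_s be the heat evolution of f, truncated far from p. On N one has
   |u_s| <= C exp(-rho^2/4s), since the part of the heat kernel inside radius rho
   integrates to 0 against f. Above this threshold u_s is thus a heat flow with
   zero boundary values on N, and an energy estimate of Davies-Gaffney type, with a
   weight exponential in the distance measured along chains, gives u_s =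
   O(exp(-rho'^2/4s)) near p for every rho' < rho. As 1 - exp(-exp(J^2 (b-a) - J))
   is a power series in exp(-J^2 a) and tends to the indicator of a < b, this
   Gaussian decay forces the integrals of f over the balls of radius < rho' about
   all centres near p to vanish. Differentiating in the centre, f is orthogonal on
   B(p, rho') to enough functions to vanish there.

   If f is bounded, N is the set of all centres with vanishing ball integrals, and
   p may lie in N but not in S: a Gaussian average of f along a line through p is a
   nonzero entire function which vanishes on N, so that a short segment issuing
   from p meets N at most in p. *)

(* The estimate needs a margin: chains must keep a positive distance from the centres, so [p] must
   have positive distance from [N]. An arbitrary S may accumulate at [p]; it is therefore replaced
   by the closed set of all null centres, at the price of moving [p] slightly, which takes a bound
   on f over the whole space. The zero set of a polynomial is closed already; there the argument is
   local, and truncation stands in for decay.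

   Since f is merely continuous, no derivative of the heat flow is formed. Time steps h^2 go with
   space steps h, the heat equation holds up to O(h^3), and T / h^2 steps add up to an error O(h).

   The rate is sharp. With a weight exp(lam d), d 1-Lipschitz, the energy grows at most like exp(2
   lam^2 s); where d = rho, the quotient exp(2 lam^2 s - 2 lam rho) is least for lam = rho / 2s,
   with value exp(-2 rho^2 / 4s), the square of the desired bound. A larger Lipschitz constant would
   shrink the ball obtained, so the discrete gradient of the weight must be bounded by exactly 1, up
   to O(h). *)
Require Import Defs.
From HB Require Import structures.
From mathcomp Require Import all_boot all_order all_algebra.
From mathcomp Require Import all_classical all_reals all_analysis.
From mathcomp Require Import measurable_realfun.
From mathcomp Require Import ring lra.

Import Order.TTheory GRing.Theory Num.Theory.
Import numFieldNormedType.Exports.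
Local Open Scope classical_set_scope.
Local Open Scope ring_scope.
Set Implicit Arguments.
Unset Strict Implicit.
Unset Printing Implicit Defensive.

(** * Iterated integrals *)

Section OneDim.
Variable R : realType.
Local Notation mu := (@lebesgue_measure R).

(** The majorant of all integrands is a product of these, one per coordinate. Such a bound passes to
    slices, so that linearity and dominated convergence for iterated integrals follow by induction
    on the dimension. *)
Definition cau (t : R) : R := (1 + t ^+ 2)^-1.

Lemma cau_gt0 t : 0 < cau t.
Proof. by rewrite invr_gt0 ltr_pwDl ?sqr_ge0. Qed.

Lemma cau_ge0 t : 0 <= cau t. Proof. exact/ltW/cau_gt0. Qed.

Lemma cau_cont : continuous cau.
Proof. exact: continuous_oneDsqrV. Qed.

Lemma cau_integrable : mu.-integrable setT (EFin \o cau).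
Proof.
apply/integrableP; split.
  apply/measurable_EFinP. apply: continuous_measurable_fun. exact: cau_cont.
under eq_integral do rewrite /= ger0_norm ?cau_ge0//.
rewrite (_ : setT = `]-oo, 0[%classic `|` `[0, +oo[%classic); last first.
  apply/seteqP; split => // x _; case: (ltP x 0) => x0; [left|right];
  by rewrite /= in_itv/= ?x0.
have mb D : measurable D -> measurable_fun D (fun x : R => (cau x)%:E).
  by move=> mD; apply: measurable_funTS; apply/measurable_EFinP; apply: continuous_measurable_fun; apply: cau_cont.
rewrite ge0_integral_setU//; last 3 first.
- by apply: mb; exact: measurableU.
- by move=> x _; rewrite lee_fin cau_ge0.
- rewrite disj_set2E; apply/eqP; rewrite -subset0 => x [] /=.
  by rewrite !in_itv/= andbT => x0; rewrite leNgt x0.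
rewrite [X in (_ + X)%E](@integral0y_oneDsqr R).
apply: (@le_lt_trans _ _ (pi / 2 + pi / 2)%:E); last by rewrite ltry.
rewrite EFinD leeD2r//.
rewrite -(@integral0y_oneDsqr R) ge0_integration_by_substitution0; last 2 first.
- exact: mb.
- by move=> r; rewrite lee_fin cau_ge0.
under [leRHS]eq_integral do rewrite /oneDsqr sqrrN.
apply: ge0_subset_integral => //.
- exact: mb.
- by move=> x _; rewrite lee_fin cau_ge0.
- by move=> x /=; rewrite !in_itv/=; exact: ltW.
Qed.

Lemma integrable_dom (G : R -> R) c :
  measurable_fun setT G -> (forall t, `|G t| <= c * cau t) ->
  mu.-integrable setT (EFin \o G).
Proof.
move=> mG Gc.
have : mu.-integrable setT (EFin \o (fun t => c * cau t)).
  have := integrableZl measurableT c cau_integrable.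
  by apply: eq_integrable => // t _ /=; rewrite EFinM.
apply: le_integrable => //; first exact/measurable_EFinP.
by move=> t _ /=; rewrite lee_fin (le_trans (Gc t))// ler_norm.
Qed.

Lemma Rintegral_dct (G_ : nat -> R -> R) (G : R -> R) c :
  (forall j, measurable_fun setT (G_ j)) ->
  (forall j t, `|G_ j t| <= c * cau t) ->
  (forall t, G_ j t @[j --> \oo] --> G t) ->
  measurable_fun setT G /\
  Rintegral mu setT (G_ j) @[j --> \oo] --> Rintegral mu setT G.
Proof.
move=> mG Gc cG.
have mGl : measurable_fun setT G by apply: measurable_fun_cvg mG _ => t _; exact: cG.
split=> //.
have ic : mu.-integrable setT (EFin \o (fun t => c * cau t)).
  have := integrableZl measurableT c cau_integrable.
  by apply: eq_integrable => // t _ /=; rewrite EFinM.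
have dj t j : setT t -> (`|(G_ j t)%:E| <= (EFin \o (fun t => c * cau t)%R) t)%E.
  by rewrite abse_EFin lee_fin.
have [||||i1 _ cv] := @dominated_convergence _ _ R mu setT measurableT
  (fun j t => (G_ j t)%:E) (fun t => (G t)%:E) _ _ _ _ ic.
- by move=> j; exact: (measurableT_comp (@EFin_measurable R setT) (mG j)).
- exact: (measurableT_comp (@EFin_measurable R setT) mGl).
- by apply: nearW => t _; apply: cvg_EFin; [exact: nearW|exact: cG].
- by apply: nearW => t j; exact: dj.
rewrite /Rintegral; apply: fine_cvg.
by rewrite fineK//; exact: integrable_fin_num.
Qed.

End OneDim.

Section Affine.
Variable R : realType.
Local Notation mu := (@lebesgue_measure R).

Definition affmap (a r : R) (t : measurableTypeR R) : measurableTypeR R := a + r * t.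

Lemma affmap_measurable a r : measurable_fun setT (affmap a r).
Proof.
apply: (@continuous_measurable_fun R (affmap a r)).
by move=> x; apply: cvgD; [exact: cvg_cst|apply: cvgM; [exact: cvg_cst|exact: cvg_id]].
Qed.

HB.instance Definition _ a r :=
  isMeasurableFun.Build _ _ _ _ (affmap a r) (affmap_measurable a r).

Lemma Rintegral_affine (G : R -> R) a r : 0 < r -> measurable_fun setT G ->
  mu.-integrable setT (EFin \o (fun t => G (a + r * t))) ->
  Rintegral mu setT G = r * Rintegral mu setT (fun t => G (a + r * t)).
Proof.
move=> r0 mG iG.
pose ph := affmap a r.
pose rr : {nonneg R} := NngNum (ltW r0).
(* Lebesgue measure is determined by its values on half-open intervals, whose preimages under the
   affine map are again such intervals. *)
have E A : measurable A -> mu A = mscale rr (pushforward mu ph) A.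
  move=> mA.
  apply: (@lebesgue_measure_unique _ (mscale rr (pushforward mu ph))) => //.
  move=> _ [[x y]] _ <-.
  have P : ph @^-1` `]x, y] = `](x - a) / r, (y - a) / r]%classic.
    apply/seteqP; split => t /=; rewrite !in_itv /= /ph /affmap ltr_pdivrMr// ler_pdivlMr//;
    by rewrite ltrBlDl lerBrDl (mulrC t).
  transitivity (r%:E * mu (ph @^-1` `]x, y]))%E; last by [].
  rewrite P lebesgue_measure_itv lebesgue_measure_itv /= !lte_fin ltr_pM2r ?invr_gt0// ltrD2r.
  case: ifP => xy; last by rewrite mule0.
  by rewrite -!EFinB -EFinM; congr EFin; field; rewrite gt_eqF.
rewrite /Rintegral.
have EI : (\int[mu]_x (G x)%:E = \int[mscale rr (pushforward mu ph)]_x (G x)%:E)%E.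
  by move=> m; apply: eq_measure_integral => A mA _; exact: E.
rewrite (EI (affmap_measurable a r)) {EI E}.
have mG' : measurable_fun setT (fun x => (G x)%:E).
  exact: (measurableT_comp (@EFin_measurable R setT) mG).
have i2 : (pushforward mu ph).-integrable setT (fun x => (G x)%:E).
  by apply: integrable_pushforward => //; exact: affmap_measurable.
have i3 : mu.-integrable setT (EFin \o (fun t => G (ph t))) by exact: iG.
have Em : (\int[mscale rr (pushforward mu ph)]_x (G x)%:E = r%:E * \int[pushforward mu ph]_x (G x)%:E)%E.
  move=> m; rewrite integralE !ge0_integral_mscale//; last 2 first.
  - exact: measurable_funeneg.
  - exact: measurable_funepos.
  rewrite [in RHS]integralE.
  have := integrable_pos_fin_num measurableT i2; have := integrable_neg_fin_num measurableT i2.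
  move=> /(_ m) nf /(_ m) pf; rewrite -(fineK pf) -(fineK nf).
  move: (fine _) (fine _) => v u.
  transitivity ((r * (u - v))%:E)%E; last by rewrite EFinM EFinB.
  by rewrite mulrBr EFinB !EFinM.
rewrite Em.
rewrite (integral_pushforward (affmap_measurable a r) mG' iG)//= preimage_setT.
rewrite fineM//; exact: integrable_fin_num.
Qed.
End Affine.

Section Iter.
Variable R : realType.
Implicit Types (g h : (nat -> R) -> R) (k : nat) (C : R) (x : nat -> R).
Local Notation mu := (@lebesgue_measure R).

Definition scons (t : R) x : nat -> R := fun i => if i is j.+1 then x j else t.
Definition slice g t : (nat -> R) -> R := fun x => g (scons t x).
Definition wt k x : R := \prod_(i < k) cau (x i).
Definition dom k C g := forall x, `|g x| <= C * wt k x.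

(* Hereditary measurability: with the bound [dom], exactly what makes [iter_int] linear. *)
Fixpoint hm k g : Prop := match k with
  | 0 => True
  | k'.+1 => measurable_fun setT (fun t => iter_int k' (slice g t)) /\
             forall t, hm k' (slice g t)
  end.

Definition bint : R := Rintegral mu setT (@cau R).

Lemma bint_ge0 : 0 <= bint.
Proof. by apply: Rintegral_ge0 => t _; exact: cau_ge0. Qed.

Lemma wt_gt0 k x : 0 < wt k x.
Proof. by apply: prodr_gt0 => i _; exact: cau_gt0. Qed.

Lemma dom_ge0 k C g : dom k C g -> 0 <= C.
Proof.
move=> /(_ (fun _ => 0)) h; rewrite -(pmulr_lge0 _ (wt_gt0 k (fun=> 0))).
exact: le_trans h.
Qed.

Lemma wtS k t x : wt k.+1 (scons t x) = cau t * wt k x.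
Proof. by rewrite /wt big_ord_recl. Qed.

Lemma dom_slice k C g t : dom k.+1 C g -> dom k (C * cau t) (slice g t).
Proof. by move=> h x; rewrite -mulrA -wtS; exact: h. Qed.

Lemma dom0 C g x : dom 0 C g -> `|g x| <= C.
Proof. by move=> /(_ x); rewrite /wt big_ord0 mulr1. Qed.

Lemma iter_int_bound k C g : dom k C g -> hm k g -> `|iter_int k g| <= C * bint ^+ k.
Proof.
elim: k C g => [|k IH] C g dg; first by rewrite expr0 mulr1 => _; exact: (dom0 _ dg).
move=> [mg hg] /=.
have b t : `|iter_int k (slice g t)| <= (C * bint ^+ k) * cau t.
  by rewrite mulrAC; apply: IH; [exact: dom_slice|exact: hg].
have i1 := integrable_dom mg b.
apply: le_trans (le_normr_Rintegral measurableT i1) _.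
rewrite exprSr mulrA /bint -RintegralZl//; last exact: cau_integrable.
apply: le_Rintegral => //.
  by have := integrable_abse i1.
by have := integrableZl measurableT (C * bint ^+ k) (cau_integrable R); apply: eq_integrable => // t _ /=; rewrite EFinM.
Qed.

Lemma slice_integrable k C g : dom k.+1 C g -> hm k.+1 g ->
  mu.-integrable setT (EFin \o (fun t => iter_int k (slice g t))).
Proof.
move=> dg [mg hg].
apply: (integrable_dom (c := C * bint ^+ k) mg) => t.
by rewrite mulrAC; apply: iter_int_bound; [exact: dom_slice|exact: hg].
Qed.

Lemma iter_int_lin k C D a g h : dom k C g -> hm k g -> dom k D h -> hm k h ->
  hm k (fun x => a * g x + h x) /\
  iter_int k (fun x => a * g x + h x) = a * iter_int k g + iter_int k h.
Proof.
elim: k C D g h => [|k IH] C D g h dg hg dh hh //=.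
have [mg sg] := hg; have [mh sh] := hh.
have H t := IH _ _ (slice g t) (slice h t) (dom_slice t dg) (sg t) (dom_slice t dh) (sh t).
have E : (fun t => iter_int k (slice (fun x => a * g x + h x) t)) =
         (fun t => a * iter_int k (slice g t) + iter_int k (slice h t)).
  by apply/funext => t; have [_] := H t.
split; first split.
- rewrite E; apply: measurable_funD => //; exact: measurable_funM.
- by move=> t; have [] := H t.
- rewrite -[LHS]/(Rintegral mu setT (fun t => iter_int k (slice (fun x => a * g x + h x) t))) E.
  have ig := slice_integrable dg hg; have ih := slice_integrable dh hh.
  rewrite RintegralD//; last first.
    by have := integrableZl measurableT a ig; apply: eq_integrable => // t _ /=; rewrite EFinM.
  by rewrite RintegralZl.
Qed.

Lemma iter_int_ge0 k g : (forall x, 0 <= g x) -> 0 <= iter_int k g.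
Proof.
elim: k g => [|k IH] g g0 /=; first exact: g0.
by apply: Rintegral_ge0 => t _; apply: IH => x; exact: g0.
Qed.

(** Hereditary measurability of the limit has to be part of the induction: the inner integrals of
    the limit are the next integrands. *)
Lemma iter_int_dct k C (g_ : nat -> (nat -> R) -> R) g :
  (forall j, dom k C (g_ j)) -> (forall j, hm k (g_ j)) ->
  (forall x, g_ j x @[j --> \oo] --> g x) ->
  hm k g /\ iter_int k (g_ j) @[j --> \oo] --> iter_int k g.
Proof.
elim: k C g_ g => [|k IH] C g_ g dg hg cg; first by split=> //=; exact: cg.
have H t := IH _ (fun j => slice (g_ j) t) (slice g t) (fun j => dom_slice t (dg j))
  (fun j => proj2 (hg j) t) (fun x => cg (scons t x)).
have [||| m c] := @Rintegral_dct R (fun j t => iter_int k (slice (g_ j) t))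
  (fun t => iter_int k (slice g t)) (C * bint ^+ k).
- by move=> j; have [] := hg j.
- move=> j t; rewrite mulrAC; apply: iter_int_bound; first exact: dom_slice.
  exact: (proj2 (hg j) t).
- by move=> t; have [] := H t.
- by split; [split => // t; have [] := H t|exact: c].
Qed.

(** Continuity in the product topology, stated through sequences because dominated convergence is a
    statement about sequences. *)
Definition sc g := forall (u : nat -> nat -> R) x,
  (forall i, u j i @[j --> \oo] --> x i) -> g (u j) @[j --> \oo] --> g x.

Lemma sc_slice g t : sc g -> sc (slice g t).
Proof.
move=> cg u x ux; apply: cg => -[|i] /=; [exact: cvg_cst|exact: ux].
Qed.

Lemma seq_continuous (G : R -> R) :
  (forall (u : nat -> R) t, u j @[j --> \oo] --> t -> G (u j) @[j --> \oo] --> G t) ->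
  continuous G.
Proof.
move=> H x; apply/continuous_withinNx/cvgr_dnbhsP => u [_ ux]; exact: H.
Qed.

(** By dominated convergence each inner integral is a continuous function of the outer variable,
    hence measurable. *)
Lemma sc_hm k C g : dom k C g -> sc g -> hm k g.
Proof.
elim: k C g => [//|k IH] C g dg cg.
have H t : hm k (slice g t) by apply: IH (dom_slice t dg) (sc_slice cg).
split => //; apply: continuous_measurable_fun; apply: seq_continuous => u t ut.
have [] := @iter_int_dct k C (fun j => slice g (u j)) (slice g t) => //.
- move=> j x; apply: le_trans (dom_slice (u j) dg x) _.
  rewrite ler_wpM2r ?(ltW (wt_gt0 _ _))// ler_piMr ?(dom_ge0 dg)//.
  by rewrite /cau invf_le1 ?ltr_pwDl ?sqr_ge0// lerDl sqr_ge0.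
- by move=> x; apply: cg => -[|i] //=; exact: cvg_cst.
Qed.

Lemma cau_affine (a r : R) : 0 < r ->
  exists2 c, 0 < c & forall t, cau (a + r * t) <= c * cau t.
Proof.
move=> r0; exists (1 + 2 * (1 + a ^+ 2) / r ^+ 2).
  by rewrite ltr_pwDl// divr_ge0// ?sqr_ge0// mulr_ge0// addr_ge0// sqr_ge0.
move=> t; rewrite /cau ler_pdivlMr ?ltr_pwDl ?sqr_ge0// mulrC ler_pdivrMr ?ltr_pwDl ?sqr_ge0//.
set s := a + r * t.
have -> : t = (s - a) / r by rewrite /s; field; rewrite gt_eqF.
rewrite expr_div_n.
have : 0 < (r ^+ 2)^-1 by rewrite invr_gt0 exprn_gt0.
move: (r ^+ 2)^-1 => u u0.
have h : (s - a) ^+ 2 <= 2 * (1 + a ^+ 2) * (1 + s ^+ 2).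
  have := sqr_ge0 (s + a); have := mulr_ge0 (sqr_ge0 s) (sqr_ge0 a); nra.
have h2 := ler_wpM2r (ltW u0) h.
have := sqr_ge0 s; nra.
Qed.

Lemma dom_affine k r C g : 0 < r -> dom k C g -> forall a : nat -> R,
  exists D, dom k D (fun x => g (fun i => a i + r * x i)).
Proof.
move=> r0 dg a.
have [D [D0 HD]] : exists D, 0 <= D /\ forall x, wt k (fun i => a i + r * x i) <= D * wt k x.
  elim: (k) => [|j [D [D0 IH]]].
    by exists 1; split => // x; rewrite /wt !big_ord0 mulr1.
  have [c c0 hc] := cau_affine (a j) r0.
  exists (D * c); split; first by rewrite mulr_ge0// ltW.
  move=> x; rewrite /wt !big_ord_recr /= mulrACA.
  by apply: ler_pM; [exact: (ltW (wt_gt0 j (fun i => a i + r * x i)))|exact: cau_ge0|exact: IH|exact: hc].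
exists (C * D) => x; apply: le_trans (dg _) _.
by rewrite -mulrA ler_wpM2l// (dom_ge0 dg).
Qed.

(** At depth 0 [iter_int] evaluates at the zero sequence, which an affine map moves; locality makes
    this harmless. *)
Definition loc k g := forall x y, (forall i, (i < k)%N -> x i = y i) -> g x = g y.

Lemma iter_int_affine k r C g : 0 < r -> dom k C g -> hm k g -> loc k g ->
  forall a : nat -> R,
  hm k (fun x => g (fun i => a i + r * x i)) /\
  iter_int k g = (r:R) ^+ k * iter_int k (fun x => g (fun i => a i + r * x i)).
Proof.
move=> r0; elim: k C g => [|k IH] C g dg hg lg a.
  by split=> //=; rewrite mul1r; exact: lg.
have [mg sg] := hg.
pose a' i := a i.+1.
have E t x : (fun i => a i + r * scons t x i) =
             scons (a 0%N + r * t) (fun i => a' i + r * x i).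
  by apply/funext => -[|i].
have L t : loc k (slice g t).
  by move=> x y xy; apply: lg => -[|i] //= ik; exact: xy.
have H t := IH _ (slice g (a 0%N + r * t)) (dom_slice _ dg) (sg _) (L _) a'.
have E2 t : slice (fun x => g (fun i => a i + r * x i)) t =
            (fun x => slice g (a 0%N + r * t) (fun i => a' i + r * x i)).
  by apply/funext => x; rewrite /slice E.
have rk : r ^+ k != 0 by rewrite expf_neq0// gt_eqF.
have E3 : (fun t => iter_int k (slice (fun x => g (fun i => a i + r * x i)) t)) =
          (fun t => (r ^+ k)^-1 * iter_int k (slice g (a 0%N + r * t))).
  by apply/funext => t; rewrite E2; have [_ ->] := H t; rewrite mulKf.
have ca : continuous (fun t : R => a 0%N + r * t).
  by move=> x; apply: cvgD; [exact: cvg_cst|apply: cvgM; [exact: cvg_cst|exact: cvg_id]].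
have mc : measurable_fun setT (fun t => iter_int k (slice g (a 0%N + r * t))).
  by apply: (measurableT_comp mg); exact: continuous_measurable_fun.
split; first split.
- by rewrite E3; apply: measurable_funM.
- by move=> t; rewrite E2; have [] := H t.
rewrite -[RHS]/(r ^+ k.+1 * Rintegral mu setT (fun t => iter_int k (slice (fun x => g (fun i => a i + r * x i)) t))) E3.
have [c c0 hc] := cau_affine (a 0%N) r0.
have i1 : mu.-integrable setT (EFin \o (fun t => iter_int k (slice g (a 0%N + r * t)))).
  apply: (integrable_dom (c := C * bint ^+ k * c) mc) => t.
  apply: le_trans (iter_int_bound (dom_slice _ dg) (sg _)) _.
  rewrite mulrAC -!mulrA ler_wpM2l ?(dom_ge0 dg)// ler_wpM2l ?exprn_ge0 ?bint_ge0//.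
rewrite RintegralZl// mulrA exprS mulrK ?unitfE//.
exact: Rintegral_affine.
Qed.

End Iter.

(** * The integral on R^n and its class of integrands *)

Section Space.
Variables (R : realType) (n : nat).
Local Notation V := 'rV[R]_n.
Implicit Types (F G : V -> R) (x y z : V) (C D a b r : R).

Definition rowof (x : nat -> R) : V := \row_(i < n) x (nat_of_ord i).
Definition weight y : R := \prod_(i < n) cau (y ord0 i).
Definition dominated C F := forall y, `|F y| <= C * weight y.
(** The working substitute for integrability: stable under linear combinations, dominated limits and
    affine substitutions, and large enough for the discontinuous indicators of balls. *)
Definition adm F := (exists C, dominated C F) /\ hm n (F \o rowof).
Definition scont F := forall (u : nat -> V) x,
  (forall i, u j ord0 i @[j --> \oo] --> x ord0 i) -> F (u j) @[j --> \oo] --> F x.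

Lemma weight_gt0 y : 0 < weight y.
Proof. by apply: prodr_gt0 => i _; exact: cau_gt0. Qed.

Lemma weight_rowof (x : nat -> R) : weight (rowof x) = wt n x.
Proof. by apply: eq_bigr => i _; rewrite mxE. Qed.

Lemma dom_rowof C F : dominated C F -> dom n C (F \o rowof).
Proof. by move=> dF x; rewrite -weight_rowof; exact: dF. Qed.

Lemma loc_rowof F : loc n (F \o rowof).
Proof. by move=> x y xy; congr F; apply/rowP => i; rewrite !mxE xy. Qed.

Lemma sc_rowof F : scont F -> sc (F \o rowof).
Proof.
move=> cF u x ux; apply: cF => i; rewrite mxE.
by under eq_fun do rewrite mxE; exact: ux.
Qed.

Lemma adm_scont C F : dominated C F -> scont F -> adm F.
Proof.
move=> dF cF; split; first by exists C.
exact: sc_hm (dom_rowof dF) (sc_rowof cF).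
Qed.

Lemma int_lin a F G : adm F -> adm G ->
  adm (fun y => a * F y + G y) /\
  int_Rn (fun y => a * F y + G y) = a * int_Rn F + int_Rn G.
Proof.
move=> [[C dF] hF] [[D dG] hG].
have [h1 h2] := iter_int_lin a (dom_rowof dF) hF (dom_rowof dG) hG.
split; last exact: h2.
split; last exact: h1.
exists (`|a| * C + D) => y; rewrite mulrDl (le_trans (ler_normD _ _))// lerD//.
by rewrite normrM -mulrA ler_wpM2l.
Qed.

Lemma adm0 : adm (fun=> 0).
Proof.
apply: (@adm_scont 0) => [y|u x _]; first by rewrite normr0 mul0r.
exact: cvg_cst.
Qed.

Lemma int_Rn_ge0 F : (forall y, 0 <= F y) -> 0 <= int_Rn F.
Proof. by move=> F0; apply: iter_int_ge0. Qed.

Lemma eq_int_Rn F G : F =1 G -> int_Rn F = int_Rn G.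
Proof. by move=> /funext ->. Qed.

Lemma eq_adm F G : F =1 G -> adm F -> adm G.
Proof. by move=> /funext ->. Qed.

Lemma int_Rn0 : int_Rn (fun _ : V => 0 : R) = 0.
Proof.
have [_ h] := int_lin (-1) adm0 adm0.
transitivity (-1 * int_Rn (fun _ : V => 0 : R) + int_Rn (fun _ : V => 0 : R)); last first.
  by rewrite mulN1r addNr.
by rewrite -h; apply: eq_int_Rn => y; rewrite mulr0 addr0.
Qed.

Lemma admZ a F : adm F -> adm (fun y => a * F y).
Proof. by move=> /(int_lin a)/(_ adm0)[] /eq_adm h _; apply: h => y; rewrite addr0. Qed.

Lemma int_RnZ a F : adm F -> int_Rn (fun y => a * F y) = a * int_Rn F.
Proof.
move=> /(int_lin a)/(_ adm0)[] _; rewrite int_Rn0 addr0 => <-.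
by apply: eq_int_Rn => y; rewrite addr0.
Qed.

Lemma admD F G : adm F -> adm G -> adm (fun y => F y + G y).
Proof. by move=> /(int_lin 1)h /h[] /eq_adm{}h _; apply: h => y; rewrite mul1r. Qed.

Lemma int_RnD F G : adm F -> adm G -> int_Rn (fun y => F y + G y) = int_Rn F + int_Rn G.
Proof.
move=> /(int_lin 1)h /h[] _; rewrite mul1r => <-.
by apply: eq_int_Rn => y; rewrite mul1r.
Qed.

Lemma admN F : adm F -> adm (fun y => - F y).
Proof. by move=> /(admZ (-1)) /eq_adm; apply => y; rewrite mulN1r. Qed.

Lemma admB F G : adm F -> adm G -> adm (fun y => F y - G y).
Proof. by move=> aF aG; apply: admD => //; exact: admN. Qed.

Lemma int_RnN F : adm F -> int_Rn (fun y => - F y) = - int_Rn F.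
Proof.
move=> aF; rewrite -mulN1r -int_RnZ//.
by apply: eq_int_Rn => y; rewrite mulN1r.
Qed.

Lemma int_RnB F G : adm F -> adm G -> int_Rn (fun y => F y - G y) = int_Rn F - int_Rn G.
Proof. by move=> aF aG; rewrite int_RnD ?int_RnN//; exact: admN. Qed.

Lemma adm_sum (I : Type) (s : seq I) (F : I -> V -> R) : (forall i, adm (F i)) ->
  adm (fun y => \sum_(i <- s) F i y).
Proof.
move=> aF; elim: s => [|i s IH].
  by apply: eq_adm adm0 => y; rewrite big_nil.
by apply: eq_adm (admD (aF i) IH) => y; rewrite big_cons.
Qed.

Lemma int_Rn_sum (I : Type) (s : seq I) (F : I -> V -> R) : (forall i, adm (F i)) ->
  int_Rn (fun y => \sum_(i <- s) F i y) = \sum_(i <- s) int_Rn (F i).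
Proof.
move=> aF; elim: s => [|i s IH].
  rewrite big_nil -[RHS]int_Rn0; apply: eq_int_Rn => y.
  by rewrite big_nil.
rewrite big_cons -IH -int_RnD//; last exact: adm_sum.
by apply: eq_int_Rn => y; rewrite big_cons.
Qed.

Lemma le_int_Rn F G : adm F -> adm G -> (forall y, F y <= G y) -> int_Rn F <= int_Rn G.
Proof.
move=> aF aG FG; rewrite -subr_ge0 -int_RnB//.
by apply: int_Rn_ge0 => y; rewrite subr_ge0.
Qed.

Lemma le_norm_int F G : adm F -> adm G -> (forall y, `|F y| <= G y) -> `|int_Rn F| <= int_Rn G.
Proof.
move=> aF aG FG; rewrite ler_norml -int_RnN//; apply/andP; split; apply: le_int_Rn => //.
- exact: admN.
- by move=> y; have := FG y; rewrite ler_norml => /andP[].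
- by move=> y; apply: le_trans (FG y); exact: ler_norm.
Qed.

Lemma dominated_cvg C (F_ : nat -> V -> R) F :
  (forall j, dominated C (F_ j)) -> (forall y, F_ j y @[j --> \oo] --> F y) -> dominated C F.
Proof.
move=> dF cF y.
have : `|F_ j y| @[j --> \oo] --> `|F y| by exact: cvg_norm.
move=> h; rewrite -(cvg_lim _ h)//; apply: limr_le; first by apply/cvg_ex; eexists; exact: h.
by apply: nearW => j; exact: dF.
Qed.

Lemma int_dct C (F_ : nat -> V -> R) F :
  (forall j, dominated C (F_ j)) -> (forall j, adm (F_ j)) ->
  (forall y, F_ j y @[j --> \oo] --> F y) ->
  adm F /\ int_Rn (F_ j) @[j --> \oo] --> int_Rn F.
Proof.
move=> dF aF cF.
have [||| hF h] := @iter_int_dct R n C (fun j => F_ j \o rowof) (F \o rowof).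
- by move=> j; exact: dom_rowof.
- by move=> j; have [] := aF j.
- by move=> x; exact: cF.
split; last exact: h; split => //; exists C; exact: dominated_cvg dF cF.
Qed.

Lemma int_affine r F (v : V) : 0 < r -> adm F ->
  adm (fun y => F (v + r *: y)) /\ int_Rn F = r ^+ n * int_Rn (fun y => F (v + r *: y)).
Proof.
move=> r0 [[C dF] hF].
pose a i := if (insub i : option 'I_n) is Some j then v ord0 j else 0.
have E (x : nat -> R) : (rowof (fun i => a i + r * x i)) = v + r *: rowof x.
  by apply/rowP => i; rewrite !mxE /a valK.
have [h1 h2] := iter_int_affine r0 (dom_rowof dF) hF (@loc_rowof F) a.
have [D dD] := dom_affine r0 (dom_rowof dF) a.
have E2 : (fun x : nat -> R => (F \o rowof) (fun i => a i + r * x i)) = (fun y => F (v + r *: y)) \o rowof.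
  by apply/funext => x /=; rewrite E.
rewrite E2 in h1 h2 dD; split => //; split => //.
exists D => y; pose x i := if (insub i : option 'I_n) is Some j then y ord0 j else 0.
have -> : y = rowof x by apply/rowP => i; rewrite mxE /x valK.
by rewrite weight_rowof; exact: dD.
Qed.

Lemma adm_shift F v : adm F -> adm (fun y => F (y + v)).
Proof.
by move=> /(int_affine v ltr01)[h _]; apply: eq_adm h => y; rewrite scale1r addrC.
Qed.

Lemma int_shift F v : adm F -> int_Rn (fun y => F (y + v)) = int_Rn F.
Proof.
move=> /(int_affine v ltr01)[_ ->]; rewrite expr1n mul1r.
by apply: eq_int_Rn => y; rewrite scale1r addrC.
Qed.

Lemma int_scale F r : 0 < r -> adm F -> int_Rn F = r ^+ n * int_Rn (fun y => F (r *: y)).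
Proof.
move=> r0 /(int_affine 0 r0)[_ ->]; congr *%R.
by apply: eq_int_Rn => y; rewrite add0r.
Qed.

Lemma adm_scale F r : 0 < r -> adm F -> adm (fun y => F (r *: y)).
Proof. by move=> r0 /(int_affine 0 r0)[h _]; apply: eq_adm h => y; rewrite add0r. Qed.

Lemma scont_cst a : scont (fun=> a). Proof. by move=> u x _; exact: cvg_cst. Qed.
Lemma scont_coord i : scont (fun y => y ord0 i). Proof. by move=> u x; exact. Qed.
Lemma scontD F G : scont F -> scont G -> scont (fun y => F y + G y).
Proof. by move=> cF cG u x ux; apply: cvgD; [exact: cF|exact: cG]. Qed.
Lemma scontN F : scont F -> scont (fun y => - F y).
Proof. by move=> cF u x ux; apply: cvgN; exact: cF. Qed.
Lemma scontB F G : scont F -> scont G -> scont (fun y => F y - G y).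
Proof. by move=> cF cG; apply: scontD => //; exact: scontN. Qed.
Lemma scontM F G : scont F -> scont G -> scont (fun y => F y * G y).
Proof. by move=> cF cG u x ux; apply: cvgM; [exact: cF|exact: cG]. Qed.
Lemma scontX F k : scont F -> scont (fun y => F y ^+ k).
Proof.
move=> cF; elim: k => [|k IH]; first exact: scont_cst.
by under [X in scont X]eq_fun do rewrite exprS; exact: scontM.
Qed.
Lemma scont_comp (f : R -> R) F : continuous f -> scont F -> scont (fun y => f (F y)).
Proof. by move=> cf cF u x ux; apply: continuous_cvg; [exact: cf|exact: cF]. Qed.
Lemma scont_norm F : scont F -> scont (fun y => `|F y|).
Proof. by move=> cF u x ux; apply: cvg_norm; exact: cF. Qed.
Lemma scont_sum (I : Type) (s : seq I) (F : I -> V -> R) : (forall i, scont (F i)) ->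
  scont (fun y => \sum_(i <- s) F i y).
Proof.
move=> cF; elim: s => [|i s IH].
  by under [X in scont X]eq_fun do rewrite big_nil; exact: scont_cst.
by under [X in scont X]eq_fun do rewrite big_cons; exact: scontD.
Qed.
Lemma scont_max F G : scont F -> scont G -> scont (fun y => Num.max (F y) (G y)).
Proof.
move=> cF cG.
have E y : Num.max (F y) (G y) = (F y + G y + `|F y - G y|) / 2 by rewrite maxr_absE.
under [X in scont X]eq_fun do rewrite E.
apply: scontM; last exact: scont_cst.
by apply: scontD; [exact: scontD|apply: scont_norm; exact: scontB].
Qed.
Lemma scont_min F G : scont F -> scont G -> scont (fun y => Num.min (F y) (G y)).
Proof.
move=> cF cG.
have E y : Num.min (F y) (G y) = (F y + G y - `|F y - G y|) / 2 by rewrite minr_absE.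
under [X in scont X]eq_fun do rewrite E.
apply: scontM; last exact: scont_cst.
by apply: scontB; [exact: scontD|apply: scont_norm; exact: scontB].
Qed.

Lemma cvg_rowP (u : nat -> V) x :
  (forall i, u j ord0 i @[j --> \oo] --> x ord0 i) -> u j @[j --> \oo] --> x.
Proof.
move=> ux; apply/cvg_ballP => e e0.
have : \forall j \near \oo, forall i : 'I_n, ball (x ord0 i) e (u j ord0 i).
  by apply: filter_forall => i; move/cvg_ballP : (ux i); exact.
by apply: filterS => j h; split => // i i'; rewrite ord1; exact: h.
Qed.

Lemma continuous_scont F : continuous F -> scont F.
Proof. by move=> cF u x /cvg_rowP ux; apply: continuous_cvg; [exact: cF|]. Qed.

Lemma scont_shift F v : scont F -> scont (fun y => F (y + v)).
Proof.
move=> cF u x ux; apply: cF => i; rewrite mxE.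
by under eq_fun do rewrite mxE; apply: cvgD; [exact: ux|exact: cvg_cst].
Qed.

Lemma scont_affine F r v : scont F -> scont (fun y => F (v + r *: y)).
Proof.
move=> cF u x ux; apply: cF => i; rewrite !mxE.
under eq_fun do rewrite !mxE.
by apply: cvgD; [exact: cvg_cst|apply: cvgM; [exact: cvg_cst|exact: ux]].
Qed.

Lemma scont_eps F x e : scont F -> 0 < e -> exists2 d, 0 < d &
  forall y, (forall i, `|y ord0 i - x ord0 i| < d) -> `|F y - F x| < e.
Proof.
move=> cF e0; apply: contrapT => H.
have K (j : nat) : exists y, (forall i, `|y ord0 i - x ord0 i| < j.+1%:R^-1) /\ e <= `|F y - F x|.
  apply: contrapT => h; apply: H; exists j.+1%:R^-1; first by rewrite invr_gt0.
  by move=> y hy; rewrite ltNge; apply/negP => h'; apply: h; exists y.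
pose u j := sval (cid (K j)).
have uP j := svalP (cid (K j)).
have ux i : u j ord0 i @[j --> \oo] --> x ord0 i.
  apply/cvgrPdist_lt => d d0; near=> j.
  have [/(_ i) h _] := uP j; rewrite distrC (lt_trans h)//.
  near: j; exact: near_infty_natSinv_lt (PosNum d0).
have /cvgrPdist_lt/(_ _ e0) := cF u x ux.
move=> [N _ /(_ N (leqnn N))] /=; rewrite distrC.
by have [_ h] := uP N; rewrite ltNge h.
Unshelve. all: by end_near. Qed.

End Space.

#[global] Hint Resolve scont_cst scont_coord : core.

(** * Euclidean geometry of row vectors *)

Section Geometry.
Variables (R : realType) (n : nat).
Local Notation V := 'rV[R]_n.
Implicit Types (F G : V -> R) (u v w x y z : V) (C D a b r : R).

Definition dot u v : R := \sum_(i < n) u ord0 i * v ord0 i.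
Definition nsq u : R := dot u u.

Lemma dotC u v : dot u v = dot v u.
Proof. by apply: eq_bigr => i _; rewrite mulrC. Qed.
Lemma dotDl u v w : dot (u + v) w = dot u w + dot v w.
Proof. by rewrite /dot -big_split; apply: eq_bigr => i _; rewrite mxE mulrDl. Qed.
Lemma dotZl a u v : dot (a *: u) v = a * dot u v.
Proof. by rewrite /dot mulr_sumr; apply: eq_bigr => i _; rewrite mxE mulrA. Qed.
Lemma dotDr u v w : dot w (u + v) = dot w u + dot w v.
Proof. by rewrite !(dotC w) dotDl. Qed.
Lemma dotZr a u v : dot v (a *: u) = a * dot v u.
Proof. by rewrite !(dotC v) dotZl. Qed.
Lemma dotNl u v : dot (- u) v = - dot u v.
Proof. by rewrite -scaleN1r dotZl mulN1r. Qed.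
Lemma dotNr u v : dot v (- u) = - dot v u.
Proof. by rewrite !(dotC v) dotNl. Qed.
Lemma dot0l v : dot 0 v = 0.
Proof. by rewrite -(scale0r 0) dotZl mul0r. Qed.

Lemma nsq_ge0 u : 0 <= nsq u.
Proof. by apply: sumr_ge0 => i _; rewrite -expr2 sqr_ge0. Qed.
Lemma nsq0 : nsq 0 = 0. Proof. exact: dot0l. Qed.
Lemma nsqD u v : nsq (u + v) = nsq u + 2 * dot u v + nsq v.
Proof. by rewrite /nsq !dotDl !dotDr (dotC v u); ring. Qed.
Lemma nsqN u : nsq (- u) = nsq u. Proof. by rewrite /nsq dotNl dotNr opprK. Qed.
Lemma nsqB u v : nsq (u - v) = nsq u - 2 * dot u v + nsq v.
Proof. by rewrite nsqD dotNr nsqN mulrN. Qed.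
Lemma nsqZ a u : nsq (a *: u) = a ^+ 2 * nsq u.
Proof. by rewrite /nsq dotZl dotZr mulrA. Qed.
Lemma nsq_coord u i : (u ord0 i) ^+ 2 <= nsq u.
Proof.
rewrite /nsq /dot (bigD1 i)//= -expr2 lerDl.
by apply: sumr_ge0 => j _; rewrite -expr2 sqr_ge0.
Qed.
Lemma nsq_eq0 u : nsq u = 0 -> u = 0.
Proof.
move=> u0; apply/rowP => i; rewrite mxE; apply/eqP; rewrite -sqrf_eq0 eq_le sqr_ge0 andbT -u0.
exact: nsq_coord.
Qed.

Lemma cauchy_schwarz u v : dot u v ^+ 2 <= nsq u * nsq v.
Proof.
have [v0|vn0] := eqVneq (nsq v) 0.
  by rewrite (nsq_eq0 v0) dotC dot0l expr0n mulr_ge0// nsq_ge0.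
have vp : 0 < nsq v by rewrite lt_neqAle eq_sym vn0 nsq_ge0.
have := nsq_ge0 (u - (dot u v / nsq v) *: v).
rewrite nsqB dotZr nsqZ => h.
rewrite -ler_pdivrMr// -subr_ge0; apply: le_trans h _.
by rewrite le_eqVlt; apply/orP; left; apply/eqP; field.
Qed.

Definition en u : R := Num.sqrt (nsq u).
Lemma e2normE u : e2norm u = en u.
Proof. by congr Num.sqrt; apply: eq_bigr => i _; rewrite expr2. Qed.
Lemma en_ge0 u : 0 <= en u. Proof. exact: sqrtr_ge0. Qed.
Lemma en_sq u : en u ^+ 2 = nsq u. Proof. by rewrite sqr_sqrtr// nsq_ge0. Qed.
Lemma en_dot u v : `|dot u v| <= en u * en v.
Proof.
rewrite -(ler_pXn2r (ltn0Sn 1)) ?nnegrE ?mulr_ge0 ?en_ge0//.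
by rewrite exprMn !en_sq real_normK ?num_real// cauchy_schwarz.
Qed.
Lemma en_triangle u v : en (u + v) <= en u + en v.
Proof.
rewrite -(ler_pXn2r (ltn0Sn 1)) ?nnegrE ?addr_ge0 ?en_ge0// sqrrD !en_sq nsqD.
rewrite lerD2r lerD2l mulr_natl -[leRHS]mulr_natl -mulr_natl ler_wpM2l//.
exact: le_trans (ler_norm _) (en_dot u v).
Qed.
Lemma enZ a u : en (a *: u) = `|a| * en u.
Proof. by rewrite /en nsqZ sqrtrM ?sqr_ge0// sqrtr_sqr. Qed.
Lemma enN u : en (- u) = en u. Proof. by rewrite /en nsqN. Qed.
Lemma enC u v : en (u - v) = en (v - u). Proof. by rewrite -enN opprB. Qed.
Lemma en0 : en 0 = 0. Proof. by rewrite /en nsq0 sqrtr0. Qed.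
Lemma en_coord u i : `|u ord0 i| <= en u.
Proof.
rewrite -(ler_pXn2r (ltn0Sn 1)) ?nnegrE ?en_ge0// en_sq real_normK ?num_real//.
exact: nsq_coord.
Qed.
Lemma en_split u v w : en (u - w) <= en (u - v) + en (v - w).
Proof. by rewrite (_ : u - w = (u - v) + (v - w)) ?en_triangle// addrA subrK. Qed.
Lemma en_lt_nsq u r : 0 < r -> (en u < r) = (nsq u < r ^+ 2).
Proof. by move=> r0; rewrite -en_sq ltr_pXn2r// nnegrE ?en_ge0// ltW. Qed.
Lemma en_le_nsq u r : 0 <= r -> (en u <= r) = (nsq u <= r ^+ 2).
Proof. by move=> r0; rewrite -en_sq ler_pXn2r// nnegrE ?en_ge0. Qed.
Lemma scont_dot v x : scont (fun y => dot v (y - x)).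
Proof.
apply: scont_sum => i; apply: scontM; first exact: scont_cst.
by under [X in scont X]eq_fun do rewrite !mxE; apply: scontB.
Qed.
Lemma scont_nsq x : scont (fun y => nsq (y - x)).
Proof.
apply: scont_sum => i.
by under [X in scont X]eq_fun do rewrite !mxE; apply: scontM; apply: scontB.
Qed.
Lemma scont_nsqC x : scont (fun y => nsq (x - y)).
Proof. by under [X in scont X]eq_fun do rewrite -nsqN opprB; exact: scont_nsq. Qed.
Lemma scont_en x : scont (fun y => en (y - x)).
Proof. by apply: (scont_comp (f := Num.sqrt)); [exact: sqrt_continuous|exact: scont_nsq]. Qed.

(** Where |y|^2 <= L, each of the n factors of [weight] is at least 1 / (1 + L). *)
Lemma dominated_supp F L M : 0 <= L -> (forall y, `|F y| <= M) ->
  (forall y, L < nsq y -> F y = 0) -> dominated (M * (1 + L) ^+ n) F.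
Proof.
move=> L0 FM FL y.
have M0 : 0 <= M by apply: le_trans (FM 0).
have [h|h] := leP (nsq y) L; last first.
  by rewrite FL// normr0 !mulr_ge0// ?exprn_ge0 ?addr_ge0// ltW// weight_gt0.
apply: le_trans (FM y) _; rewrite -mulrA ler_peMr//.
rewrite /weight -[in X in _ ^+ X](card_ord n) -prodr_const -big_split /=.
elim/big_ind : _ => // [a b a1 b1|i _]; first by rewrite -[leLHS]mulr1 ler_pM.
rewrite /cau ler_pdivlMr ?ltr_pwDl ?sqr_ge0// mul1r lerD2l.
exact: le_trans (nsq_coord _ _) h.
Qed.

(** Coordinatewise, with s the squared coordinate: 1 + s <= (1 + 1/a) (1 + a s) <= (1 + 1/a) exp(a
    s). *)
Lemma gauss_weight a : 0 < a -> exists2 C, 0 < C & forall y, expR (- (a * nsq y)) <= C * weight y.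
Proof.
move=> a0; exists ((1 + a^-1) ^+ n); first by rewrite exprn_gt0// ltr_pwDl// invr_ge0 ltW.
move=> y; rewrite /nsq /dot mulr_sumr -sumrN expR_sum.
rewrite -[in X in _ ^+ X](card_ord n) -prodr_const -big_split /=.
apply: ler_prod => i _; rewrite expR_ge0 /= /cau ler_pdivlMr ?ltr_pwDl ?sqr_ge0//.
rewrite -[a * _]opprK expRN opprK -expr2 mulrC ler_pdivrMr ?expR_gt0//.
set s := _ ^+ 2; have s0 : 0 <= s by exact: sqr_ge0.
apply: (@le_trans _ _ ((1 + a^-1) * (1 + a * s))); last first.
  by rewrite ler_wpM2l ?addr_ge0 ?invr_ge0 ?(ltW a0)// expR_ge1Dx.
have : (1 + a^-1) * (1 + a * s) = 1 + s + (a^-1 + a * s) by field; rewrite gt_eqF.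
by move=> ->; rewrite lerDl; apply: addr_ge0; [rewrite invr_ge0 ltW|rewrite mulr_ge0// ltW].
Qed.

Lemma scont_continuous F : scont F -> continuous F.
Proof.
move=> cF; suff H : forall x : V, F y @[y --> x] --> F x by move=> x; exact: H.
move=> x; apply/(cvgrPdist_lt (FF := @nbhs_filter V x)) => e e0.
have [d d0 H] := scont_eps x cF e0.
near=> y; rewrite distrC; apply: H => i.
have : ball x d y by near: y; exact: nbhsx_ballx.
by case=> _ /(_ ord0 i); rewrite /ball /= distrC.
Unshelve. all: by end_near. Qed.

Lemma nsq_compact L : compact [set y : V | nsq y <= L].
Proof.
apply: bounded_closed_compact.
  exists (Num.sqrt `|L|); split; first exact: num_real.
  move=> M LM y /= yL; rewrite /Num.norm /= mx_normrE.
  apply/bigmax_leP; split; first by rewrite (le_trans (sqrtr_ge0 `|L|))// ltW.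
  move=> i _; rewrite (ord1 i.1) (le_trans (en_coord _ _))// (le_trans _ (ltW LM))//.
  by rewrite ler_sqrt// (le_trans yL) ?ler_norm.
have /continuous_closedP h := scont_continuous (@scont_nsq 0).
have := h _ (@closed_le R L); congr closed.
by apply/seteqP; split => y /=; rewrite subr0.
Qed.

Lemma scont_bounded F L : scont F -> exists2 M, 0 < M & forall y, nsq y <= L -> `|F y| <= M.
Proof.
move=> /scont_continuous cF.
have /compact_near_coveringP H := @nsq_compact L.
have [|N _ h] := H nat \oo (fun k y => `|F y| <= k.+1%:R).
  move=> x _.
  have [k hk] : exists k : nat, `|F x| + 1 < k%:R.
    by exists (Num.Def.archi_bound (`|F x| + 1)); apply: archi_boundP; rewrite addr_ge0.
  exists ([set y | `|F y - F x| < 1], [set j | (k <= j)%N]).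
    split => /=; last by exists k.
    have /cvgrPdist_lt/(_ 1 ltr01) := cF x; apply: filterS => y /=; by rewrite distrC.
  case=> y j [/= hy kj]; rewrite -[F y](subrK (F x)) (le_trans (ler_normD _ _))//.
  rewrite (@le_trans _ _ (1 + `|F x|))// ?lerD2r ?ltW// addrC (lt_le_trans hk)// ler_nat.
  exact: leq_trans kj _.
by exists N.+1%:R => // y yL; exact: (h N (leqnn N)).
Qed.

Lemma scont_unif F L e : scont F -> 0 < e -> exists2 d, 0 < d &
  forall x y, nsq x <= L -> en (y - x) < d -> `|F y - F x| <= e.
Proof.
move=> cF e0.
have /compact_near_coveringP H := @nsq_compact L.
have [|d /= d0 h] := H R 0^'+ (fun d x => forall y, en (y - x) < d -> `|F y - F x| <= e).
  move=> x _.
  have [d d0 hd] := scont_eps x cF (divr_gt0 e0 (ltr0Sn _ 1)).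
  exists (ball x (d / 2), [set t | t < d / 2]).
    split => /=; first by apply: nbhsx_ballx; rewrite divr_gt0.
    by apply: nbhs_right_lt; rewrite divr_gt0.
  case=> x' t [[_ bx] /= ht] y yx'.
  rewrite (_ : F y - F x' = (F y - F x) - (F x' - F x)); last by ring.
  rewrite (le_trans (ler_normB _ _))// [leRHS]splitr lerD// ltW// hd// => i.
    have := bx ord0 i; rewrite /ball /= distrC => bi.
    have := en_coord (y - x') i; rewrite !mxE => h1.
    rewrite (_ : y ord0 i - x ord0 i = (y ord0 i - x' ord0 i) + (x' ord0 i - x ord0 i)); last by ring.
    rewrite (le_lt_trans (ler_normD _ _))// [ltRHS]splitr ltrD//.
    by rewrite (le_lt_trans h1)// (lt_trans yx').
  have := bx ord0 i; rewrite /ball /= distrC => /lt_trans; apply.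
  by rewrite ltr_pdivrMr// ltr_pMr// ltr1n.
exists (d / 2); first by rewrite divr_gt0.
move=> x y xL; apply: h => //=; rewrite ?divr_gt0//.
by rewrite sub0r normrN gtr0_norm ?divr_gt0// ltr_pdivrMr// ltr_pMr// ltr1n.
Qed.

End Geometry.

(** * Strict positivity of integrals of continuous functions *)

Section Positivity.
Variable R : realType.
Local Notation mu := (@lebesgue_measure R).

Lemma Rintegral_gt0 (G : R -> R) c t0 : continuous G -> (forall t, 0 <= G t) ->
  (forall t, `|G t| <= c * cau t) -> 0 < G t0 -> 0 < Rintegral mu setT G.
Proof.
move=> cG G0 Gc Gt0.
have mG : measurable_fun setT G by exact: continuous_measurable_fun.
have iG := integrable_dom mG Gc.
have h0 : 0 < G t0 / 2 by rewrite divr_gt0.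
have /cvgrPdist_lt/(_ _ h0) [d /= d0 hd] := cG t0.
pose A : set R := `]t0 - d, t0 + d[%classic.
have dd : t0 - d < t0 + d by rewrite ltrD2l gtrN.
have Ad t : A t -> `|t0 - t| < d.
  by rewrite /A /= in_itv/= => /andP[h1 h2]; rewrite distrC ltr_distl h1 h2.
have mA : measurable A by exact: measurable_itv.
apply: (@lt_le_trans _ _ (Rintegral mu A (cst (G t0 / 2)))).
  have mu_A : mu A = (t0 + d - (t0 - d))%:E.
    by rewrite /A lebesgue_measure_itv/= lte_fin dd EFinB.
  have e : Rintegral mu A (cst (G t0 / 2)) = G t0 / 2 * fine (mu A) := Rintegral_cst mu mA _.
  by rewrite e mu_A /= mulr_gt0// subr_gt0.
rewrite Rintegral_mkcond; apply: le_Rintegral => //; last first.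
  move=> t _; rewrite patchE; case: ifPn => [/set_mem At|_] //.
  have := hd _ (Ad _ At); rewrite ltr_norml => /andP[_]; lra.
apply: (@integrable_dom R _ (G t0 / 2 * (1 + (`|t0| + d) ^+ 2))).
  have H := proj1 (measurable_restrictT (cst (G t0 / 2)) mA).
  by apply: H; exact: measurable_cst.
move=> t; rewrite patchE; case: ifPn => [/set_mem At|_]; last first.
  by rewrite normr0 !mulr_ge0 ?cau_ge0 ?addr_ge0 ?sqr_ge0// ltW.
rewrite (ger0_norm (ltW h0)) -mulrA ler_peMr ?(ltW h0)// /cau ler_pdivlMr ?ltr_pwDl ?sqr_ge0// mul1r lerD2l.
rewrite -[t ^+ 2]real_normK ?num_real// lerXn2r ?nnegrE ?addr_ge0 ?(ltW d0)//.
by rewrite -[t](subKr t0) (le_trans (ler_normB _ _))// lerD2l ltW// Ad.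
Qed.

Lemma slice_continuous k C (g : (nat -> R) -> R) : dom k.+1 C g -> sc g ->
  continuous (fun t => iter_int k (slice g t)).
Proof.
move=> dg cg.
have H t : hm k (slice g t) by apply: sc_hm (dom_slice t dg) (sc_slice cg).
apply: seq_continuous => u t ut.
have [] := @iter_int_dct R k C (fun j => slice g (u j)) (slice g t) => //.
- move=> j x; apply: le_trans (dom_slice (u j) dg x) _.
  rewrite ler_wpM2r ?(ltW (wt_gt0 _ _))// ler_piMr ?(dom_ge0 dg)//.
  by rewrite /cau invf_le1 ?ltr_pwDl ?sqr_ge0// lerDl sqr_ge0.
- by move=> x; apply: cg => -[|i] //=; exact: cvg_cst.
Qed.

Lemma iter_int_gt0 k C (g : (nat -> R) -> R) x0 : dom k C g -> sc g -> loc k g ->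
  (forall x, 0 <= g x) -> 0 < g x0 -> 0 < iter_int k g.
Proof.
elim: k C g x0 => [|k IH] C g x0 dg cg lg g0 gx0 /=; first by rewrite (lg _ x0).
apply: (@Rintegral_gt0 (fun t => iter_int k (slice g t)) (C * bint R ^+ k) (x0 0%N)).
- exact: slice_continuous dg cg.
- by move=> t; apply: iter_int_ge0 => x; exact: g0.
- move=> t; rewrite mulrAC; apply: iter_int_bound; first exact: dom_slice.
  by apply: sc_hm (dom_slice t dg) (sc_slice cg).
- apply: (IH (C * cau (x0 0%N)) _ (fun i => x0 i.+1)).
  + exact: dom_slice.
  + exact: sc_slice.
  + by move=> x y xy; apply: lg => -[|i] //= ik; exact: xy.
  + by move=> x; exact: g0.
  + by rewrite /slice (_ : scons _ _ = x0)//; apply/funext => -[|i].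
Qed.

Variable n : nat.
Local Notation V := 'rV[R]_n.

Lemma int_gt0 C (F : V -> R) x0 : dominated C F -> scont F -> (forall y, 0 <= F y) ->
  0 < F x0 -> 0 < int_Rn F.
Proof.
move=> dF cF F0 Fx0.
pose a i := if (insub i : option 'I_n) is Some j then x0 ord0 j else 0.
have E : rowof n a = x0 by apply/rowP => i; rewrite mxE /a valK.
apply: (@iter_int_gt0 n C (F \o @rowof R n) a (dom_rowof dF) (sc_rowof cF) (@loc_rowof _ _ F)).
  by move=> x; exact: F0.
by rewrite /= E.
Qed.

Lemma int_eq0 C (F : V -> R) : dominated C F -> scont F -> (forall y, 0 <= F y) ->
  int_Rn F = 0 -> forall y, F y = 0.
Proof.
move=> dF cF F0 IF y; apply/eqP; rewrite eq_le F0 andbT leNgt; apply/negP => Fy.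
by have := int_gt0 dF cF F0 Fy; rewrite IF ltxx.
Qed.

End Positivity.

Lemma cvg_cst_eq (R : realType) (c l : R) : (fun _ : nat => c) @ \oo --> l -> l = c.
Proof. by move=> h; rewrite -(cvg_lim _ h)//; exact: lim_cst. Qed.

(** * Ball integrals and radial kernels *)

Section Balls.
Variables (R : realType) (n : nat).
Local Notation V := 'rV[R]_n.
Implicit Types (F G f : V -> R) (u v w x y z : V) (C D a b r : R).

Lemma nsq_le2 x y : nsq y <= 2 * nsq (y - x) + 2 * nsq x.
Proof.
have h := nsq_ge0 (y - x - x); move: h; rewrite nsqB => h.
have := nsqD (y - x) x; rewrite subrK => ->; lra.
Qed.

Lemma dominated_ball x b M : exists C, forall F : V -> R, (forall y, `|F y| <= M) ->
  (forall y, b < nsq (y - x) -> F y = 0) -> dominated C F.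
Proof.
exists (M * (1 + (2 * `|b| + 2 * nsq x)) ^+ n) => F FM Fb.
apply: dominated_supp => //; first by rewrite addr_ge0// mulr_ge0// nsq_ge0.
move=> y h; apply: Fb; rewrite (le_lt_trans (ler_norm b))//.
have := nsq_le2 x y; lra.
Qed.

Lemma scont_bounded_ball f x b : scont f ->
  exists2 M, 0 < M & forall y, nsq (y - x) <= b -> `|f y| <= M.
Proof.
move=> cf; have [M M0 h] := scont_bounded (2 * b + 2 * nsq x) cf.
exists M => // y yb; apply: h; have := nsq_le2 x y; lra.
Qed.

Lemma csupp_dominated F x b : scont F -> (forall y, b < nsq (y - x) -> F y = 0) ->
  exists C, dominated C F.
Proof.
move=> cF Fb; have [M M0 h] := scont_bounded_ball x b cF.
have [C HC] := dominated_ball x b M; exists C; apply: HC => // y.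
by have [/h//|/Fb->] := leP (nsq (y - x)) b; rewrite normr0 ltW.
Qed.

Lemma csupp_adm F x b : scont F -> (forall y, b < nsq (y - x) -> F y = 0) -> adm F.
Proof. by move=> cF /(csupp_dominated cF)[C h]; exact: adm_scont h cF. Qed.

(** Here [b] is the square of the radius, which keeps square roots out of the integrands. *)
Definition ballfun f x b : V -> R := fun y => if nsq (y - x) < b then f y else 0.

(** Continuous approximations to the indicator of t > 0; through them [ballfun] becomes a dominated
    limit of continuous integrands. *)
Definition ramp (j : nat) (t : R) : R := Num.min 1 (Num.max 0 (j%:R * t)).

Lemma ramp_cvg t : ramp j t @[j --> \oo] --> (if 0 < t then 1 else 0 : R).
Proof.
case: ltP => t0.
  apply: cvg_near_cst; near=> j; rewrite /ramp.
  have : 1 <= j%:R * t.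
    rewrite -ler_pdivrMr// mul1r; near: j; exact: nbhs_infty_ger.
  by move=> h; rewrite max_r ?min_l// (le_trans _ h).
apply: cvg_near_cst; near=> j; rewrite /ramp max_l ?min_r//.
by rewrite mulr_ge0_le0.
Unshelve. all: by end_near. Qed.

Lemma ramp_ge0 j t : 0 <= ramp j t.
Proof. by rewrite /ramp le_min ler01 le_max lexx. Qed.
Lemma ramp_le1 j t : ramp j t <= 1.
Proof. by rewrite /ramp ge_min lexx. Qed.
Lemma ramp_eq0 j t : t <= 0 -> ramp j t = 0.
Proof. by move=> t0; rewrite /ramp max_l ?min_r// mulr_ge0_le0. Qed.

Lemma scont_ramp j F : scont F -> scont (fun y => ramp j (F y)).
Proof.
by move=> cF; apply: scont_min => //; apply: scont_max => //; apply: scontM.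
Qed.

Lemma adm_ballfun f x b : scont f -> adm (ballfun f x b).
Proof.
move=> cf.
have [M M0 hM] := scont_bounded_ball x b cf.
have [C HC] := dominated_ball x b M.
pose F_ j := fun y => f y * ramp j (b - nsq (y - x)).
have cF j : scont (F_ j).
  by apply: scontM => //; apply: scont_ramp; apply: scontB => //; exact: scont_nsq.
have F0 j y : b < nsq (y - x) -> F_ j y = 0.
  by move=> h; rewrite /F_ ramp_eq0 ?mulr0// subr_le0 ltW.
have dF j : dominated C (F_ j).
  apply: HC => [y|]; last exact: F0.
  have [h|/F0->] := leP (nsq (y - x)) b; last by rewrite normr0 ltW.
  rewrite normrM (ger0_norm (ramp_ge0 _ _)) (le_trans _ (hM _ h))//.
  by rewrite ler_piMr// ramp_le1.
have [] // := @int_dct _ _ C F_ (ballfun f x b) dF (fun j => adm_scont (dF j) (cF j)).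
move=> y; rewrite /ballfun (_ : (if _ then _ else _) = f y * (if 0 < b - nsq (y - x) then 1 else 0)).
  by apply: cvgM; [exact: cvg_cst|exact: ramp_cvg].
by rewrite subr_gt0; case: ifP; rewrite ?mulr1 ?mulr0.
Qed.

Definition ballint f x b : R := int_Rn (ballfun f x b).

(* Step-function approximation of the profile [k]. *)
Lemma radial_kernel0 f x (B : R) (k : R -> R) : 0 < B -> scont f -> continuous k ->
  (forall a, B <= a -> k a = 0) ->
  (forall b, 0 < b -> b <= B -> ballint f x b = 0) ->
  int_Rn (fun y => f y * k (nsq (y - x))) = 0.
Proof.
move=> B0 cf ck kB Hb.
pose t N j : R := j%:R * B / N.+1%:R.
pose s N (a : R) : R := \sum_(0 <= j < N.+1) (k (t N j) - k (t N j.+1)) * (if a < t N j.+1 then 1 else 0).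
have tm N i j : (i <= j)%N -> t N i <= t N j.
  by move=> ij; rewrite /t -!mulrA ler_wpM2r ?ler_nat// mulr_ge0// ltW.
have tB N : t N N.+1 = B by rewrite /t mulrAC divff ?mul1r// pnatr_eq0.
have sE N a : 0 <= a -> a < B -> exists2 i, s N a = k (t N i) & t N i <= a < t N i + B / N.+1%:R.
  move=> a0 aB; pose i := Num.truncn (a * N.+1%:R / B).
  have p0 : 0 <= a * N.+1%:R / B by rewrite divr_ge0 ?mulr_ge0// ltW.
  have /andP[h1 h2] : i%:R <= a * N.+1%:R / B < i.+1%:R by apply: truncn_itv.
  have g1 : t N i <= a by rewrite /t ler_pdivrMr// -ler_pdivlMr.
  have g2 : a < t N i.+1 by rewrite /t ltr_pdivlMr// -ltr_pdivrMr.
  have iN : (i < N.+1)%N.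
    by rewrite ltnNge; apply/negP => /(tm N); rewrite tB => h; have := le_trans h g1; rewrite leNgt aB.
  exists i; last by rewrite g1 (lt_le_trans g2)// /t -natr1 mulrDl mul1r mulrDl.
  (* The terms with j < i vanish, and those with j >= i telescope to [k (t N i) - k B], where
     [k B = 0]. *)
  rewrite /s (big_cat_nat (leq0n i) (ltnW iN)) /= big_nat big1 ?add0r; last first.
    move=> j /andP[_ ji]; rewrite ifF ?mulr0//; apply/negbTE; rewrite -leNgt.
    exact: le_trans (tm _ _ _ ji) g1.
  rewrite big_nat (eq_bigr (fun j => - (k (t N j.+1) - k (t N j)))); last first.
    by move=> j /andP[ij _]; rewrite (lt_le_trans g2 (tm _ _ _ _))// mulr1 opprB.
  rewrite -big_nat sumrN telescope_sumr; last exact: ltnW.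
  by rewrite tB kB// sub0r opprK.
have sE0 N a : B <= a -> s N a = 0.
  move=> Ba; rewrite /s big_nat big1// => j /andP[_ jN]; rewrite ifF ?mulr0//.
  by apply/negbTE; rewrite -leNgt (le_trans _ Ba)// -(tB N) tm.
have sk a : 0 <= a -> s N a @[N --> \oo] --> k a.
  move=> a0; have [Ba|aB] := leP B a.
    by rewrite kB//; under eq_fun do rewrite sE0//; exact: cvg_cst.
  apply/cvgrPdist_lt => e e0.
  have /cvgrPdist_lt/(_ _ e0)[d /= d0 hd] := ck a.
  near=> N; have [i -> /andP[h1 h2]] := sE N a a0 aB.
  apply: hd => /=; rewrite ger0_norm ?subr_ge0// ltrBlDl (lt_trans h2)// ltrD2l.
  rewrite ltr_pdivrMr// mulrC -ltr_pdivrMr//.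
  have : B / d < N%:R by near: N; exact: nbhs_infty_gtr.
  by move=> /lt_trans; apply; rewrite ltr_nat.
have [K K0 HK] : exists2 K, 0 <= K & forall a, 0 <= a -> a <= B -> `|k a| <= K.
  have /compact_bounded [K [Kr HK]] : compact (k @` `[0, B]).
    by apply: continuous_compact; [exact: continuous_subspaceT|exact: segment_compact].
  exists (`|K| + 1); first by rewrite addr_ge0.
  move=> a a0 aB; apply: (HK (`|K| + 1)).
    by rewrite (le_lt_trans (ler_norm _))// ltrDl.
  by exists a => //=; rewrite in_itv/= a0 aB.
have t0 N i : 0 <= t N i by rewrite /t divr_ge0 ?mulr_ge0// ltW.
have sK N a : 0 <= a -> `|s N a| <= K.
  move=> a0; have [/sE0->|aB] := leP B a; first by rewrite normr0.
  have [i -> /andP[h1 h2]] := sE N a a0 aB.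
  by apply: HK => //; rewrite (le_trans h1)// ltW.
have [M M0 hM] := scont_bounded_ball x B cf.
have [C HC] := dominated_ball x B (M * K).
pose F_ N := fun y => f y * s N (nsq (y - x)).
have aF N : adm (F_ N) /\ int_Rn (F_ N) = 0.
  have E y : F_ N y = \sum_(j <- iota 0 N.+1) (k (t N j) - k (t N j.+1)) * ballfun f x (t N j.+1) y.
    rewrite /F_ /s /index_iota subn0 mulr_sumr; apply: eq_bigr => j _.
    by rewrite /ballfun; case: ifP => _; rewrite ?mulr0 ?mulr1// mulrC.
  have aj j : adm (fun y => (k (t N j) - k (t N j.+1)) * ballfun f x (t N j.+1) y).
    by apply: admZ; exact: adm_ballfun.
  split; first by apply: eq_adm (adm_sum _ aj) => y; rewrite E.
  rewrite (eq_int_Rn E) int_Rn_sum// big_seq big1// => j; rewrite mem_iota add0n => /andP[_ jN].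
  rewrite int_RnZ ?[int_Rn _]Hb ?mulr0//; last exact: adm_ballfun.
    by rewrite /t divr_gt0// mulr_gt0.
  by rewrite -(tB N) tm.
have [|||_] := @int_dct _ _ C F_ (fun y => f y * k (nsq (y - x))).
- move=> N; apply: HC => [y|y h].
    have [h|h] := leP (nsq (y - x)) B; last by rewrite /F_ sE0 ?mulr0 ?normr0 ?mulr_ge0// ltW.
    by rewrite normrM ler_pM// ?hM// sK// nsq_ge0.
  by rewrite /F_ sE0 ?mulr0// ltW.
- by move=> N; have [] := aF N.
- by move=> y; apply: cvgM; [exact: cvg_cst|apply: sk; exact: nsq_ge0].
have -> : (fun N => int_Rn (F_ N)) = (fun=> 0) by apply/funext => N; have [] := aF N.
exact: cvg_cst_eq.
Unshelve. all: by end_near. Qed.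

End Balls.

(** * Mollification *)

Section Mollifier.
Variables (R : realType) (n : nat).
Local Notation V := 'rV[R]_n.
Implicit Types (F G f : V -> R) (u v w x y z : V) (C D a b r e : R).

Lemma scont_of_en F : (forall x e, 0 < e -> exists2 d, 0 < d &
  forall y, en (y - x) < d -> `|F y - F x| <= e) -> scont F.
Proof.
move=> H u x ux; apply/cvgrPdist_le => e e0; have [d d0 hd] := H x e e0.
have : en (u j - x) @[j --> \oo] --> en (x - x) by exact: (@scont_en R n x u x ux).
rewrite subrr en0 => /cvgrPdist_lt/(_ d d0); apply: filterS => j.
by rewrite sub0r normrN ger0_norm ?en_ge0// distrC => /hd.
Qed.

(** A profile in the squared distance, supported in the ball of squared radius [e]. Squaring the
    positive part is the cheapest way to a first-order Taylor formula with quadratic remainder,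
    which is all the smoothness used later. *)
Definition mker e a : R := (Num.max 0 (e - a)) ^+ 2.

Lemma mker_ge0 e a : 0 <= mker e a. Proof. exact: sqr_ge0. Qed.

Lemma mker_eq0 e a : e <= a -> mker e a = 0.
Proof. by move=> h; rewrite /mker max_l ?expr0n// subr_le0. Qed.

Lemma mker_taylor e a b :
  `|mker e b - mker e a - (-2 * Num.max 0 (e - a)) * (b - a)| <= (b - a) ^+ 2.
Proof.
rewrite /mker (_ : b - a = (e - a) - (e - b)); last by ring.
move: (e - a) (e - b) => p q; rewrite ler_norml.
have h1 := sqr_ge0 (p - q); have h2 := sqr_ge0 p; have h3 := sqr_ge0 q.
case: (leP p 0) => hp; case: (leP q 0) => hq.
- by rewrite !expr0n /= !(mulr0, mul0r) !subr0 oppr_le0 h1.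
- have := mulr_le0_ge0 hp (ltW hq) => h.
  by rewrite expr0n /= !(mulr0, mul0r) !subr0; apply/andP; split; nra.
- have := mulr_ge0_le0 (ltW hp) hq => h.
  by rewrite expr0n /= ; apply/andP; split; nra.
- by apply/andP; split; nra.
Qed.

Lemma scont_mker e F : scont F -> scont (fun y => mker e (F y)).
Proof. by move=> cF; apply: scontX; apply: scont_max => //; apply: scontB. Qed.

Lemma adm_mker F e x : scont F -> adm (fun y => F y * mker e (nsq (y - x))).
Proof.
move=> cF; apply: (@csupp_adm _ _ _ x e).
  by apply: scontM => //; apply: scont_mker; exact: scont_nsq.
by move=> y h; rewrite mker_eq0 ?mulr0// ltW.
Qed.

Lemma adm_mker1 e : adm (fun y : V => mker e (nsq y)).
Proof.
by apply: eq_adm (adm_mker e 0 (@scont_cst R n 1)) => y; rewrite subr0 mul1r.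
Qed.

Definition mmass e : R := int_Rn (fun z : V => mker e (nsq z)).

Lemma mmass_gt0 e : 0 < e -> 0 < mmass e.
Proof.
move=> e0; have c1 : scont (fun y : V => 1 * mker e (nsq (y - 0))).
  by apply: scontM => //; apply: scont_mker; exact: scont_nsq.
have [|C dC] := @csupp_dominated _ _ _ 0 e c1.
  by move=> y h; rewrite mker_eq0 ?mulr0// ltW.
rewrite /mmass (eq_int_Rn (G := fun y : V => 1 * mker e (nsq (y - 0)))); last first.
  by move=> y; rewrite subr0 mul1r.
apply: (int_gt0 (x0 := 0) dC c1) => [y|]; first by rewrite mul1r mker_ge0.
by rewrite subrr nsq0 mul1r /mker subr0 max_r ?exprn_gt0// ltW.
Qed.

Definition moll e F x : R := (mmass e)^-1 * int_Rn (fun y => F y * mker e (nsq (y - x))).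

Lemma mollE e F x : scont F ->
  moll e F x = (mmass e)^-1 * int_Rn (fun z => F (z + x) * mker e (nsq z)).
Proof.
move=> cF; congr *%R; rewrite -(int_shift x (adm_mker e x cF)).
by apply: eq_int_Rn => y; rewrite addrK.
Qed.

Lemma adm_mollE e F x : scont F -> adm (fun z => F (z + x) * mker e (nsq z)).
Proof.
move=> cF; apply: eq_adm (adm_mker e 0 (scont_shift (v := x) cF)) => y.
by rewrite subr0.
Qed.

Lemma moll_diff e F G x x' c : 0 < e -> scont F -> scont G ->
  (forall z, nsq z < e -> `|F (z + x) - G (z + x')| <= c) ->
  `|moll e F x - moll e G x'| <= c.
Proof.
move=> e0 cF cG H; rewrite !mollE// -mulrBr -int_RnB; try exact: adm_mollE.
have m0 := mmass_gt0 e0.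
rewrite normrM gtr0_norm ?invr_gt0// mulrC ler_pdivrMr// /mmass -int_RnZ; last exact: adm_mker1.
apply: le_norm_int.
- by apply: admB; exact: adm_mollE.
- by apply: admZ; exact: adm_mker1.
- move=> y; rewrite -mulrBl normrM (ger0_norm (mker_ge0 _ _)).
  have [h|h] := ltP (nsq y) e; last by rewrite mker_eq0 ?mulr0.
  by rewrite ler_wpM2r ?mker_ge0// H.
Qed.

Lemma moll_cst e c x : 0 < e -> moll e (fun=> c) x = c.
Proof.
move=> e0; rewrite mollE// int_RnZ -/(mmass e); last exact: adm_mker1.
by rewrite mulrC mulfK// gt_eqF// mmass_gt0.
Qed.

Lemma moll_near e F x a c : 0 < e -> scont F ->
  (forall z, nsq z < e -> `|F (z + x) - a| <= c) -> `|moll e F x - a| <= c.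
Proof. by move=> e0 cF H; rewrite -[X in _ - X](@moll_cst e a x)//; apply: moll_diff. Qed.

(** The gradient of [moll e F]: the derivative in x of the squared positive part of e - |y - x|^2 is
    4 (e - |y - x|^2)_+ (y - x). *)
Definition mgrad e F x : V := \row_i ((mmass e)^-1 *
  int_Rn (fun y => F y * (4 * Num.max 0 (e - nsq (y - x)) * (y - x) ord0 i))).

Lemma adm_mgrad e F x i :
  scont F -> adm (fun y => F y * (4 * Num.max 0 (e - nsq (y - x)) * (y - x) ord0 i)).
Proof.
move=> cF; apply: (@csupp_adm _ _ _ x e).
  apply: scontM => //; apply: scontM; last first.
    by under [X in scont X]eq_fun do rewrite !mxE; apply: scontB.
  by apply: scontM => //; apply: scont_max => //; apply: scontB => //; exact: scont_nsq.
by move=> y h; rewrite max_l ?(mulr0, mul0r)// subr_le0 ltW.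
Qed.

Lemma mgradE e F x v : scont F ->
  dot (mgrad e F x) v = (mmass e)^-1 *
    int_Rn (fun y => F y * (4 * Num.max 0 (e - nsq (y - x)) * dot (y - x) v)).
Proof.
move=> cF.
transitivity (\sum_(i < n) (mmass e)^-1 *
  int_Rn (fun y => v ord0 i * (F y * (4 * Num.max 0 (e - nsq (y - x)) * (y - x) ord0 i)))).
  by apply: eq_bigr => i _; rewrite mxE int_RnZ; [ring|exact: adm_mgrad].
rewrite -mulr_sumr -int_Rn_sum; last by move=> i; apply: admZ; exact: adm_mgrad.
congr *%R; apply: eq_int_Rn => y; rewrite /dot !mulr_sumr; apply: eq_bigr => i _.
by ring.
Qed.

Lemma adm_mgradE e F x v :
  scont F -> adm (fun y => F y * (4 * Num.max 0 (e - nsq (y - x)) * dot (y - x) v)).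
Proof.
move=> cF; apply: (@csupp_adm _ _ _ x e).
  apply: scontM => //; apply: scontM; last first.
    by under [X in scont X]eq_fun do rewrite dotC; exact: scont_dot.
  by apply: scontM => //; apply: scont_max => //; apply: scontB => //; exact: scont_nsq.
by move=> y h; rewrite max_l ?(mulr0, mul0r)// subr_le0 ltW.
Qed.

(** The ball of radius sqrt e + 2 contains the supports of the kernel centred at 0 and at every v
    with |v| <= 1, so it carries the whole Taylor remainder. *)
Definition fatball e (w : V) : R := if nsq w < (Num.sqrt e + 2) ^+ 2 then 1 else 0.

Lemma fatball_ge0 e w : 0 <= fatball e w.
Proof. by rewrite /fatball; case: ifP. Qed.

Lemma adm_fatball e x : adm (fun y => fatball e (y - x)).
Proof.
have := @adm_ballfun R n (fun=> 1) x ((Num.sqrt e + 2) ^+ 2) (@scont_cst R n 1).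
by apply: eq_adm.
Qed.

Lemma mker_grad_bound e w v : 0 < e ->
  `|4 * Num.max 0 (e - nsq w) * dot w v| <= 4 * e * Num.sqrt e * en v * fatball e w.
Proof.
move=> e0; have [h|h] := ltP (nsq w) e; last first.
  rewrite max_l ?subr_le0// mulr0 mul0r normr0.
  by rewrite !mulr_ge0 ?sqrtr_ge0 ?en_ge0 ?fatball_ge0// ltW.
have s0 := sqrtr_ge0 e; have sq : Num.sqrt e ^+ 2 = e by rewrite sqr_sqrtr// ltW.
have -> : fatball e w = 1 by rewrite /fatball ifT// (lt_trans h)// -[ltLHS]sq ltrXn2r// ?nnegrE; lra.
have wq : en w <= Num.sqrt e by rewrite /en ler_sqrt ltW.
rewrite mulr1 normrM -mulrA; apply: ler_pM => //.
  have h' : 0 <= e - nsq w by rewrite subr_ge0 ltW.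
  rewrite (max_r h') ger0_norm; last by rewrite mulr_ge0.
  have := nsq_ge0 w; lra.
by apply: le_trans (en_dot _ _) _; rewrite ler_wpM2r ?en_ge0.
Qed.

Lemma mker_remainder e w v : 0 < e -> en v <= 1 ->
  `|mker e (nsq (w - v)) - mker e (nsq w) - 4 * Num.max 0 (e - nsq w) * dot w v| <=
  ((2 * (Num.sqrt e + 2) + 1) ^+ 2 + 2 * e) * nsq v * fatball e w.
Proof.
move=> e0 v1.
have s0 := sqrtr_ge0 e; have sq : Num.sqrt e ^+ 2 = e by rewrite sqr_sqrtr// ltW.
set q := Num.sqrt e in s0 sq *.
have far a : q <= a -> e <= a ^+ 2.
  by move=> qa; rewrite -sq lerXn2r ?nnegrE// (le_trans s0).
have v0 := en_ge0 v; have w0 := en_ge0 w.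
have [wq|wq] := ltP (en w) (q + 2); last first.
  have h1 := en_triangle (w - v) v; rewrite subrK in h1.
  have h2 : e <= nsq (w - v) by rewrite -en_sq far//; lra.
  have h3 : e <= nsq w by rewrite -en_sq far//; lra.
  rewrite !mker_eq0// max_l ?subr_le0// !(mulr0, mul0r) !subr0 normr0.
  by rewrite !mulr_ge0 ?nsq_ge0 ?fatball_ge0// addr_ge0 ?sqr_ge0// mulr_ge0// ltW.
have -> : fatball e w = 1 by rewrite /fatball ifT// -en_lt_nsq//; lra.
(* The argument changes by -2<w,v> + |v|^2. Its square gives the first summand of the constant; the
   second bounds the term -2 m |v|^2 that the linear part leaves over. *)
have := mker_taylor e (nsq w) (nsq (w - v)).
have Ea : nsq (w - v) - nsq w = - (2 * dot w v) + nsq v by rewrite nsqB; ring.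
rewrite Ea; set m := Num.max _ _ => T.
have mge : 0 <= m by rewrite /m le_max lexx.
have mle : m <= e by rewrite /m ge_max ltW //= gerBl nsq_ge0.
have d1 : `|dot w v| <= (q + 2) * en v.
  by apply: le_trans (en_dot _ _) _; rewrite ler_wpM2r// ltW.
set d := dot w v in d1 T *.
rewrite (_ : _ - _ = (mker e (nsq (w - v)) - mker e (nsq w) - -2 * m * (- (2 * d) + nsq v)) - 2 * m * nsq v); last by ring.
have -> : ((2 * (q + 2) + 1) ^+ 2 + 2 * e) * nsq v * 1 =
  (2 * (q + 2) + 1) ^+ 2 * nsq v + 2 * e * nsq v by ring.
apply: le_trans (ler_normB _ _) _; apply: lerD.
  apply: le_trans T _.
  rewrite -[nsq v]en_sq -exprMn -[leLHS]real_normK ?num_real// lerXn2r ?nnegrE ?mulr_ge0//; first lra.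
  rewrite (le_trans (ler_normD _ _))// normrN normrM normr_nat (ger0_norm (sqr_ge0 _)).
  have : en v ^+ 2 <= en v by rewrite expr2 ler_piMl.
  lra.
rewrite ger0_norm; last by rewrite !mulr_ge0// nsq_ge0.
by rewrite ler_wpM2r ?nsq_ge0// ler_wpM2l.
Qed.

Lemma moll_C1 e F M : 0 < e -> scont F -> (forall y, `|F y| <= M) ->
  exists2 C, 0 < C & (forall x v, en v <= 1 ->
    `|moll e F (x + v) - moll e F x - dot (mgrad e F x) v| <= C * nsq v) /\
  (forall x v, `|dot (mgrad e F x) v| <= C * en v).
Proof.
move=> e0 cF FM.
have M0 : 0 <= M by apply: le_trans (FM 0).
have m0 := mmass_gt0 e0.
pose I0 : R := int_Rn (fun y : V => fatball e y).
have I00 : 0 <= I0 by apply: int_Rn_ge0 => y; exact: fatball_ge0.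
have iJ x : int_Rn (fun y : V => fatball e (y - x)) = I0.
  by rewrite (int_shift (- x) (F := fatball e))//; apply: eq_adm (adm_fatball e 0) => y; rewrite subr0.
have key C (H : V -> R) x : 0 <= C -> adm H ->
    (forall y, `|H y| <= C * fatball e (y - x)) -> `|(mmass e)^-1 * int_Rn H| <= (mmass e)^-1 * (C * I0).
  move=> C0 aH HC; rewrite normrM gtr0_norm ?invr_gt0// ler_pM2l ?invr_gt0//.
  rewrite -(iJ x) -int_RnZ; last exact: adm_fatball.
  by apply: le_norm_int => //; apply: admZ; exact: adm_fatball.
have s0 := sqrtr_ge0 e.
pose K1 := (2 * (Num.sqrt e + 2) + 1) ^+ 2 + 2 * e.
pose K2 := 4 * e * Num.sqrt e.
have K10 : 0 <= K1 by rewrite addr_ge0 ?sqr_ge0// mulr_ge0// ltW.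
have K20 : 0 <= K2 by rewrite !mulr_ge0// ltW.
pose A1 := (mmass e)^-1 * (M * K1 * I0); pose A2 := (mmass e)^-1 * (M * K2 * I0).
have A10 : 0 <= A1 by rewrite !mulr_ge0 ?invr_ge0// ltW.
have A20 : 0 <= A2 by rewrite !mulr_ge0 ?invr_ge0// ltW.
exists (A1 + A2 + 1); first by lra.
split=> x v.
- move=> v1.
  have -> : moll e F (x + v) - moll e F x - dot (mgrad e F x) v =
    (mmass e)^-1 * int_Rn (fun y => F y * mker e (nsq (y - (x + v))) - F y * mker e (nsq (y - x))
       - F y * (4 * Num.max 0 (e - nsq (y - x)) * dot (y - x) v)).
    rewrite mgradE// /moll -!mulrBr -!int_RnB//; try exact: adm_mker; try exact: adm_mgradE.
    by apply: admB; exact: adm_mker.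
  apply: (@le_trans _ _ (A1 * nsq v)); last by rewrite ler_wpM2r ?nsq_ge0//; lra.
  rewrite (_ : A1 * nsq v = (mmass e)^-1 * (M * K1 * nsq v * I0)); last by rewrite /A1; ring.
  apply: (key _ _ x).
  + by rewrite !mulr_ge0// nsq_ge0.
  + apply: admB; last exact: adm_mgradE.
    by apply: admB; exact: adm_mker.
  + move=> y; rewrite -!mulrBr normrM -!mulrA; apply: ler_pM => //.
    rewrite (_ : y - (x + v) = (y - x) - v); last by rewrite opprD addrA.
    by have := mker_remainder (y - x) e0 v1; rewrite -!mulrA.
- rewrite mgradE//; apply: (@le_trans _ _ (A2 * en v)); last by rewrite ler_wpM2r ?en_ge0//; lra.
  rewrite (_ : A2 * en v = (mmass e)^-1 * (M * K2 * en v * I0)); last by rewrite /A2; ring.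
  apply: (key _ _ x).
  + by apply: mulr_ge0; [exact: mulr_ge0|exact: en_ge0].
  + exact: adm_mgradE.
  + move=> y; rewrite normrM -!mulrA; apply: ler_pM => //.
    by have := mker_grad_bound (y - x) v e0; rewrite /K2 !mulrA.
Qed.

Lemma scont_moll e F M : 0 < e -> scont F -> (forall y, `|F y| <= M) -> scont (moll e F).
Proof.
move=> e0 cF FM; have [C C0 [H1 H2]] := moll_C1 e0 cF FM.
apply: scont_of_en => x d d0.
have C2 : 0 < 2 * C by rewrite mulr_gt0.
exists (Num.min 1 (d / (2 * C))); first by rewrite lt_min ltr01 divr_gt0.
move=> y; rewrite lt_min => /andP[/ltW v1 v2].
have := H1 x (y - x) v1; rewrite (addrC x) subrK => h1; have h2 := H2 x (y - x).
rewrite ltr_pdivlMr// in v2.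
have h3 : nsq (y - x) <= en (y - x) by rewrite -en_sq expr2 ler_piMl ?en_ge0.
rewrite -[X in `|X|](subrK (dot (mgrad e F x) (y - x))) (le_trans (ler_normD _ _))//.
by nra.
Qed.

End Mollifier.

(** * From spherical means to ball integrals *)

Section Calculus.
Variable R : realType.
Implicit Types (a : R -> R).

(** Outer shells yield only a right derivative, so the mean value theorem does not apply. Instead,
    the supremum of the radii up to which |a s - a r0| <= e (s - r0) holds is shown to be r1. *)
Lemma right_derivative0_const a r0 r1 : r0 <= r1 ->
  (forall r, r0 <= r -> r <= r1 -> {for r, continuous a}) ->
  (forall r, r0 <= r -> r < r1 -> forall e, 0 < e -> exists2 d, 0 < d &
     forall h, 0 < h -> h < d -> `|a (r + h) - a r| <= e * h) ->
  a r1 = a r0.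
Proof.
move=> r01 ca da.
suff H : forall e, 0 < e -> `|a r1 - a r0| <= e * (r1 - r0).
  apply/eqP; rewrite -subr_eq0 -normr_le0; apply/ler_addgt0Pl => e e0; rewrite addr0.
  have p : 0 < r1 - r0 + 1 by rewrite ltr_wpDl// subr_ge0.
  apply: le_trans (H (e / (r1 - r0 + 1)) (divr_gt0 e0 p)) _.
  by rewrite -mulrA ler_piMr ?(ltW e0)// mulrC ler_pdivrMr// mul1r lerDl.
move=> e e0.
pose S := [set r | r0 <= r /\ r <= r1 /\ forall s, r0 <= s -> s <= r -> `|a s - a r0| <= e * (s - r0)].
have S0 : S r0.
  split=> //; split=> // s h1 h2; have -> : s = r0 by apply/eqP; rewrite eq_le h1 h2.
  by rewrite !subrr normr0 mulr0.
have hS : has_sup S by split; [exists r0|exists r1 => r [_ []]].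
pose c := sup S.
have r0c : r0 <= c by apply: (sup_upper_bound hS).
have cr1 : c <= r1 by apply: ge_sup; [exists r0|move=> r [_ []]].
have below s : r0 <= s -> s < c -> `|a s - a r0| <= e * (s - r0).
  move=> h1 h2; have [r [_ [_ Hr]] sr] := sup_adherent (ltac:(by rewrite subr_gt0; exact: h2) : 0 < c - s) hS.
  by apply: Hr => //; move: sr; rewrite opprB addrCA subrr addr0 => /ltW.
have atc : `|a c - a r0| <= e * (c - r0).
  apply/ler_addgt0Pr => d d0.
  have [->|r0nc] := eqVneq r0 c; first by rewrite !subrr normr0 mulr0 add0r ltW.
  have r0c' : r0 < c by rewrite lt_neqAle r0nc.
  have /cvgrPdist_lt/(_ d d0)[k /= k0 Hk] := ca c r0c cr1.
  pose s := Num.max r0 (c - k / 2).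
  have sc : s < c by rewrite /s gt_max r0c' /= gtrBl divr_gt0.
  have rs : r0 <= s by rewrite /s le_max lexx.
  have : `|a c - a s| < d.
    apply: Hk => /=; rewrite gtr0_norm ?subr_gt0// ltrBlDl -ltrBlDr /s lt_max; apply/orP; right.
    by rewrite ltrD2l ltrN2 ltr_pdivrMr// ltr_pMr// ltr1n.
  have := below s rs sc => h1 h2.
  have h3 : e * (s - r0) <= e * (c - r0) by rewrite ler_pM2l// lerD2r ltW.
  have := ler_normD (a c - a s) (a s - a r0).
  rewrite (_ : a c - a s + (a s - a r0) = a c - a r0); last by ring.
  lra.
have [cr|] := ltP c r1; last first.
  by move=> r1c; have <- : c = r1 by apply/eqP; rewrite eq_le cr1 r1c.
exfalso; have [d d0 Hd] := da c r0c cr e e0.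
pose c' := Num.min r1 (c + d / 2).
have cc' : c < c' by rewrite /c' lt_min cr ltrDl divr_gt0.
suff : S c' by move=> /(sup_upper_bound hS); rewrite leNgt cc'.
split; first by rewrite (le_trans r0c)// ltW.
split; first by rewrite /c' ge_min lexx.
move=> s h1 h2; have [sc|cs] := ltP s c; first exact: below.
have [->//|snc] := eqVneq s c.
have cs' : c < s by rewrite lt_neqAle eq_sym snc.
have sd : s - c < d.
  rewrite ltrBlDl (le_lt_trans h2)// /c' gt_min; apply/orP; right.
  by rewrite ltrD2l ltr_pdivrMr// ltr_pMr// ltr1n.
have := Hd (s - c) (ltac:(by rewrite subr_gt0)) sd; rewrite (addrC c) subrK => h3.
have := ler_normD (a s - a c) (a c - a r0).
rewrite (_ : a s - a c + (a c - a r0) = a s - a r0); last by ring.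
lra.
Qed.

Lemma quot_aux (x t j : R) : j != 0 -> x * j = (x - j^-1 * t) * j + t.
Proof. by move=> j0; field. Qed.

Lemma pow_taylor (r : R) n : 0 <= r -> exists2 K, 0 <= K & forall h, 0 <= h -> h <= 1 ->
  `|(r + h) ^+ n - r ^+ n - n%:R * r ^+ n.-1 * h| <= K * h ^+ 2.
Proof.
move=> r0; elim: n => [|n [K K0 IH]].
  by exists 0 => // h _ _; rewrite !expr0 !mul0r !subrr normr0.
exists ((r + 1) * K + n%:R * r ^+ n.-1).
  by rewrite addr_ge0// ?mulr_ge0// ?exprn_ge0// addr_ge0.
move=> h h0 h1; have := IH h h0 h1.
have E : n%:R * r ^+ n.-1 * r = n%:R * r ^+ n.
  by case: n {IH} => [|n] /=; rewrite ?mul0r// -mulrA -exprSr.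
set D := (r + h) ^+ n - _ - _ => HD.
have -> : (r + h) ^+ n.+1 - r ^+ n.+1 - n.+1%:R * r ^+ n.+1.-1 * h =
  (r + h) * D + n%:R * r ^+ n.-1 * h ^+ 2.
  rewrite /D /= !exprS (_ : n.+1%:R * r ^+ n = n%:R * r ^+ n.-1 * r + r ^+ n); last first.
    by rewrite E -natr1 mulrDl mul1r.
  by ring.
apply: le_trans (ler_normD _ _) _; rewrite [leRHS]mulrDl; apply: lerD.
  rewrite normrM ger0_norm ?addr_ge0// -[leRHS]mulrA ler_pM ?addr_ge0//.
  by rewrite lerD2l.
by rewrite ger0_norm// !mulr_ge0// exprn_ge0.
Qed.

Lemma pow_lip (r : R) n : 0 <= r -> exists2 K, 0 <= K & forall h, 0 <= h -> h <= 1 ->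
  (r + h) ^+ n - r ^+ n <= K * h.
Proof.
move=> r0; have [K K0 H] := pow_taylor n r0; exists (K + n%:R * r ^+ n.-1).
  by rewrite addr_ge0// mulr_ge0// exprn_ge0.
move=> h h0 h1; have := H h h0 h1; rewrite ler_norml => /andP[_].
rewrite lerBlDr => /le_trans; apply; rewrite mulrDl lerD2r.
by rewrite ler_wpM2l// expr2 ler_piMl.
Qed.
End Calculus.

Section SphericalMeans.
Variables (R : realType) (n : nat).
Local Notation V := 'rV[R]_n.
Implicit Types (f g F G : V -> R) (u v w x y z p : V) (C D a b r s h e : R).

Lemma ballint_scale f p r : 0 < r -> scont f ->
  ballint f p (r ^+ 2) = r ^+ n * ballint (fun z => f (p + r *: z)) 0 1.
Proof.
move=> r0 cf; rewrite /ballint; have [_ ->] := int_affine p r0 (adm_ballfun p (r ^+ 2) cf).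
congr *%R; apply: eq_int_Rn => y; rewrite /ballfun addrAC subrr add0r subr0 nsqZ.
by rewrite -[X in _ < X]mulr1 ltr_pM2l ?exprn_gt0.
Qed.

Definition uvol : R := ballint (fun _ : V => 1) 0 1.

Lemma ballint1 p r : 0 < r -> ballint (fun _ : V => 1) p (r ^+ 2) = r ^+ n * uvol.
Proof. by move=> r0; rewrite ballint_scale. Qed.

Lemma uvol_ge0 : 0 <= uvol.
Proof. by apply: int_Rn_ge0 => y; rewrite /ballfun; case: ifP. Qed.

(** For a shell of thickness h the right side is O(c h): a uniform approximation of f changes the
    quotient by h only by a multiple of c. *)
Lemma shell_diff f g p r s c : 0 < r -> r <= s -> scont f -> scont g ->
  (forall y, nsq (y - p) <= s ^+ 2 -> `|f y - g y| <= c) ->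
  `|(ballint f p (s ^+ 2) - ballint f p (r ^+ 2)) - (ballint g p (s ^+ 2) - ballint g p (r ^+ 2))|
    <= c * ((s ^+ n - r ^+ n) * uvol).
Proof.
move=> r0 rs cf cg H; have s0 := lt_le_trans r0 rs.
rewrite mulrBl -!(ballint1 p)// /ballint -!int_RnB; try by [exact: adm_ballfun|apply: admB; exact: adm_ballfun].
have a1 b : adm (ballfun (fun _ : V => 1) p b) by exact: adm_ballfun.
rewrite -int_RnZ; last exact: admB.
apply: le_norm_int.
- by apply: admB; apply: admB; exact: adm_ballfun.
- by apply: admZ; exact: admB.
- move=> y; rewrite /ballfun.
  have rs2 : r ^+ 2 <= s ^+ 2 by rewrite lerXn2r ?nnegrE// ltW.
  case: ltP => h1; case: ltP => h2; rewrite ?subrr ?subr0 ?normr0 ?mulr0 ?mulr1//.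
    by apply: H; exact: ltW.
  by have := lt_le_trans h2 rs2; rewrite ltNge h1.
Qed.

Lemma shell_bound f p r s M : 0 < r -> r <= s -> scont f ->
  (forall y, nsq (y - p) <= s ^+ 2 -> `|f y| <= M) ->
  `|ballint f p (s ^+ 2) - ballint f p (r ^+ 2)| <= M * ((s ^+ n - r ^+ n) * uvol).
Proof.
move=> r0 rs cf H; have := @shell_diff f (fun=> 0) p r s M r0 rs cf (@scont_cst R n 0).
have Z b : ballint (fun _ : V => 0 : R) p b = 0.
  by rewrite -[RHS](@int_Rn0 R n); apply: eq_int_Rn => y; rewrite /ballfun if_same.
by rewrite !Z !subr0; apply => y hy; rewrite subr0; exact: H.
Qed.

Lemma ballint_le f p r M : 0 < r -> scont f -> (forall y, nsq (y - p) <= r ^+ 2 -> `|f y| <= M) ->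
  `|ballint f p (r ^+ 2)| <= M * (r ^+ n * uvol).
Proof.
move=> r0 cf H; rewrite -(ballint1 p)// /ballint -int_RnZ; last exact: adm_ballfun.
apply: le_norm_int; [exact: adm_ballfun|by apply: admZ; exact: adm_ballfun|].
move=> y; rewrite /ballfun; case: ltP => h; last by rewrite normr0 mulr0.
by rewrite mulr1 H// ltW.
Qed.

Lemma shell_intE f p r h : 0 < r -> 0 < h -> scont f ->
  shell_int f p r h = ballint f p ((r + h) ^+ 2) - ballint f p (r ^+ 2).
Proof.
move=> r0 h0 cf; rewrite /ballint -int_RnB; try exact: adm_ballfun.
apply: eq_int_Rn => y; rewrite e2normE /ballfun leNgt !en_lt_nsq//; last exact: addr_gt0.
have rs2 : r ^+ 2 <= (r + h) ^+ 2 by rewrite lerXn2r ?nnegrE ?lerDl ?addr_ge0// ltW.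
case: ltP => h1 /=; last by rewrite subr0.
by rewrite (lt_le_trans h1 rs2) subrr.
Qed.

(** Rescaling to the unit ball turns the ball integral into r^n U(r), and U inherits a first-order
    expansion from g. So the shell quotients of g converge, at rate O(h). *)
Lemma shell_smooth g p r C (G : V -> V) : 0 < r -> scont g -> 0 <= C ->
  (forall x v, en v <= 1 -> `|g (x + v) - g x - dot (G x) v| <= C * nsq v) ->
  (forall x v, `|dot (G x) v| <= C * en v) ->
  exists l K, 0 <= K /\ forall h, 0 < h -> h <= 1 ->
   `|ballint g p ((r + h) ^+ 2) - ballint g p (r ^+ 2) - l * h| <= K * h ^+ 2.
Proof.
move=> r0 cg C0 H1 H2.
pose U r := ballint (fun z => g (p + r *: z)) 0 1.
have cU r' : scont (fun z => g (p + r' *: z)) by exact: scont_affine.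
pose T z := dot (G (p + r *: z)) z.
pose B F := ballfun F 0 1.
have quot h z : 0 < h -> h <= 1 -> nsq z < 1 -> `|g (p + (r + h) *: z) - g (p + r *: z) - h * T z| <= C * h ^+ 2.
  move=> h0 h1 z1.
  have zle : en z <= 1 by rewrite en_le_nsq// expr1n ltW.
  rewrite (_ : p + (r + h) *: z = (p + r *: z) + h *: z); last by rewrite scalerDl addrA.
  rewrite /T -dotZr; apply: le_trans (H1 _ _ _) _.
    by rewrite enZ gtr0_norm// mulr_ile1 ?en_ge0// ltW.
  by rewrite nsqZ ler_wpM2l// ler_piMr ?sqr_ge0// ltW.
have hj (j : nat) : 0 < j.+1%:R^-1 :> R by rewrite invr_gt0.
have hj1 (j : nat) : j.+1%:R^-1 <= 1 :> R by rewrite invf_le1// ler1n.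
(* No regularity of [G] is assumed; [B T] is admissible as the bounded limit of difference quotients
   of [g]. *)
have aT : adm (B T).
  pose F_ (j : nat) z := B (fun z => (g (p + (r + j.+1%:R^-1) *: z) - g (p + r *: z)) * j.+1%:R) z.
  have [C' HC'] := dominated_ball (0 : V) 1 (C + C).
  have [] // := @int_dct _ _ C' F_ (B T) _ _ _.
  - move=> j; apply: HC' => y.
      rewrite /F_ /B /ballfun subr0; case: ltP => hy; last by rewrite normr0 addr_ge0.
      have := quot _ y (hj j) (hj1 j) hy.
      have := H2 (p + r *: y) y; rewrite -/(T y) => t1.
      have yle : en y <= 1 by rewrite en_le_nsq// expr1n ltW.
      set X := g _ - g _ => q.
      have {}t1 : `|T y| <= C by rewrite (le_trans t1)// ler_piMr.
      have -> : X * j.+1%:R = (X - j.+1%:R^-1 * T y) * j.+1%:R + T y.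
        by apply: quot_aux; rewrite pnatr_eq0.
      rewrite (le_trans (ler_normD _ _))// lerD// normrM (ger0_norm (ler0n _ _)) -ler_pdivlMr// (le_trans q)//.
      by rewrite ler_wpM2l// expr2 ler_piMl// ltW.
    by move=> h; rewrite /F_ /B /ballfun ltNge (ltW h).
  - move=> j; apply: adm_ballfun; apply: scontM => //.
    by apply: scontB; exact: scont_affine.
  - move=> y; rewrite /F_ /B /ballfun subr0; case: ltP => hy; last exact: cvg_cst.
    apply/cvgrPdist_le => e e0; near=> j.
    have := quot _ y (hj j) (hj1 j) hy; set X := g _ - g _ => q.
    have -> : T y - X * j.+1%:R = - ((X - j.+1%:R^-1 * T y) * j.+1%:R).
      by rewrite [X in _ - X](@quot_aux R _ (T y)) ?pnatr_eq0//; ring.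
    rewrite normrN normrM (ger0_norm (ler0n _ _)) -ler_pdivlMr// (le_trans q)//.
    rewrite expr2 mulrA ler_wpM2r// ?invr_ge0//.
    have : C / e <= j.+1%:R.
      have : C / e <= j%:R by near: j; exact: nbhs_infty_ger.
      by move=> /le_trans; apply; rewrite ler_nat.
    by rewrite ler_pdivrMr// ler_pdivrMr// mulrC.
pose D := int_Rn (B T).
have dU h : 0 < h -> h <= 1 -> `|U (r + h) - U r - h * D| <= C * h ^+ 2 * uvol.
  move=> h0 h1.
  rewrite /U /D /ballint -int_RnZ// -!int_RnB; try by [apply: adm_ballfun|apply: admZ|apply: admB; apply: adm_ballfun].
  rewrite /uvol /ballint -int_RnZ; last exact: adm_ballfun.
  apply: le_norm_int; [|by apply: admZ; exact: adm_ballfun|].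
    by apply: admB; [apply: admB; exact: adm_ballfun|exact: admZ].
  move=> y; rewrite /B /ballfun subr0; case: ltP => hy; rewrite ?(mulr0, subr0, normr0)// mulr1.
  exact: quot.
have [K K0 HK] := pow_taylor n (ltW r0).
pose k := n%:R * r ^+ n.-1.
have k0 : 0 <= k by rewrite mulr_ge0// exprn_ge0// ltW.
have v0 := uvol_ge0.
exists (k * U r + r ^+ n * D).
exists (K * (`|U r| + `|D| + C * uvol) + k * (`|D| + C * uvol) + r ^+ n * (C * uvol)).
have Cv : 0 <= C * uvol by rewrite mulr_ge0.
have rn0 : 0 <= r ^+ n by rewrite exprn_ge0// ltW.
have p1 : 0 <= `|D| + C * uvol by apply: addr_ge0.
have p2 : 0 <= `|U r| + `|D| + C * uvol by rewrite -addrA; apply: addr_ge0.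
split.
  by apply: addr_ge0; [apply: addr_ge0|]; exact: mulr_ge0.
move=> h h0 h1; rewrite !ballint_scale ?addr_gt0// -/(U _) -/(U r).
have := dU h h0 h1; set d := U (r + h) - U r - h * D => Hd.
have EU : U (r + h) = U r + h * D + d by rewrite /d; ring.
have := HK h (ltW h0) h1; rewrite -/k; set q := (r + h) ^+ n - _ - _ => Hq.
have -> : (r + h) ^+ n * U (r + h) - r ^+ n * U r - (k * U r + r ^+ n * D) * h =
   q * U (r + h) + k * h * (h * D + d) + r ^+ n * d by rewrite EU /q; ring.
have nd : `|d| <= C * uvol * h ^+ 2 by rewrite mulrAC.
have hh : h ^+ 2 <= h by rewrite expr2 ler_piMl// ltW.
have h20 : 0 <= h ^+ 2 by rewrite sqr_ge0.
have nd1 : `|d| <= C * uvol * h by apply: le_trans nd _; rewrite ler_wpM2l.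
have nhD : `|h * D + d| <= (`|D| + C * uvol) * h.
  by rewrite (le_trans (ler_normD _ _))// mulrDl lerD// normrM gtr0_norm// mulrC.
have nU : `|U (r + h)| <= `|U r| + `|D| + C * uvol.
  rewrite EU -addrA -addrA (le_trans (ler_normD _ _))// lerD2l (le_trans nhD)//.
  by rewrite ler_piMr// addr_ge0.
clearbody q d.
apply: le_trans (ler_normD _ _) _; rewrite [leRHS]mulrDl; apply: lerD.
  apply: le_trans (ler_normD _ _) _; rewrite [leRHS]mulrDl; apply: lerD.
    by rewrite normrM mulrAC ler_pM.
  rewrite normrM (ger0_norm (mulr_ge0 k0 (ltW h0))) expr2.
  rewrite [leRHS](_ : _ = (k * h) * ((`|D| + C * uvol) * h)); last by ring.
  by rewrite ler_wpM2l// mulr_ge0// ltW.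
by rewrite normrM ger0_norm// -mulrA ler_wpM2l// mulrA.
Unshelve. all: by end_near. Qed.

Definition cutoff b : R -> R := fun a => Num.min 1 (Num.max 0 (b + 1 - a)).

Lemma cutoff_1 b a : a <= b -> cutoff b a = 1.
Proof. move=> h; have h' : 1 <= b + 1 - a by lra. by rewrite /cutoff max_r ?min_l// (le_trans _ h'). Qed.
Lemma cutoff_0 b a : b + 1 <= a -> cutoff b a = 0.
Proof. by move=> h; rewrite /cutoff max_l ?min_r// subr_le0. Qed.
Lemma cutoff_ge0 b a : 0 <= cutoff b a.
Proof. by rewrite /cutoff le_min ler01 le_max lexx. Qed.
Lemma cutoff_le1 b a : cutoff b a <= 1.
Proof. by rewrite /cutoff ge_min lexx. Qed.
Lemma scont_cutoff b F : scont F -> scont (fun y => cutoff b (F y)).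
Proof.
move=> cF; apply: scont_min => //; apply: scont_max => //.
by apply: scontB.
Qed.

Definition trunc f p b y := f y * cutoff b (nsq (y - p)).

Lemma scont_trunc f p b : scont f -> scont (trunc f p b).
Proof. by move=> cf; apply: scontM => //; apply: scont_cutoff; exact: scont_nsq. Qed.

Lemma trunc_eq f p b y : nsq (y - p) <= b -> trunc f p b y = f y.
Proof. by move=> h; rewrite /trunc cutoff_1 ?mulr1. Qed.

Lemma trunc_eq0 f p b y : b + 1 <= nsq (y - p) -> trunc f p b y = 0.
Proof. by move=> h; rewrite /trunc cutoff_0 ?mulr0. Qed.

Lemma trunc_bounded f p b : scont f -> exists2 M, 0 < M & forall y, `|trunc f p b y| <= M.
Proof.
move=> cf; have [M M0 HM] := scont_bounded_ball p (b + 1) cf.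
exists M => // y; have [h|/ltW h] := leP (nsq (y - p)) (b + 1); last first.
  by rewrite trunc_eq0 ?normr0// ltW.
by rewrite normrM (ger0_norm (cutoff_ge0 _ _)) (le_trans _ (HM _ h))// ler_piMr// cutoff_le1.
Qed.

Lemma moll_approx F p L c M : scont F -> (forall y, `|F y| <= M) -> 0 < c ->
  exists2 e, 0 < e & forall y, nsq (y - p) <= L -> `|moll e F y - F y| <= c.
Proof.
move=> cF FM c0.
have [d d0 Hd] := scont_unif (2 * L + 2 * nsq p) cF c0.
exists (d ^+ 2); first by rewrite exprn_gt0.
move=> y yL; apply: moll_near => //; first by rewrite exprn_gt0.
move=> z zd; apply: Hd; first by have := nsq_le2 p y; lra.
by rewrite addrK en_lt_nsq.
Qed.

(** Near the sphere f is replaced by a mollification at uniform distance [c1]. The quotients of the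
    mollification converge to l, and the exchange costs at most c / 2 because shell volumes are
    O(h). *)
Lemma Rsph_quotient f p r c : 0 < r -> scont f -> 0 < c ->
  exists l d, 0 < d /\ forall h, 0 < h -> h < d ->
    `|h^-1 * shell_int f p r h - l| <= c.
Proof.
move=> r0 cf c0.
pose L := (r + 1) ^+ 2.
pose f1 := trunc f p L.
have cf1 : scont f1 by exact: scont_trunc.
have [M M0 HM] := trunc_bounded p L cf.
have [K K0 HK] := pow_lip n (ltW r0).
have v0 := uvol_ge0.
pose c1 := c / 2 / (K * uvol + 1).
have Kv : 0 <= K * uvol by rewrite mulr_ge0.
have c10 : 0 < c1 by rewrite !divr_gt0// ltr_wpDl.
have [e e0 He] := @moll_approx f1 p L c1 M cf1 HM c10.
have [C C0 [G1 G2]] := moll_C1 e0 cf1 HM.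
pose g := moll e f1.
have cg : scont g by apply: scont_moll HM.
have [l [K' [K'0 Hl]]] := shell_smooth p r0 cg (ltW C0) G1 G2.
exists l, (Num.min 1 (c / 2 / (K' + 1))).
split; first by rewrite lt_min ltr01 !divr_gt0// ltr_wpDl.
move=> h h0; rewrite lt_min => /andP[/ltW h1 h2].
have K'1 : 0 < K' + 1 by rewrite ltr_wpDl.
have Kv1 : 0 < K * uvol + 1 by rewrite ltr_wpDl.
have h3 : K' * h <= c / 2.
  move: h2; rewrite ltr_pdivlMr// => h2; nra.
have h4 : c1 * (K * uvol) <= c / 2.
  by rewrite /c1 -mulrA ler_piMr ?divr_ge0 ?(ltW c0)// mulrC ler_pdivrMr// mul1r lerDl.
rewrite shell_intE//.
have sm : (r + h) ^+ 2 <= L by rewrite /L lerXn2r ?nnegrE ?addr_ge0 ?lerD2l// ltW.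
have Ef b : b <= L -> ballint f p b = ballint f1 p b.
  move=> bL; apply: eq_int_Rn => y; rewrite /ballfun; case: ltP => // hy.
  by rewrite /f1 trunc_eq// (le_trans (ltW hy)).
have rh : r <= r + h by rewrite lerDl ltW.
have rL : r ^+ 2 <= L by rewrite (le_trans _ sm)// lerXn2r ?nnegrE ?addr_ge0// ltW.
rewrite !Ef//.
have A1 : `|ballint f1 p ((r + h) ^+ 2) - ballint f1 p (r ^+ 2) - (ballint g p ((r + h) ^+ 2) - ballint g p (r ^+ 2))| <= c1 * (((r + h) ^+ n - r ^+ n) * uvol).
  apply: shell_diff => // y hy; rewrite distrC; apply: He.
  exact: le_trans hy sm.
have A2 := Hl h h0 h1.
have A3 := HK h (ltW h0) h1.
rewrite (_ : h^-1 * _ - l = (ballint f1 p ((r + h) ^+ 2) - ballint f1 p (r ^+ 2) - l * h) / h); last first.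
  by field; rewrite gt_eqF.
rewrite normrM (gtr0_norm (ltac:(by rewrite invr_gt0) : 0 < h^-1)) ler_pdivrMr//.
set X := ballint f1 _ _ - _ in A1 *; set Y := ballint g _ _ - _ in A1 A2 *.
rewrite (_ : X - l * h = (X - Y) + (Y - l * h)); last by ring.
rewrite (le_trans (ler_normD _ _))// [c]splitr mulrDl lerD//.
  apply: le_trans A1 _; apply: le_trans (ler_wpM2r (ltW h0) h4).
  by rewrite -[leRHS]mulrA ler_wpM2l ?(ltW c10)// mulrAC ler_wpM2r.
by apply: le_trans A2 _; rewrite expr2 mulrA ler_wpM2r// ltW.
Qed.

(** [Rsph] is defined by [lim], so its vanishing carries information only once the limit is known to
    exist. *)
Lemma Rsph_cvg f p r : 0 < r -> scont f ->
  h^-1 * shell_int f p r h @[h --> 0^'+] --> Rsph f p r.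
Proof.
move=> r0 cf; apply/cauchy_cvgP/cauchy_exP => e e0.
have [l [d [d0 H]]] := Rsph_quotient p r0 cf (divr_gt0 e0 (ltr0Sn _ 1)).
exists l; suff : \forall h \near 0^'+, ball l e (h^-1 * shell_int f p r h) by [].
near=> h.
rewrite /ball /= distrC (@le_lt_trans _ _ (e / 2))//; last by rewrite ltr_pdivrMr// ltr_pMr// ltr1n.
by apply: H.
Unshelve. all: by end_near. Qed.

(** As a function of the radius r, the ball integral is continuous with right derivative [Rsph],
    here 0, so it is constant. It is also at most M r^n [uvol], which tends to 0 with r because n >
    0. *)
Lemma Rsph0_ballint f p b : (0 < n)%N -> scont f -> (forall r, 0 < r -> Rsph f p r = 0) ->
  0 < b -> ballint f p b = 0.
Proof.
move=> n0 cf H b0.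
pose A r := ballint f p (r ^+ 2).
have right r e : 0 < r -> 0 < e -> exists2 d, 0 < d & forall h, 0 < h -> h < d -> `|A (r + h) - A r| <= e * h.
  move=> r0 e0; have := Rsph_cvg (p := p) r0 cf; rewrite H// => /cvgrPdist_lt/(_ _ e0)[d /= d0 Hd].
  exists d => // h h0 hd; have := Hd h; rewrite /= sub0r normrN gtr0_norm// => /(_ hd h0).
  rewrite sub0r normrN shell_intE// normrM gtr0_norm ?invr_gt0// mulrC ltr_pdivrMr// => /ltW.
  by [].
have cA r : 0 < r -> {for r, continuous A}.
  move=> r0; have [M M0 HM] := scont_bounded_ball p ((r + 1) ^+ 2) cf.
  have lip s t : 0 < s -> s <= t -> t <= r + 1 -> `|A t - A s| <= M * ((t ^+ n - s ^+ n) * uvol).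
    move=> s0 st tr; apply: shell_bound => // y hy; apply: HM; apply: le_trans hy _.
    by rewrite lerXn2r ?nnegrE ?addr_ge0// ltW// (lt_le_trans s0).
  have pc : {for r, continuous (fun t : R => M * (`|t ^+ n - r ^+ n| * uvol))}.
    apply: cvgM; first exact: cvg_cst.
    apply: cvgM; last exact: cvg_cst.
    by apply: cvg_norm; apply: cvgB; [exact: exprn_continuous|exact: cvg_cst].
  apply/cvgrPdist_le => e e0.
  have /cvgrPdist_lt/(_ _ e0) He := pc.
  near=> t.
  have : `|M * (`|r ^+ n - r ^+ n| * uvol) - M * (`|t ^+ n - r ^+ n| * uvol)| < e by near: t.
  rewrite subrr normr0 mul0r mulr0 => ht.
  have t0 : 0 < t by near: t; exact: lt_nbhsr.
  have t1 : t <= r + 1 by near: t; exists 1; [exact: ltr01|move=> u; rewrite /ball_ /= ltr_norml => /andP[]; lra].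
  rewrite sub0r normrN ger0_norm in ht; last first.
    by rewrite mulr_ge0 ?(ltW M0)// mulr_ge0// uvol_ge0.
  apply: le_trans (ltW ht); have [rt|tr] := leP r t.
    by rewrite distrC (le_trans (lip r t r0 rt t1))// ler_wpM2l ?(ltW M0)// ler_wpM2r ?uvol_ge0// ler_norm.
  by rewrite (le_trans (lip t r t0 (ltW tr) _))// ?lerDl// ler_wpM2l ?(ltW M0)// ler_wpM2r ?uvol_ge0// distrC ler_norm.
have cst r s : 0 < r -> r <= s -> A s = A r.
  move=> r0 rs; apply: right_derivative0_const => // t rt ts.
    by apply: cA; exact: lt_le_trans rt.
  by move=> e e0; apply: right => //; exact: lt_le_trans rt.
pose s := Num.sqrt b.
have s0 : 0 < s by rewrite sqrtr_gt0.
have -> : ballint f p b = A s by rewrite /A /s sqr_sqrtr// ltW.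
have [M M0 HM] := scont_bounded_ball p b cf.
apply/eqP; rewrite -normr_le0; apply/ler_addgt0Pl => e e0; rewrite addr0.
pose r := Num.min s (Num.min 1 (e / (M * uvol + 1))).
have Mv : 0 < M * uvol + 1 by rewrite ltr_wpDl// mulr_ge0 ?uvol_ge0// ltW.
have r0 : 0 < r by rewrite !lt_min s0 ltr01 divr_gt0.
have rs : r <= s by rewrite /r ge_min lexx.
have r1 : r <= 1 by rewrite /r !ge_min lexx orbT.
have re : r <= e / (M * uvol + 1) by rewrite /r !ge_min lexx !orbT.
rewrite (cst r s)//; apply: le_trans (ballint_le r0 cf (M := M) _) _.
  move=> y hy; apply: HM; apply: le_trans hy _.
  have -> : b = s ^+ 2 by rewrite /s sqr_sqrtr// ltW.
  by rewrite lerXn2r ?nnegrE// ltW.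
rewrite mulrCA; apply: (@le_trans _ _ (r * (M * uvol))).
  rewrite ler_wpM2r ?mulr_ge0 ?uvol_ge0 ?(ltW M0)// -[X in _ <= X]expr1 ler_wiXn2l// ltW//.
rewrite ler_pdivlMr// in re; apply: le_trans re; rewrite ler_wpM2l ?(ltW r0)// lerDl//.
Unshelve. all: by end_near. Qed.

End SphericalMeans.

(** * Heat kernel *)

Section ExpTaylor.
Variable R : realType.
Implicit Types (u : R).

Lemma exp_cvg u : series (exp_coeff u) N @[N --> \oo] --> expR u.
Proof. by rewrite /expR; exact: is_cvg_series_exp_coeff. Qed.

Lemma exp_partial_le u N : 0 <= u -> \sum_(0 <= i < N) exp_coeff u i <= expR u.
Proof.
move=> u0; apply: (@nondecreasing_cvgn_le _ (series (exp_coeff u))); last first.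
  exact: is_cvg_series_exp_coeff.
apply: nondecreasing_series => i _ _; exact: exp_coeff_ge0.
Qed.

Lemma exp_taylor u k :
  `|expR u - \sum_(0 <= i < k) exp_coeff u i| <= `|u| ^+ k * expR `|u|.
Proof.
have H N : `|\sum_(0 <= i < N + k) exp_coeff u i - \sum_(0 <= i < k) exp_coeff u i| <= `|u| ^+ k * expR `|u|.
  rewrite (big_cat_nat (leq0n k) (leq_addl N k)) /= addrAC subrr add0r.
  rewrite -{1}[k]add0n big_addn addnK (le_trans (ler_norm_sum _ _ _))//.
  apply: (@le_trans _ _ (`|u| ^+ k * \sum_(0 <= i < N) exp_coeff `|u| i)); last first.
    by rewrite ler_wpM2l ?exprn_ge0// exp_partial_le.
  rewrite mulr_sumr; apply: ler_sum => i _.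
  rewrite /exp_coeff /= normrM normrX normfV normr_nat exprD [_ ^+ i * _]mulrC -mulrA.
  rewrite ler_wpM2l ?exprn_ge0// ler_wpM2l ?exprn_ge0// lef_pV2 ?posrE ?ltr0n ?fact_gt0// ler_nat.
  by apply: leq_fact; rewrite leq_addr.
have c : `|\sum_(0 <= i < N + k) exp_coeff u i - \sum_(0 <= i < k) exp_coeff u i| @[N --> \oo]
   --> `|expR u - \sum_(0 <= i < k) exp_coeff u i|.
  apply: cvg_norm; apply: cvgB; last exact: cvg_cst.
  by have := @exp_cvg u; rewrite -(cvg_shiftn k).
rewrite -(cvg_lim _ c)//; apply: limr_le; first by apply/cvg_ex; eexists; exact: c.
exact: nearW.
Qed.

Lemma exp_taylor1 u : `|expR u - 1| <= `|u| * expR `|u|.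
Proof.
have := exp_taylor u 1; rewrite big_nat1 /exp_coeff /= expr0 fact0 divr1.
by rewrite expr1.
Qed.

Lemma exp_taylor2 u : `|expR u - 1 - u| <= `|u| ^+ 2 * expR `|u|.
Proof.
have := exp_taylor u 2; rewrite !big_nat_recr //= big_geq// /exp_coeff /= expr0 fact0 divr1 expr1 divr1.
by rewrite add0r opprD addrA.
Qed.

Lemma exp_taylor3 u : `|expR u - 1 - u - u ^+ 2 / 2| <= `|u| ^+ 3 * expR `|u|.
Proof.
have := exp_taylor u 3; rewrite !big_nat_recr //= big_geq// /exp_coeff /= expr0 fact0 divr1 expr1 divr1.
by rewrite add0r !opprD !addrA.
Qed.

(** Prepared for the time step in [hk_expand]: [th] will be the logarithm of a ratio of heat kernels
    and [et * be] its linear part. *)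
Lemma exp_lin_err (th be et ga g : R) : 0 <= et -> 0 <= ga -> ga <= g ->
  `|th - et * be| <= 2 * et ^+ 2 * ga -> `|th| <= 2 * et * ga -> `|th| <= g ->
  `|expR th - 1 - et * be| <= et ^+ 2 * (2 * g + 4 * g ^+ 2 * expR g).
Proof.
move=> et0 ga0 gag thE thle thg.
have g0 := le_trans ga0 gag.
have h2 := exp_taylor2 th.
have h1 : `|th| <= 2 * et * g.
  by apply: le_trans thle _; apply: ler_wpM2l => //; exact: mulr_ge0.
have h3 : `|th| ^+ 2 * expR `|th| <= (2 * et * g) ^+ 2 * expR g.
  apply: ler_pM; [exact: exprn_ge0|exact: expR_ge0| |by rewrite ler_expR].
  by rewrite lerXn2r// nnegrE mulr_ge0// mulr_ge0.
have h4 : 2 * et ^+ 2 * ga <= 2 * et ^+ 2 * g.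
  by apply: ler_wpM2l => //; apply: mulr_ge0 => //; exact: sqr_ge0.
rewrite (_ : _ - et * be = (expR th - 1 - th) + (th - et * be)); last by ring.
apply: le_trans (ler_normD _ _) _.
rewrite (_ : et ^+ 2 * _ = (2 * et * g) ^+ 2 * expR g + 2 * et ^+ 2 * g); last by ring.
by apply: lerD; [exact: le_trans h3|exact: le_trans h4].
Qed.

Lemma ln_taylor (t : R) : 0 <= t -> t <= 2^-1 -> `|ln (1 - t) + t| <= 2 * t ^+ 2.
Proof.
move=> t0 t1.
have p : 0 < 1 - t by lra.
have h1 : ln (1 - t) <= - t.
  by apply: le_ln1Dx; lra.
have h2 : - (t / (1 - t)) <= ln (1 - t).
  rewrite lerNl -lnV ?posrE//.
  rewrite [X in ln X](_ : _ = 1 + t / (1 - t)); last by field; lra.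
  by apply: le_ln1Dx; have := divr_ge0 t0 (ltW p); lra.
have h3 : t / (1 - t) <= t + 2 * t ^+ 2.
  rewrite ler_pdivrMr//; nra.
by rewrite ler_norml; apply/andP; split; lra.
Qed.
End ExpTaylor.

Section HeatKernel.
Variables (R : realType) (n : nat).
Local Notation V := 'rV[R]_n.
Implicit Types (f g F G : V -> R) (u v w x y z p : V) (a b c r s t h : R).

(** The heat kernel at time s as a function of the squared distance, without the factor (4
    pi)^(-n/2). The power s^(-n/2) is written as an exponential, so that ratios of kernels are
    single exponentials. *)
Definition hk s a : R := expR (- (n%:R / 2 * ln s) - a / (4 * s)).

Lemma hk_gt0 s a : 0 < hk s a. Proof. exact: expR_gt0. Qed.
Lemma hk_ge0 s a : 0 <= hk s a. Proof. exact/ltW/hk_gt0. Qed.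

Lemma hk_le s0 s a : 0 < s0 -> s0 <= s -> 0 <= a -> hk s a <= hk s0 0.
Proof.
move=> s00 s0s a0; rewrite /hk ler_expR mul0r subr0.
have h1 : ln s0 <= ln s by rewrite ler_ln ?posrE// (lt_le_trans s00).
have h2 : 0 <= a / (4 * s) by rewrite divr_ge0// mulr_ge0// (le_trans (ltW s00)).
have := ler_wpM2l (ltac:(by rewrite divr_ge0) : 0 <= n%:R / 2 :> R) h1; lra.
Qed.

Lemma hk_cont s : continuous (hk s).
Proof.
move=> a; apply: continuous_cvg; first exact: continuous_expR.
apply: cvgB; first exact: cvg_cst.
by apply: cvgM; [exact: cvg_id|exact: cvg_cst].
Qed.

Lemma hk_dominated s x : 0 < s -> exists C, forall F : V -> R, (forall y, `|F y| <= 1) ->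
  dominated C (fun y => F y * hk s (nsq y)).
Proof.
move=> s0; have s4 : 0 < (4 * s)^-1 by rewrite invr_gt0 mulr_gt0.
have [C C0 HC] := gauss_weight n s4.
exists (hk s 0 * C) => F F1 y.
rewrite normrM -[leRHS]mul1r (ger0_norm (hk_ge0 _ _)); apply: ler_pM => //; first exact: hk_ge0.
have -> : hk s (nsq y) = hk s 0 * expR (- ((4 * s)^-1 * nsq y)).
  by rewrite /hk -expRD; congr expR; rewrite mul0r subr0 [_^-1 * _]mulrC.
by rewrite -mulrA; apply: ler_wpM2l; [exact: hk_ge0|exact: HC].
Qed.

Lemma adm_hk s : 0 < s -> adm (fun z : V => hk s (nsq z)).
Proof.
move=> s0; have [C HC] := hk_dominated 0 s0.
apply: (@adm_scont _ _ C) => [y|].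
  by have := HC (fun=> 1) (fun y => ltac:(by rewrite normr1)) y; rewrite mul1r.
apply: scont_comp; first exact: hk_cont.
by have := @scont_nsq R n 0; congr scont; apply/funext => y; rewrite subr0.
Qed.

Lemma adm_nsq_hk s : 0 < s -> adm (fun z : V => nsq z * hk s (nsq z)).
Proof.
move=> s0; have s8 : 0 < (8 * s)^-1 by rewrite invr_gt0 mulr_gt0.
have [C C0 HC] := gauss_weight n s8.
have cn : scont (fun z : V => nsq z).
  by have := @scont_nsq R n 0; congr scont; apply/funext => y; rewrite subr0.
apply: (@adm_scont _ _ (hk s 0 * (8 * s) * C)) => [y|]; last first.
  by apply: scontM => //; apply: scont_comp cn; exact: hk_cont.
rewrite normrM (ger0_norm (hk_ge0 _ _)) (ger0_norm (nsq_ge0 _)).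
have := HC y; set q := nsq y; have q0 : 0 <= q := nsq_ge0 y.
(* Half of the Gaussian exponent absorbs the factor |z|^2, the other half provides the weight. *)
have h : q <= 8 * s * expR ((8 * s)^-1 * q).
  rewrite -ler_pdivrMl ?mulr_gt0//; apply: le_trans (expR_ge1Dx _); lra.
have -> : hk s q = hk s 0 * expR (- ((8 * s)^-1 * q)) * expR (- ((8 * s)^-1 * q)).
  rewrite /hk -!expRD; congr expR; field; lra.
move=> Hq; have e0 := expR_ge0 (- ((8 * s)^-1 * q)).
have h2 : q * expR (- ((8 * s)^-1 * q)) <= 8 * s.
  by rewrite expRN ler_pdivrMr ?expR_gt0.
have k0 := hk_ge0 s 0.
rewrite (_ : q * _ = hk s 0 * (q * expR (- ((8 * s)^-1 * q))) * expR (- ((8 * s)^-1 * q))); last by ring.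
rewrite -[leRHS]mulrA; apply: ler_pM => //; first by rewrite !mulr_ge0.
by rewrite ler_wpM2l.
Qed.

(** It stands for (4 pi)^(n/2), which is never computed: only independence of s and positivity
    enter. *)
Definition hmass : R := int_Rn (fun z : V => hk 1 (nsq z)).
Definition hmass2 : R := int_Rn (fun z : V => nsq z * hk 1 (nsq z)).

Lemma hk_scale s a : 0 < s -> Num.sqrt s ^+ n * hk s (s * a) = hk 1 a.
Proof.
move=> s0; have q0 : 0 < Num.sqrt s by rewrite sqrtr_gt0.
have -> : Num.sqrt s ^+ n = expR (n%:R / 2 * ln s).
  have -> : n%:R / 2 * ln s = n%:R * ln (Num.sqrt s).
    have : ln s = 2 * ln (Num.sqrt s).
      by rewrite -{1}(sqr_sqrtr (ltW s0)) lnXn// mulr_natl.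
    by move=> ->; field.
  by rewrite expRM_natl lnK ?posrE.
rewrite /hk -expRD ln1 mulr0 oppr0 sub0r; congr expR.
by field; rewrite gt_eqF.
Qed.

Lemma hk_mass s : 0 < s -> int_Rn (fun z : V => hk s (nsq z)) = hmass.
Proof.
move=> s0; have q0 : 0 < Num.sqrt s by rewrite sqrtr_gt0.
rewrite (int_scale q0 (adm_hk s0)) -int_RnZ; last first.
  exact: adm_scale q0 (adm_hk s0).
by apply: eq_int_Rn => z; rewrite nsqZ sqr_sqrtr ?ltW// hk_scale.
Qed.

Lemma hk_mass2 s : 0 < s -> int_Rn (fun z : V => nsq z * hk s (nsq z)) = s * hmass2.
Proof.
move=> s0; have q0 : 0 < Num.sqrt s by rewrite sqrtr_gt0.
rewrite (int_scale q0 (adm_nsq_hk s0)) -int_RnZ; last first.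
  exact: (adm_scale q0 (adm_nsq_hk s0)).
rewrite /hmass2 -int_RnZ; last by apply: adm_nsq_hk.
by apply: eq_int_Rn => z; rewrite nsqZ sqr_sqrtr ?ltW// -(hk_scale (nsq z) s0); ring.
Qed.

Lemma hmass_ge0 : 0 <= hmass. Proof. by apply: int_Rn_ge0 => z; exact: hk_ge0. Qed.
Lemma hmass2_ge0 : 0 <= hmass2.
Proof. by apply: int_Rn_ge0 => z; rewrite mulr_ge0 ?nsq_ge0 ?hk_ge0. Qed.

Definition evec (i : 'I_n) : V := delta_mx ord0 i.

Lemma dot_evec v i : dot v (evec i) = v ord0 i.
Proof.
rewrite /dot (bigD1 i)//= mxE !eqxx mulr1 big1 ?addr0// => j ji.
by rewrite mxE (negbTE ji) andbF mulr0.
Qed.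

Lemma nsq_evec i : nsq (evec i) = 1.
Proof. by rewrite /nsq dot_evec mxE !eqxx. Qed.

Lemma nsq_sum v : nsq v = \sum_(i < n) (v ord0 i) ^+ 2.
Proof. by apply: eq_bigr => i _; rewrite expr2. Qed.

(* The heat equation, in finite-difference form. *)
Lemma hk_expand s0 L : 0 < s0 -> 0 <= L -> exists2 C, 0 <= C & forall s h w, s0 <= s ->
  0 < h -> h <= 1 -> h ^+ 2 <= s0 / 2 -> nsq w <= L ->
  `|hk s (nsq w) - hk (s - h ^+ 2) (nsq w) -
    \sum_(i < n) (hk s (nsq (w - h *: evec i)) + hk s (nsq (w + h *: evec i)) - 2 * hk s (nsq w))|
   <= C * h ^+ 3.
Proof.
move=> s00 L0.
pose g := n%:R / 2 + L / (4 * s0).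
pose m := (L + 2) / s0.
have g0 : 0 <= g by rewrite addr_ge0// divr_ge0// mulr_ge0// ltW.
have m0 : 0 <= m by rewrite divr_ge0 ?addr_ge0// ltW.
pose Ca := (2 * g + 4 * g ^+ 2 * expR g) / s0 ^+ 2.
pose Cb := n%:R * (m ^+ 2 + 2 * m ^+ 3 * expR m).
exists (hk s0 0 * (Ca + Cb)).
  rewrite mulr_ge0 ?hk_ge0// addr_ge0//.
    by rewrite divr_ge0 ?sqr_ge0// addr_ge0// mulr_ge0 ?expR_ge0// mulr_ge0 ?sqr_ge0.
  by rewrite mulr_ge0// addr_ge0 ?sqr_ge0// mulr_ge0 ?expR_ge0// mulr_ge0 ?exprn_ge0.
move=> s h w s0s h0 h1 hs wL.
have sp : 0 < s := lt_le_trans s00 s0s.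
set a := nsq w in wL *; have a0 : 0 <= a := nsq_ge0 w.
pose et := h ^+ 2 / s.
have et0 : 0 <= et by rewrite divr_ge0 ?sqr_ge0// ltW.
have et1 : et <= 2^-1 by rewrite /et ler_pdivrMr// (le_trans hs)//; lra.
have etle : et <= h ^+ 2 / s0 by rewrite /et ler_wpM2l ?sqr_ge0// lef_pV2.
have sh : 0 < s - h ^+ 2 by lra.
pose be := n%:R / 2 - a / (4 * s).
pose ga := n%:R / 2 + a / (4 * s).
have gag : ga <= g.
  rewrite /ga /g lerD2l ler_pM ?invr_ge0 ?mulr_ge0 ?(ltW sp)//.
  by rewrite lef_pV2 ?posrE ?mulr_gt0// ler_wpM2l.
have as0 : 0 <= a / (4 * s) by rewrite divr_ge0// mulr_ge0// ltW.
have n20 : 0 <= n%:R / 2 :> R by rewrite divr_ge0.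
have ga0 : 0 <= ga by rewrite addr_ge0.
(* The logarithm of the ratio of the kernels at times s - h^2 and s; its part linear in [et] = h^2 /
   s is [et * be]. *)
pose th := - (n%:R / 2 * (ln (s - h ^+ 2) - ln s)) - (a / (4 * (s - h ^+ 2)) - a / (4 * s)).
have Kth : hk (s - h ^+ 2) a = hk s a * expR th.
  by rewrite /hk -expRD; congr expR; rewrite /th; ring.
have lnE : ln (s - h ^+ 2) - ln s = ln (1 - et).
  have -> : s - h ^+ 2 = s * (1 - et) by rewrite /et; field; rewrite gt_eqF.
  by rewrite lnM ?posrE//; [ring|lra].
have dE : a / (4 * (s - h ^+ 2)) - a / (4 * s) = a / (4 * s) * (et + et ^+ 2 / (1 - et)).
  rewrite /et; field; apply/andP; split; rewrite gt_eqF//; lra.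
have thE : `|th - et * be| <= 2 * et ^+ 2 * ga.
  have := ln_taylor et0 et1; rewrite -lnE; set l := ln _ - ln _ => hl.
  have -> : th - et * be = - (n%:R / 2) * (l + et) - a / (4 * s) * (et ^+ 2 / (1 - et)).
    by rewrite /th -/l dE /be; ring.
  have q1 : et ^+ 2 / (1 - et) <= 2 * et ^+ 2.
    rewrite ler_pdivrMr; last lra.
    have := sqr_ge0 et; nra.
  have q0 : 0 <= et ^+ 2 / (1 - et) by rewrite divr_ge0 ?sqr_ge0//; lra.
  apply: le_trans (ler_normB _ _) _; rewrite /ga [leRHS]mulrDr; apply: lerD.
    by rewrite normrM normrN (ger0_norm n20) mulrC; apply: ler_wpM2r.
  rewrite ger0_norm; last exact: mulr_ge0.
  by rewrite [leRHS]mulrC; apply: ler_wpM2l.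
have beg : `|be| <= ga by rewrite /be /ga (le_trans (ler_normB _ _))// !ger0_norm.
have et2 : et ^+ 2 <= et / 2 by rewrite expr2 ler_wpM2l.
have thle : `|th| <= 2 * et * ga.
  rewrite -(subrK (et * be) th) (le_trans (ler_normD _ _))//.
  have : `|et * be| <= et * ga by rewrite normrM ger0_norm// ler_wpM2l.
  have : 2 * et ^+ 2 * ga <= et * ga by rewrite ler_wpM2r//; lra.
  lra.
have thg : `|th| <= g.
  rewrite (le_trans thle)//; apply: (@le_trans _ _ (1 * ga)); last by rewrite mul1r.
  by rewrite ler_wpM2r//; lra.
have e4 : et ^+ 2 <= h ^+ 3 / s0 ^+ 2.
  apply: (@le_trans _ _ ((h ^+ 2 / s0) ^+ 2)).
    by rewrite lerXn2r ?nnegrE// (le_trans et0).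
  rewrite expr_div_n -exprM; apply: ler_wpM2r; first by rewrite invr_ge0 sqr_ge0.
  by rewrite ler_wiXn2l// ltW.
have E1 : `|expR th - 1 - et * be| <= Ca * h ^+ 3.
  apply: le_trans (exp_lin_err et0 ga0 gag thE thle thg) _.
  rewrite (_ : Ca * h ^+ 3 = h ^+ 3 / s0 ^+ 2 * (2 * g + 4 * g ^+ 2 * expR g)); last by rewrite /Ca; ring.
  apply: ler_wpM2r => //; apply: addr_ge0; first exact: mulr_ge0.
  by apply: mulr_ge0; [apply: mulr_ge0 => //; exact: sqr_ge0|exact: expR_ge0].
pose u i := h * w ord0 i / (2 * s).
pose q := h ^+ 2 / (4 * s).
have Kp i : hk s (nsq (w + h *: evec i)) = hk s a * expR (- u i - q).
  rewrite /hk -expRD nsqD dotZr dot_evec nsqZ nsq_evec mulr1 -/a; congr expR.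
  by rewrite /u /q; field; rewrite gt_eqF.
have Km i : hk s (nsq (w - h *: evec i)) = hk s a * expR (u i - q).
  rewrite /hk -expRD nsqB dotZr dot_evec nsqZ nsq_evec mulr1 -/a; congr expR.
  by rewrite /u /q; field; rewrite gt_eqF.
have wi i : `|w ord0 i| <= L + 1.
  have := nsq_coord w i; rewrite -/a => h2.
  rewrite -[_ ^+ 2]real_normK ?num_real// in h2.
  have := normr_ge0 (w ord0 i); have := sqr_ge0 (`|w ord0 i| - 1).
  by rewrite sqrrB expr1n mulr1 -mulr_natl; move: h2 wL; clear; lra.
have q0 : 0 <= q by rewrite divr_ge0 ?sqr_ge0// mulr_ge0// ltW.
have uq i : `|u i| + q <= h * m.
  have -> : `|u i| = h * (`|w ord0 i| / (2 * s)).
    rewrite /u !normrM normfV (gtr0_norm h0) (gtr0_norm (ltac:(by rewrite mulr_gt0) : 0 < 2 * s)).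
    by rewrite mulrA.
  rewrite /q expr2 -mulrA -mulrDr ler_wpM2l ?(ltW h0)// /m.
  have i1 : `|w ord0 i| / (2 * s) <= (L + 1) / s0.
    apply: ler_pM => //; first by rewrite invr_ge0 mulr_ge0// ltW.
    by rewrite lef_pV2 ?posrE ?mulr_gt0//; move: s0s s00; clear; lra.
  have i2 : h / (4 * s) <= 1 / s0.
    apply: ler_pM => //; [exact: ltW|by rewrite invr_ge0 mulr_ge0// ltW|].
    by rewrite lef_pV2 ?posrE ?mulr_gt0//; move: s0s s00; clear; lra.
  rewrite (_ : (L + 2) / s0 = (L + 1) / s0 + 1 / s0); last by field; rewrite gt_eqF.
  exact: lerD.
have hm : h * m <= m by rewrite ler_piMl.
have cub (x : R) : `|x| <= h * m -> `|expR x - 1 - x - x ^+ 2 / 2| <= m ^+ 3 * expR m * h ^+ 3.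
  move=> xh; apply: le_trans (exp_taylor3 x) _.
  rewrite (_ : m ^+ 3 * expR m * h ^+ 3 = (h * m) ^+ 3 * expR m); last by ring.
  apply: ler_pM; rewrite ?exprn_ge0 ?expR_ge0 ?ler_expR//.
    by rewrite lerXn2r ?nnegrE// mulr_ge0// ltW.
  exact: le_trans xh hm.
have E2 i : `|expR (u i - q) + expR (- u i - q) - 2 - (u i ^+ 2 - 2 * q)| <= (m ^+ 2 + 2 * m ^+ 3 * expR m) * h ^+ 3.
  have t1 : `|u i - q| <= h * m by rewrite (le_trans (ler_normB _ _))// (ger0_norm q0).
  have t2 : `|- u i - q| <= h * m by rewrite (le_trans (ler_normB _ _))// normrN (ger0_norm q0).
  rewrite (_ : _ - (u i ^+ 2 - 2 * q) = (expR (u i - q) - 1 - (u i - q) - (u i - q) ^+ 2 / 2) +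
     (expR (- u i - q) - 1 - (- u i - q) - (- u i - q) ^+ 2 / 2) + q ^+ 2); last by field.
  have qh : `|q ^+ 2| <= m ^+ 2 * h ^+ 3.
    rewrite ger0_norm ?sqr_ge0//.
    have qm : q <= h ^+ 2 * m.
      rewrite /q /m ler_wpM2l ?sqr_ge0//.
      apply: (@le_trans _ _ (1 / s0)).
        by rewrite mul1r lef_pV2 ?posrE ?mulr_gt0//; move: s0s s00; clear; lra.
      by rewrite ler_wpM2r ?invr_ge0 ?(ltW s00)//; move: L0; clear; lra.
    apply: (@le_trans _ _ ((h ^+ 2 * m) ^+ 2)); first by rewrite lerXn2r ?nnegrE// mulr_ge0 ?sqr_ge0.
    rewrite exprMn mulrC ler_wpM2l ?sqr_ge0// -exprM.
    by rewrite ler_wiXn2l// ltW.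
  have := cub _ t1; have := cub _ t2.
  set A1 := expR (u i - q) - _ - _ - _; set A2 := expR (- u i - q) - _ - _ - _ => c2 c1.
  by move: (ler_normD (A1 + A2) (q ^+ 2)) (ler_normD A1 A2) c1 c2 qh; clear; lra.
(* This identity is the heat equation for the kernel: the leading terms of the spatial second
   differences add up to that of the time difference. *)
have S1 : \sum_(i < n) (u i ^+ 2 - 2 * q) = - (et * be).
  rewrite sumrB sumr_const card_ord -mulr_natl.
  have -> : \sum_(i < n) u i ^+ 2 = h ^+ 2 / (4 * s ^+ 2) * a.
    rewrite /a nsq_sum mulr_sumr; apply: eq_bigr => i _; rewrite /u.
    by field; rewrite gt_eqF.
  by rewrite /et /be /q; field; rewrite gt_eqF.
rewrite Kth (eq_bigr (fun i => hk s a * (expR (u i - q) + expR (- u i - q) - 2))); last first.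
  by move=> i _; rewrite Kp Km; ring.
rewrite -mulr_sumr.
set Sg := \sum_(i < n) _.
have E3 : `|Sg + et * be| <= Cb * h ^+ 3.
  rewrite -[et * be]opprK -S1 /Sg -sumrB (le_trans (ler_norm_sum _ _ _))//.
  apply: (@le_trans _ _ (\sum_(i < n) ((m ^+ 2 + 2 * m ^+ 3 * expR m) * h ^+ 3))).
    by apply: ler_sum => i _; exact: E2.
  by rewrite sumr_const card_ord -[leLHS]mulr_natl /Cb mulrA.
rewrite (_ : hk s a - _ - _ = - hk s a * ((expR th - 1 - et * be) + (Sg + et * be))); last by ring.
rewrite normrM normrN (ger0_norm (hk_ge0 _ _)) -[leRHS]mulrA; apply: ler_pM => //; first exact: hk_ge0.
  exact: hk_le.
by rewrite [leRHS]mulrDl; apply: le_trans (ler_normD _ _) _; exact: lerD.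
Qed.

Lemma hk_lip s0 L : 0 < s0 -> 0 <= L -> exists2 C, 0 <= C & forall s w v, s0 <= s ->
  en v <= 1 -> nsq w <= L -> `|hk s (nsq (w - v)) - hk s (nsq w)| <= C * en v.
Proof.
move=> s00 L0; pose m := (L + 2) / s0.
have m0 : 0 <= m by rewrite divr_ge0 ?addr_ge0// ltW.
exists (hk s0 0 * (m * expR m)); first by apply: mulr_ge0; [exact: hk_ge0|apply: mulr_ge0 => //; exact: expR_ge0].
move=> s w v s0s v1 wL; have sp := lt_le_trans s00 s0s.
pose th := (2 * dot w v - nsq v) / (4 * s).
have -> : hk s (nsq (w - v)) = hk s (nsq w) * expR th.
  by rewrite /hk -expRD nsqB; congr expR; rewrite /th; field; rewrite gt_eqF.
have v0 := en_ge0 v.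
have thle : `|th| <= m * en v.
  rewrite /th normrM normfV (gtr0_norm (ltac:(by rewrite mulr_gt0) : 0 < 4 * s)).
  rewrite ler_pdivrMr ?mulr_gt0// (le_trans (ler_normB _ _))//.
  rewrite normrM normr_nat (ger0_norm (nsq_ge0 _)) -en_sq.
  have d1 := en_dot w v.
  have w1 : en w <= L + 1 by have := en_sq w; have := en_ge0 w; nra.
  have d2 : `|dot w v| <= (L + 1) * en v by apply: le_trans d1 _; rewrite ler_wpM2r.
  have d3 : en v ^+ 2 <= en v by rewrite expr2 ler_piMl.
  have d4 : m * 4 * s0 = 4 * (L + 2) by rewrite /m; field; rewrite gt_eqF.
  have d5 : m * en v * (4 * s0) <= m * en v * (4 * s).
    by apply: ler_wpM2l; [exact: mulr_ge0|apply: ler_wpM2l].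
  have d6 : m * en v * (4 * s0) = 4 * (L + 2) * en v by rewrite -d4; ring.
  nra.
have thm : `|th| <= m by rewrite (le_trans thle)// ler_piMr.
rewrite (_ : hk s (nsq w) * expR th - _ = hk s (nsq w) * (expR th - 1)); last by ring.
rewrite normrM (ger0_norm (hk_ge0 _ _)) -mulrA; apply: ler_pM => //; first exact: hk_ge0.
  by apply: hk_le => //; exact: nsq_ge0.
apply: le_trans (exp_taylor1 th) _; rewrite mulrAC.
by apply: ler_pM; rewrite ?expR_ge0 ?ler_expR.
Qed.

End HeatKernel.

(** * Heat evolution of a compactly supported continuous function *)

Section Heat.
Variables (R : realType) (n : nat).
Local Notation V := 'rV[R]_n.
Implicit Types (u v w x y z p : V) (a b c r s t h : R).

Definition heat (f : V -> R) s x : R := int_Rn (fun y => f y * hk n s (nsq (y - x))).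

Lemma scont_hk s x : scont (fun y : V => hk n s (nsq (y - x))).
Proof. by apply: scont_comp; [exact: hk_cont|exact: scont_nsq]. Qed.

Variables (f : V -> R) (M b : R) (p : V).
Hypotheses (cf : scont f) (fM : forall y, `|f y| <= M) (fb : forall y, b < nsq (y - p) -> f y = 0).

Lemma adm_mulf (F : V -> R) : scont F -> adm (fun y => f y * F y).
Proof.
move=> cF; apply: (@csupp_adm _ _ _ p b); first exact: scontM.
by move=> y h; rewrite fb// mul0r.
Qed.

Lemma adm_heat s x : adm (fun y => f y * hk n s (nsq (y - x))).
Proof. by apply: adm_mulf; exact: scont_hk. Qed.

Lemma adm_normf : adm (fun y => `|f y|).
Proof.
apply: (@csupp_adm _ _ _ p b); first exact: scont_norm.
by move=> y h; rewrite fb// normr0.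
Qed.

Lemma int_mulf_bound (F : V -> R) c : scont F ->
  (forall y, nsq (y - p) <= b -> `|F y| <= c) -> `|int_Rn (fun y => f y * F y)| <= c * int_Rn (fun y => `|f y|).
Proof.
move=> cF Fc; rewrite -int_RnZ; last exact: adm_normf.
apply: le_norm_int; [exact: adm_mulf|by apply: admZ; exact: adm_normf|].
move=> y; have [h|h] := leP (nsq (y - p)) b; last by rewrite fb// mul0r normr0 mulr0.
by rewrite normrM mulrC; apply: ler_wpM2r => //; exact: Fc.
Qed.

Lemma heatE s x : heat f s x = int_Rn (fun z => f (z + x) * hk n s (nsq z)).
Proof.
rewrite /heat -(int_shift x (adm_heat s x)).
by apply: eq_int_Rn => y; rewrite addrK.
Qed.

Lemma adm_heatE s x : adm (fun z => f (z + x) * hk n s (nsq z)).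
Proof.
by apply: eq_adm (adm_shift x (adm_heat s x)) => y; rewrite addrK.
Qed.

Lemma heat_bound s x : 0 < s -> `|heat f s x| <= M * hmass R n.
Proof.
move=> s0; rewrite heatE -(hk_mass n s0) -int_RnZ; last exact: adm_hk.
apply: le_norm_int; [exact: adm_heatE|by apply: admZ; exact: adm_hk|].
move=> y; rewrite normrM (ger0_norm (hk_ge0 _ _ _)).
by apply: ler_wpM2r => //; exact: hk_ge0.
Qed.

(** At a zero x of f, uniform continuity gives |f(y + x)| <= c1 + (M / d^2) |y|^2, and the second
    moment of the kernel is proportional to s. *)
Lemma heat_small L c : 0 < c -> exists2 s1, 0 < s1 & forall s x, 0 < s -> s <= s1 ->
  nsq (x - p) <= L -> f x = 0 -> `|heat f s x| <= c.
Proof.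
move=> c0.
have h0 := hmass_ge0 R n; have h20 := hmass2_ge0 R n.
pose c1 := c / 2 / (hmass R n + 1).
have c10 : 0 < c1 by rewrite !divr_gt0// ltr_wpDl.
have [d d0 Hd] := scont_unif (2 * L + 2 * nsq p) cf c10.
have M0 : 0 <= M by apply: le_trans (fM 0).
pose k := M / d ^+ 2 * hmass2 R n.
have k0 : 0 <= k by rewrite !mulr_ge0// invr_ge0 sqr_ge0.
exists (c / 2 / (k + 1)); first by rewrite !divr_gt0// ltr_wpDl.
move=> s x s0 s1 xL fx.
have xL2 : nsq x <= 2 * L + 2 * nsq p by have := nsq_le2 p x; lra.
have B y : `|f (y + x)| <= c1 + M / d ^+ 2 * nsq y.
  have [hy|hy] := ltP (en y) d.
    have := Hd x (y + x) xL2; rewrite addrK fx subr0 => /(_ hy) h.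
    apply: le_trans h _; rewrite lerDl; apply: mulr_ge0; last exact: nsq_ge0.
    by rewrite divr_ge0// sqr_ge0.
  apply: le_trans (fM _) _; apply: (@le_trans _ _ (M / d ^+ 2 * nsq y)); last by rewrite lerDr ltW.
  rewrite -mulrA; apply: ler_peMr => //; rewrite mulrC ler_pdivlMr ?exprn_gt0// mul1r.
  by rewrite -en_sq lerXn2r// ?nnegrE ?en_ge0// ltW.
rewrite heatE.
have a1 : adm (fun z : V => c1 * hk n s (nsq z)) by apply: admZ; exact: adm_hk.
have a2 : adm (fun z : V => M / d ^+ 2 * (nsq z * hk n s (nsq z))) by apply: admZ; exact: adm_nsq_hk.
apply: le_trans (le_norm_int (G := fun z => c1 * hk n s (nsq z) + M / d ^+ 2 * (nsq z * hk n s (nsq z))) _ _ _) _.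
- exact: adm_heatE.
- exact: admD.
- move=> y; rewrite normrM (ger0_norm (hk_ge0 _ _ _)) mulrA -mulrDl.
  by apply: ler_wpM2r => //; exact: hk_ge0.
rewrite int_RnD// !int_RnZ; [|exact: adm_nsq_hk|exact: adm_hk].
rewrite hk_mass// hk_mass2// [c in _ <= c]splitr; apply: lerD.
  rewrite /c1 -mulrA; apply: ler_piMr; first by rewrite divr_ge0// ltW.
  by rewrite mulrC ler_pdivrMr ?ltr_wpDl// mul1r lerDl.
rewrite mulrCA -/k; move: s1; rewrite ler_pdivlMr ?ltr_wpDl// => s1; apply: le_trans s1.
by apply: ler_wpM2l; [exact: ltW|rewrite lerDl].
Qed.

Lemma nsq_diff L x y : nsq (x - p) <= L -> nsq (y - p) <= b -> nsq (y - x) <= 2 * b + 2 * L.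
Proof.
move=> xL yb; have := nsq_ge0 ((y - p) + (x - p)); rewrite nsqD => h.
have -> : y - x = (y - p) - (x - p) by rewrite opprB addrA subrK.
by rewrite nsqB; lra.
Qed.

Lemma heat_lip s0 L : 0 < s0 -> 0 <= b -> 0 <= L -> exists2 C, 0 <= C & forall s x v, s0 <= s ->
  en v <= 1 -> nsq (x - p) <= L -> `|heat f s (x + v) - heat f s x| <= C * en v.
Proof.
move=> s00 b0 L0; have [|C C0 HC] := @hk_lip _ n s0 (2 * b + 2 * L) s00; first by lra.
have I0 : 0 <= int_Rn (fun y => `|f y|) by apply: int_Rn_ge0.
exists (C * int_Rn (fun y => `|f y|)); first exact: mulr_ge0.
move=> s x v s0s v1 xL; rewrite /heat -int_RnB; try exact: adm_heat.
rewrite (eq_int_Rn (G := fun y => f y * (hk n s (nsq (y - (x + v))) - hk n s (nsq (y - x))))); last first.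
  by move=> y; rewrite mulrBr.
rewrite mulrAC; apply: int_mulf_bound; first by apply: scontB; exact: scont_hk.
move=> y yb; rewrite opprD addrA; apply: HC => //; exact: nsq_diff.
Qed.

End Heat.

Section Heat2.
Variables (R : realType) (n : nat).
Local Notation V := 'rV[R]_n.
Implicit Types (u v w x y z p : V) (a b c r s t h : R).
Variables (f : V -> R) (M b : R) (p : V).
Hypotheses (cf : scont f) (fM : forall y, `|f y| <= M) (fb : forall y, b < nsq (y - p) -> f y = 0).
Hypothesis b0 : 0 <= b.

Lemma scont_heat s : 0 < s -> scont (heat f s).
Proof.
move=> s0; apply: scont_of_en => x e e0.
have [C C0 HC] := heat_lip cf fb s0 b0 (nsq_ge0 (x - p)).
have C1 : 0 < C + 1 by rewrite ltr_wpDl.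
exists (Num.min 1 (e / (C + 1))); first by rewrite lt_min ltr01 divr_gt0.
move=> y; rewrite lt_min => /andP[/ltW y1 y2].
have := HC s x (y - x) (lexx s) y1 (lexx _); rewrite (addrC x) subrK => /le_trans; apply.
move: y2; rewrite ltr_pdivlMr// => /ltW; have := en_ge0 (y - x); nra.
Qed.

Lemma heat_expand s0 L : 0 < s0 -> 0 <= L -> exists2 C, 0 <= C & forall s h x, s0 <= s ->
  0 < h -> h <= 1 -> h ^+ 2 <= s0 / 2 -> nsq (x - p) <= L ->
  `|heat f s x - heat f (s - h ^+ 2) x -
    \sum_(i < n) (heat f s (x + h *: evec R i) + heat f s (x - h *: evec R i) - 2 * heat f s x)|
   <= C * h ^+ 3.
Proof.
move=> s00 L0; have [|C C0 HC] := @hk_expand _ n s0 (2 * b + 2 * L) s00.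
  by apply: addr_ge0; apply: mulr_ge0.
have I0 : 0 <= int_Rn (fun y => `|f y|) by apply: int_Rn_ge0.
exists (C * int_Rn (fun y => `|f y|)); first exact: mulr_ge0.
move=> s h x s0s h0 h1 hs xL.
have ah t z : adm (fun y => f y * hk n t (nsq (y - z))) by exact: (adm_heat cf fb).
pose K (i : 'I_n) y := hk n s (nsq (y - x - h *: evec R i)) + hk n s (nsq (y - x + h *: evec R i)) - 2 * hk n s (nsq (y - x)).
have E i : heat f s (x + h *: evec R i) + heat f s (x - h *: evec R i) - 2 * heat f s x =
    int_Rn (fun y => f y * K i y).
  rewrite /heat -int_RnZ// -int_RnD// -int_RnB//; last exact: admZ.
    apply: eq_int_Rn => y; rewrite /K.
    rewrite (_ : y - (x + h *: evec R i) = y - x - h *: evec R i); last by rewrite opprD addrA.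
    rewrite (_ : y - (x - h *: evec R i) = y - x + h *: evec R i); last by rewrite opprB addrA addrAC.
    by ring.
  exact: admD.
have cK i : scont (K i).
  apply: scontB; last by apply: scontM => //; exact: scont_hk.
  apply: scontD.
    have := @scont_hk R n s (x + h *: evec R i); congr scont; apply/funext => y.
    by rewrite opprD addrA.
  have := @scont_hk R n s (x - h *: evec R i); congr scont; apply/funext => y.
  by rewrite opprB addrA addrAC.
have aK i : adm (fun y => f y * K i y) by apply: (adm_mulf cf fb).
rewrite (eq_bigr _ (fun i _ => E i)) -int_Rn_sum// /heat -!int_RnB//; last 2 first.
- exact: admB.
- exact: adm_sum.
rewrite (eq_int_Rn (G := fun y => f y * (hk n s (nsq (y - x)) - hk n (s - h ^+ 2) (nsq (y - x)) - \sum_(i < n) K i y))); last first.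
  by move=> y; rewrite mulrBr mulr_sumr; ring.
rewrite mulrAC; apply: (int_mulf_bound cf fb).
  apply: scontB; last exact: scont_sum.
  by apply: scontB; exact: scont_hk.
move=> y yb; apply: HC => //; exact: (nsq_diff (p := p) (b := b)).
Qed.

End Heat2.

(** * Soft thresholding and its convexity inequalities *)

Section Threshold.
Variable R : realType.
Implicit Types (a b e q : R).

(* Soft threshold; it plays the role of a Dirichlet condition on [{|u| <= e}]. *)
Definition thr e a : R := Num.max 0 (a - e) - Num.max 0 (- a - e).

Variant thr_spec e a : R -> Type :=
  | ThrPos of e < a : thr_spec e a (a - e)
  | ThrNeg of a < - e : thr_spec e a (a + e)
  | ThrZero of - e <= a & a <= e : thr_spec e a 0.

Lemma thrP e a : 0 <= e -> thr_spec e a (thr e a).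
Proof.
move=> e0; rewrite /thr.
case: (leP (a - e) 0) => h1; case: (leP (- a - e) 0) => h2.
- by rewrite subrr; constructor; lra.
- by rewrite sub0r opprB opprK addrC; constructor; lra.
- by rewrite subr0; constructor; lra.
- by exfalso; lra.
Qed.

Lemma thr_le e a : 0 <= e -> `|thr e a| <= `|a|.
Proof.
move=> e0; case: (thrP a e0) => [h1|h1|h1 h1']; last by rewrite normr0.
  by rewrite !ger0_norm; lra.
by rewrite !ler0_norm; lra.
Qed.

Lemma thr_eq0 e a : 0 <= e -> `|a| <= e -> thr e a = 0.
Proof.
move=> e0; rewrite ler_norml => /andP[h1 h2].
by case: (thrP a e0) => // h; exfalso; lra.
Qed.

Lemma thr_ge e a : 0 <= e -> `|a| <= `|thr e a| + e.
Proof.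
move=> e0; case: (thrP a e0) => [h1|h1|h1 h1'].
- by rewrite !ger0_norm; lra.
- by rewrite !ler0_norm; lra.
- by rewrite normr0 ler_norml; apply/andP; split; lra.
Qed.

Lemma thr_rest e a : 0 <= e -> - e <= a - thr e a /\ a - thr e a <= e.
Proof. by move=> e0; case: (thrP a e0) => *; split; lra. Qed.

(** Where [thr e a] is nonzero, the remainder [a - thr e a] is the endpoint of [-e, e] on the same
    side, beyond every other remainder. *)
Lemma thr_mono e a b : 0 <= e -> 0 <= thr e a * ((a - thr e a) - (b - thr e b)).
Proof.
move=> e0; have [b1 b2] := thr_rest b e0; move: (b - thr e b) b1 b2 => B b1 b2.
case: (thrP a e0) => [h1|h1|h1 h1']; last by rewrite mul0r.
  by apply: mulr_ge0; lra.
by rewrite -mulrNN; apply: mulr_ge0; lra.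
Qed.

(** The square of [thr e] is convex with derivative [2 * thr e]; this is its tangent line at b. *)
Lemma thr_convex e a b : 0 <= e -> thr e b ^+ 2 - thr e a ^+ 2 <= 2 * (thr e b * (b - a)).
Proof.
move=> e0; have h := thr_mono b a e0; have := sqr_ge0 (thr e a - thr e b).
move: (thr e a) (thr e b) h => A B; lra.
Qed.

Lemma thr_lip e a b : 0 <= e -> `|thr e a - thr e b| <= `|a - b|.
Proof.
move=> e0; have h1 := thr_mono a b e0; have h2 := thr_mono b a e0.
rewrite -(ler_pXn2r (ltn0Sn 1)) ?nnegrE// !real_normK ?num_real//.
have := sqr_ge0 ((a - thr e a) - (b - thr e b)).
move: (thr e a) (thr e b) h1 h2 => A B; lra.
Qed.

(** Discrete form of grad(psi^2 g) . grad u >= - |grad psi|^2 g^2 for g = thr(u), proved likewise by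
    completing a square. *)
Lemma thr_cross e a b q r : 0 <= e ->
  - ((q - r) ^+ 2 * (`|thr e a| * `|thr e b|)) <= (q ^+ 2 * thr e a - r ^+ 2 * thr e b) * (a - b).
Proof.
move=> e0.
have h1 := mulr_ge0 (sqr_ge0 q) (thr_mono a b e0).
have h2 := mulr_ge0 (sqr_ge0 r) (thr_mono b a e0).
have h3 : (q - r) ^+ 2 * (thr e a * thr e b) <= (q - r) ^+ 2 * (`|thr e a| * `|thr e b|).
  by rewrite -normrM; apply: ler_wpM2l; [exact: sqr_ge0|exact: ler_norm].
have h4 := sqr_ge0 (q * thr e a - r * thr e b).
move: (thr e a) (thr e b) h1 h2 h3 h4 => A B; lra.
Qed.

Lemma thr_cont e : continuous (thr e).
Proof.
move=> a; rewrite /thr.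
have cm (g : R -> R) : {for a, continuous g} -> {for a, continuous (fun x => Num.max 0 (g x))}.
  by move=> cg; apply: continuous_max => //; exact: cst_continuous.
apply: cvgB; apply: cm; apply: cvgB; try exact: cvg_cst; [exact: cvg_id|].
by apply: cvgN; exact: cvg_id.
Qed.
End Threshold.

(** * Weighted energy estimate *)

Section Gronwall.
Variable R : realType.

(** The hypothesis is a differential inequality tested with time steps h^2 and error O(h) per unit
    of time; since h is free below [h1], the error is pushed below the arbitrary [k]. *)
Lemma gronwall_discrete (I : R -> R) (a b C h1 s0 s1 k : R) : 0 < a -> 0 <= b -> 0 <= C -> 0 < h1 ->
  s0 < s1 -> (forall s, 0 <= I s) -> 0 < k ->
  (forall h s, 0 < h -> h <= h1 -> s0 <= s - h ^+ 2 -> s <= s1 ->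
     I s - I (s - h ^+ 2) <= h ^+ 2 * (a * I s + b + C * h)) ->
  I s1 <= 2 * (I s0 + b / a + k) * expR (a * (s1 - s0)).
Proof.
move=> a0 b0 C0 h10 s01 I0 k0 H.
pose T := s1 - s0; have T0 : 0 < T by rewrite subr_gt0.
(* Since a * be = b + a * k dominates b + C * h, adding [be] to I makes the recursion
   homogeneous. *)
pose be := b / a + k.
have be0 : 0 <= be by rewrite addr_ge0 ?divr_ge0 // ltW.
pose m := a * k / (C + 1).
have C1 : 0 < C + 1 by rewrite ltr_wpDl.
have m0 : 0 < m by rewrite divr_gt0// mulr_gt0.
(* One summand per requirement on N > B: h <= h1, h <= m (that is, C * h <= a * k), 2 (a T)^2 / N <=
   1/2, and x <= 1/2. *)
pose B := T / h1 ^+ 2 + T / m ^+ 2 + 4 * (a * T) ^+ 2 + 2 * (a * T) + 1.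
have B1 : 0 <= T / h1 ^+ 2 by rewrite divr_ge0 ?sqr_ge0// ltW.
have B2 : 0 <= T / m ^+ 2 by rewrite divr_ge0 ?sqr_ge0// ltW.
have B3 : 0 <= (a * T) ^+ 2 by rewrite sqr_ge0.
have aT0 : 0 < a * T by rewrite mulr_gt0.
have B0 : 0 < B by rewrite /B; lra.
pose N := (Num.Def.archi_bound B).
have BN : B < N%:R by apply: archi_boundP; exact: ltW.
have N0 : 0 < N%:R :> R := lt_trans B0 BN.
pose h := Num.sqrt (T / N%:R).
have hh : h ^+ 2 = T / N%:R by rewrite sqr_sqrtr// divr_ge0// ltW.
have h0 : 0 < h by rewrite sqrtr_gt0 divr_gt0.
have le_h c : 0 < c -> T / c ^+ 2 < N%:R -> h <= c.
  move=> c0 cN; rewrite -(ler_pXn2r (ltn0Sn 1)) ?nnegrE ?(ltW h0) ?(ltW c0)// hh.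
  rewrite ler_pdivrMr// mulrC -ler_pdivrMr ?exprn_gt0//; exact: ltW.
have hh1 : h <= h1 by apply: le_h => //; apply: le_lt_trans BN; rewrite /B; lra.
have hm : h <= m by apply: le_h => //; apply: le_lt_trans BN; rewrite /B; lra.
have Ch : C * h <= a * k.
  apply: (@le_trans _ _ ((C + 1) * m)); last by rewrite /m mulrC divfK// gt_eqF.
  by apply: ler_pM => //; [exact: ltW|rewrite lerDl].
pose x := a * h ^+ 2.
have xE : x = a * T / N%:R by rewrite /x hh mulrA.
have x0 : 0 <= x by rewrite mulr_ge0 ?sqr_ge0// ltW.
have x1 : x <= 2^-1.
  rewrite xE ler_pdivrMr// -ler_pdivrMl; last by rewrite invr_gt0.
  by rewrite invrK; apply: ltW; apply: le_lt_trans BN; rewrite /B; lra.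
have step j : (j <= N)%N -> (I (s0 + j%:R * h ^+ 2) + be) * (1 - x) ^+ j <= I s0 + be.
  elim: j => [|j IH] jN; first by rewrite mul0r addr0 expr0 mulr1.
  apply: le_trans (IH (ltnW jN)); rewrite [(1 - x) ^+ _]exprS [leLHS]mulrA; apply: ler_wpM2r.
    by apply: exprn_ge0; lra.
  have e1 : s0 + j.+1%:R * h ^+ 2 - h ^+ 2 = s0 + j%:R * h ^+ 2 by rewrite -natr1; ring.
  have := H h (s0 + j.+1%:R * h ^+ 2) h0 hh1; rewrite e1.
  have e2 : s0 <= s0 + j%:R * h ^+ 2 by rewrite lerDl mulr_ge0// sqr_ge0.
  have e3 : s0 + j.+1%:R * h ^+ 2 <= s1.
    rewrite -lerBrDl -/T hh mulrCA; apply: ler_piMr; first exact: ltW.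
    by rewrite ler_pdivrMr// mul1r ler_nat.
  move=> /(_ e2 e3) h2.
  have h3 : h ^+ 2 * (C * h) <= h ^+ 2 * (a * k) by apply: ler_wpM2l; [exact: sqr_ge0|].
  have h4 : a * be = b + a * k by rewrite /be; field; rewrite gt_eqF.
  have h5 : x * be = h ^+ 2 * b + h ^+ 2 * (a * k) by rewrite /x mulrAC [a * be]h4; ring.
  by move: h2 h3 h5; rewrite /x; clear; lra.
have := step N (leqnn N).
have -> : s0 + N%:R * h ^+ 2 = s1 by rewrite hh mulrC divfK ?gt_eqF// /T addrC subrK.
(* From 1 - x >= exp(-x - 2 x^2), the power loses at most the factor exp(-2 (a T)^2 / N) >= 1/2
   against exp(-a T); this is the 2 in the conclusion. *)
have low : expR (- (a * T)) / 2 <= (1 - x) ^+ N.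
  have l1 : expR (- x - 2 * x ^+ 2) <= 1 - x.
    have p : 0 < 1 - x by lra.
    rewrite -[leRHS]lnK ?posrE// ler_expR.
    by have := ln_taylor x0 x1; rewrite ler_norml => /andP[h2 _]; lra.
  have l2 : expR (- x - 2 * x ^+ 2) ^+ N <= (1 - x) ^+ N.
    by rewrite lerXn2r ?nnegrE ?expR_ge0//; lra.
  apply: le_trans l2; rewrite -expRM_natl.
  have -> : N%:R * (- x - 2 * x ^+ 2) = - (a * T) + - (2 * (a * T) ^+ 2 / N%:R).
    by rewrite xE; field; rewrite gt_eqF.
  rewrite expRD; apply: ler_wpM2l; first exact: expR_ge0.
  apply: le_trans (expR_ge1Dx _).
  have : 2 * (a * T) ^+ 2 / N%:R <= 2^-1.
    rewrite ler_pdivrMr// -ler_pdivrMl; last by rewrite invr_gt0.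
    by rewrite invrK; apply: ltW; apply: le_lt_trans BN; rewrite /B; lra.
  lra.
move=> fin; have Ib : 0 <= I s1 + be by rewrite addr_ge0.
have f2 := le_trans (ler_wpM2l Ib low) fin.
have f3 : I s1 + be <= 2 * (I s0 + be) * expR (a * T).
  have e0 := expR_gt0 (a * T).
  rewrite -ler_pdivrMr// -expRN mulrC; move: f2; rewrite mulrA [X in X / 2]mulrC; clear; lra.
by move: f3; rewrite /be !addrA; move: be0; rewrite /be; clear; lra.
Qed.
End Gronwall.

Section EnergyStep.
Variables (R : realType) (n : nat).
Local Notation V := 'rV[R]_n.
Implicit Types (u v w x y z p : V) (a b c r s t h e : R).

(* Summation by parts for the second difference of [u] in direction [v]. *)
Lemma shift_energy (p : V) b e (psi u : V -> R) v : 0 <= e -> scont psi -> scont u ->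
  (forall y, b < nsq (y - p) -> psi y = 0) ->
  adm (fun y => (psi y - psi (y + v)) ^+ 2 * (`|thr e (u y)| * `|thr e (u (y + v))|)) /\
  int_Rn (fun y => psi y ^+ 2 * thr e (u y) * (u (y + v) + u (y - v) - 2 * u y)) <=
  int_Rn (fun y => (psi y - psi (y + v)) ^+ 2 * (`|thr e (u y)| * `|thr e (u (y + v))|)).
Proof.
move=> e0 cp cu pb.
have cg : scont (fun y => thr e (u y)) by apply: scont_comp cu; exact: thr_cont.
have cup : scont (fun y => u (y + v)) by exact: scont_shift.
have cum : scont (fun y => u (y - v)) by exact: scont_shift.
have cpp : scont (fun y => psi (y + v)) by exact: scont_shift.
have cgp : scont (fun y => thr e (u (y + v))) by apply: scont_comp cup; exact: thr_cont.
have A (X : V -> R) : scont X -> adm (fun y => psi y * X y) by exact: (adm_mulf cp pb).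
have pb' y : b < nsq (y - (p - v)) -> psi (y + v) = 0.
  by rewrite opprB addrA => h; exact: pb.
have A' (X : V -> R) : scont X -> adm (fun y => psi (y + v) * X y) by exact: (adm_mulf cpp pb').
have aQ : adm (fun y => (psi y - psi (y + v)) ^+ 2 * (`|thr e (u y)| * `|thr e (u (y + v))|)).
  have cX : scont (fun y => `|thr e (u y)| * `|thr e (u (y + v))|) by apply: scontM; exact: scont_norm.
  apply: eq_adm (admD (A (fun y => (psi y - 2 * psi (y + v)) * (`|thr e (u y)| * `|thr e (u (y + v))|)) _)
     (A' (fun y => psi (y + v) * (`|thr e (u y)| * `|thr e (u (y + v))|)) _)).
  - by move=> y; ring.
  - by apply: scontM => //; apply: scontB => //; exact: scontM.
  - exact: scontM.
split=> //.
have a1 : adm (fun y => psi y ^+ 2 * thr e (u y) * (u y - u (y + v))).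
  apply: eq_adm (A (fun y => psi y * thr e (u y) * (u y - u (y + v))) _); first by move=> y; ring.
  by apply: scontM; [exact: scontM|exact: scontB].
have a2 : adm (fun y => psi y ^+ 2 * thr e (u y) * (u y - u (y - v))).
  apply: eq_adm (A (fun y => psi y * thr e (u y) * (u y - u (y - v))) _); first by move=> y; ring.
  by apply: scontM; [exact: scontM|exact: scontB].
have a3 : adm (fun y => psi (y + v) ^+ 2 * thr e (u (y + v)) * (u (y + v) - u y)).
  by apply: eq_adm (adm_shift v a2) => y; rewrite addrK.
have e2 : int_Rn (fun y => psi y ^+ 2 * thr e (u y) * (u y - u (y - v))) =
          int_Rn (fun y => psi (y + v) ^+ 2 * thr e (u (y + v)) * (u (y + v) - u y)).
  by rewrite -(int_shift v a2); apply: eq_int_Rn => y; rewrite addrK.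
have -> : int_Rn (fun y => psi y ^+ 2 * thr e (u y) * (u (y + v) + u (y - v) - 2 * u y)) =
  - (int_Rn (fun y => psi y ^+ 2 * thr e (u y) * (u y - u (y + v))) +
     int_Rn (fun y => psi y ^+ 2 * thr e (u y) * (u y - u (y - v)))).
  rewrite -int_RnD// -int_RnN; last exact: admD.
  by apply: eq_int_Rn => y; ring.
rewrite e2 -int_RnD// -int_RnN; last exact: admD.
apply: le_int_Rn => //; first by apply: admN; exact: admD.
move=> y; have := thr_cross (u y) (u (y + v)) (psi y) (psi (y + v)) e0.
move: (psi y) (psi (y + v)) => P P'; lra.
Qed.

(** Discrete form of d/dt int psi^2 g^2 = 2 int psi^2 g Lap u <= 2 int |grad psi|^2 g^2 with g =
    thr(u). [Q] bounds the gradient term and [E] the defect in the heat equation. *)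
Lemma energy_step (p : V) b e (psi u1 u0 Q : V -> R) h E : 0 <= e -> scont psi -> scont u1 -> scont u0 ->
  (forall y, b < nsq (y - p) -> psi y = 0) -> adm Q ->
  (forall y, nsq (y - p) <= b ->
   `|u1 y - u0 y - \sum_(i < n) (u1 (y + h *: evec R i) + u1 (y - h *: evec R i) - 2 * u1 y)| <= E) ->
  (forall y, \sum_(i < n) (psi y - psi (y + h *: evec R i)) ^+ 2 *
      (`|thr e (u1 y)| * `|thr e (u1 (y + h *: evec R i))|) <= Q y) ->
  int_Rn (fun y => psi y ^+ 2 * thr e (u1 y) ^+ 2) - int_Rn (fun y => psi y ^+ 2 * thr e (u0 y) ^+ 2) <=
  2 * int_Rn Q + 2 * (E * int_Rn (fun y => psi y ^+ 2 * `|thr e (u1 y)|)).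
Proof.
move=> e0 cp c1 c0 pb aQ H1 H2.
have cg (u : V -> R) : scont u -> scont (fun y => thr e (u y)) by move=> cu; apply: scont_comp cu; exact: thr_cont.
have A (X : V -> R) : scont X -> adm (fun y => psi y ^+ 2 * X y).
  move=> cX; apply: eq_adm (adm_mulf cp pb (F := fun y => psi y * X y) _); first by move=> y; ring.
  exact: scontM.
have ag (u : V -> R) : scont u -> adm (fun y => psi y ^+ 2 * thr e (u y) ^+ 2).
  by move=> cu; apply: A; apply: scontX; exact: cg.
have an : adm (fun y => psi y ^+ 2 * `|thr e (u1 y)|) by apply: A; apply: scont_norm; exact: cg.
pose d i y := u1 (y + h *: evec R i) + u1 (y - h *: evec R i) - 2 * u1 y.
have cd i : scont (d i).
  by apply: scontB; [apply: scontD; exact: scont_shift|apply: scontM].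
have ad i : adm (fun y => psi y ^+ 2 * thr e (u1 y) * d i y).
  apply: eq_adm (A (fun y => thr e (u1 y) * d i y) _); first by move=> y; ring.
  by apply: scontM => //; exact: cg.
pose q i y := (psi y - psi (y + h *: evec R i)) ^+ 2 * (`|thr e (u1 y)| * `|thr e (u1 (y + h *: evec R i))|).
have SE i := shift_energy (h *: evec R i) e0 cp c1 pb.
have aq i : adm (q i) by have [] := SE i.
have S : \sum_(i < n) int_Rn (fun y => psi y ^+ 2 * thr e (u1 y) * d i y) <= int_Rn Q.
  apply: (@le_trans _ _ (\sum_(i < n) int_Rn (q i))).
    by apply: ler_sum => i _; have [] := SE i.
  rewrite -int_Rn_sum//; apply: le_int_Rn => //; exact: adm_sum.
rewrite -int_RnB; [|exact: ag|exact: ag].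
apply: (@le_trans _ _ (int_Rn (fun y => 2 * (\sum_(i < n) psi y ^+ 2 * thr e (u1 y) * d i y) +
    2 * (E * (psi y ^+ 2 * `|thr e (u1 y)|))))).
  apply: le_int_Rn; first by apply: admB; exact: ag.
    by apply: admD; apply: admZ; [exact: adm_sum|exact: admZ].
  move=> y; rewrite -mulr_sumr; have [yb|yb] := leP (nsq (y - p)) b; last first.
    by rewrite pb// expr0n /= !(mul0r, mulr0) subrr addr0.
  have := H1 y yb; rewrite -/(d _ _); set S0 := \sum_(i < n) _; move=> h1.
  have h2 := thr_convex (u0 y) (u1 y) e0.
  have h3 : thr e (u1 y) * (u1 y - u0 y - S0) <= `|thr e (u1 y)| * E.
    by apply: le_trans (ler_norm _) _; rewrite normrM; apply: ler_wpM2l.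
  have h4 := sqr_ge0 (psi y).
  rewrite -mulrBr; apply: (@le_trans _ _ (psi y ^+ 2 * (2 * (thr e (u1 y) * S0) + 2 * (`|thr e (u1 y)| * E)))).
    by apply: ler_wpM2l => //; lra.
  rewrite le_eqVlt; apply/orP; left; apply/eqP; ring.
rewrite int_RnD; [|by apply: admZ; exact: adm_sum|by apply: admZ; exact: admZ].
rewrite !int_RnZ//; [|exact: admZ|exact: adm_sum].
by rewrite int_Rn_sum//; apply: lerD => //; apply: ler_wpM2l.
Qed.

End EnergyStep.

Section HeatEnergy.
Variables (R : realType) (n : nat).
Local Notation V := 'rV[R]_n.
Implicit Types (u v w x y z p : V) (a c r s t h e : R).

(** Subtracting 1 and clipping makes the weight vanish continuously where D <= eta, hence at all
    points that no short chain reaches. The price is that its gradient is bounded by lam (psi + 1)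
    instead of lam psi. *)
Definition psi_of (lam eta : R) (D : V -> R) y : R := Num.max 0 (expR (lam * (D y - eta)) - 1).

(** The clipped function plus 1 is the exponential of max(0, a), and clipping is 1-Lipschitz. *)
Lemma expm1_lip (a b : R) : `|Num.max 0 (expR a - 1) - Num.max 0 (expR b - 1)| <=
  (Num.max 0 (expR a - 1) + 1) * (`|a - b| * expR `|a - b|).
Proof.
have E c : Num.max 0 (expR c - 1) + 1 = expR (Num.max 0 c).
  have [c0|c0] := leP c 0.
    by rewrite max_l ?add0r ?expR0// subr_le0 -expR0 ler_expR.
  by rewrite max_r ?subrK// subr_ge0 -expR0 ler_expR ltW.
rewrite (_ : _ - _ = (Num.max 0 (expR a - 1) + 1) - (Num.max 0 (expR b - 1) + 1)); last by ring.
rewrite !E; set A := Num.max 0 a; set B := Num.max 0 b.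
have AB : `|B - A| <= `|a - b|.
  rewrite /A /B distrC; case: (leP a 0) => ha; case: (leP b 0) => hb; rewrite ?subrr ?normr0 ?subr0 ?sub0r ?normrN//.
  - by rewrite !ler_norml; rewrite [`|_ - _|]ler0_norm; lra.
  - by rewrite gtr0_norm// ger0_norm; lra.
rewrite (_ : expR A - expR B = - (expR A * (expR (B - A) - 1))); last first.
  by rewrite mulrBr mulr1 -expRD (_ : A + (B - A) = B) ?opprB// addrC subrK.
rewrite normrN normrM ger0_norm ?expR_ge0//; apply: ler_wpM2l; first exact: expR_ge0.
apply: le_trans (exp_taylor1 _) _.
by apply: ler_pM => //; rewrite ?expR_ge0 ?ler_expR.
Qed.

Variables (f : V -> R) (M b : R) (p : V).
Hypotheses (cf : scont f) (fM : forall y, `|f y| <= M) (fb : forall y, b < nsq (y - p) -> f y = 0).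
Hypothesis b0 : 0 <= b.
Variables (rho e s0 s1 lam del eta : R) (D : V -> R) (Gd : V -> Prop).
Hypotheses (rho0 : 0 < rho) (e0 : 0 <= e) (s00 : 0 < s0) (s01 : s0 < s1) (lam0 : 0 < lam)
  (del0 : 0 < del) (eta0 : 0 <= eta).
Hypotheses (cD : scont D) (Drho : forall y, 0 <= D y <= rho)
  (Dsupp : forall y, (rho + 1) ^+ 2 < nsq (y - p) -> D y = 0).
Hypothesis HG : forall s y, s0 <= s -> s <= s1 -> nsq (y - p) <= (rho + 2) ^+ 2 -> ~ Gd y ->
  `|heat f s y| <= e.
Hypothesis HD : exists Cd h0, [/\ 0 <= Cd, 0 < h0 & forall h y, 0 < h -> h <= h0 -> Gd y ->
  nsq (y - p) <= (rho + 2) ^+ 2 ->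
  \sum_(i < n) (D y - D (y + h *: evec R i)) ^+ 2 <= h ^+ 2 * (1 + Cd * h)].

Let psi := psi_of lam eta D.
Let theta y := cutoff ((rho + 2) ^+ 2) (nsq (y - p)).
Let G := M * hmass R n.
Let energy s := int_Rn (fun y => psi y ^+ 2 * thr e (heat f s y) ^+ 2).
Let a := 2 * lam ^+ 2 * (1 + del).
Let bb := 2 * lam ^+ 2 * (1 + del^-1) * G ^+ 2 * int_Rn theta.

Let cpsi : scont psi.
Proof.
apply: scont_max => //; apply: scontB => //.
apply: (scont_comp (f := expR)); first exact: continuous_expR.
by apply: scontM => //; apply: scontB.
Qed.

Let psi_ge0 y : 0 <= psi y. Proof. by rewrite /psi /psi_of le_max lexx. Qed.

Let psi_supp y : (rho + 1) ^+ 2 < nsq (y - p) -> psi y = 0.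
Proof.
move=> /Dsupp h; rewrite /psi /psi_of h max_l// subr_le0 -expR0 ler_expR sub0r mulrN oppr_le0.
by rewrite mulr_ge0// ltW.
Qed.

Let psi_le y : psi y + 1 <= expR (lam * rho).
Proof.
have [h1 h2] := andP (Drho y).
rewrite -lerBrDr /psi /psi_of ge_max; apply/andP; split.
  by rewrite subr_ge0 -expR0 ler_expR mulr_ge0// ltW.
by rewrite lerD2r ler_expR; apply: ler_wpM2l; [exact: ltW|rewrite (le_trans _ h2)// gerBl].
Qed.

Let G0 : 0 <= G.
Proof. by apply: mulr_ge0; [exact: le_trans (fM 0)|exact: hmass_ge0]. Qed.

Let adm_theta : adm theta.
Proof.
apply: (@csupp_adm _ _ _ p ((rho + 2) ^+ 2 + 1)).
  by apply: scont_cutoff; exact: scont_nsq.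
by move=> y h; rewrite /theta cutoff_0// ltW.
Qed.

(** Off [Gd] the thresholded evolution vanishes; on [Gd] the discrete gradient of [psi] is at most
    lam (psi + 1), up to O(h). Young's inequality (psi + 1)^2 <= (1 + del) psi^2 + 1 + 1/del then
    splits this into the growth rate [a] and the source [bb]. *)
Lemma heat_energy_step : exists C h1, [/\ 0 <= C, 0 < h1 & forall h s, 0 < h -> h <= h1 ->
  s0 <= s - h ^+ 2 -> s <= s1 ->
  energy s - energy (s - h ^+ 2) <= h ^+ 2 * (a * energy s + bb + C * h)].
Proof.
have [Cd [h0 [Cd0 h00 HDh]]] := HD.
have L0 : 0 <= (rho + 2) ^+ 2 by exact: sqr_ge0.
have [CL CL0 HL] := heat_lip cf fb s00 b0 L0.
have [CE CE0 HE] := heat_expand cf fb b0 s00 L0.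
pose Psi := expR (lam * rho).
have Psi0 : 0 <= Psi by exact: expR_ge0.
have V0 : 0 <= int_Rn theta by apply: int_Rn_ge0 => y; exact: cutoff_ge0.
pose ka := lam * (1 + Cd) * expR (lam * (1 + Cd)).
have lC : 0 <= lam * (1 + Cd) by apply: mulr_ge0; [exact: ltW|exact: addr_ge0].
have ka0 : 0 <= ka by apply: mulr_ge0 => //; exact: expR_ge0.
pose k2 := 2 * ka + ka ^+ 2.
have k20 : 0 <= k2 by rewrite addr_ge0 ?sqr_ge0// mulr_ge0.
pose C4 := k2 + Cd + k2 * Cd.
have C40 : 0 <= C4 by rewrite !addr_ge0// mulr_ge0.
pose C3 := lam ^+ 2 * (Psi ^+ 2 * (G ^+ 2 * C4 + G * CL * (1 + C4))).
have C30 : 0 <= C3.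
  apply: mulr_ge0; first exact: sqr_ge0.
  apply: mulr_ge0; first exact: sqr_ge0.
  apply: addr_ge0; first by apply: mulr_ge0 => //; exact: sqr_ge0.
  by apply: mulr_ge0; [exact: mulr_ge0|exact: addr_ge0].
have dl0 : 0 <= 1 + del^-1 by rewrite addr_ge0// invr_ge0 ltW.
exists (2 * C3 * int_Rn theta + 2 * CE * (Psi ^+ 2 * G * int_Rn theta)).
exists (Num.min (Num.min 2^-1 h0) (Num.min 2^-1 (s0 / 2))); split.
- apply: addr_ge0; first by apply: mulr_ge0 => //; apply: mulr_ge0.
  apply: mulr_ge0; first exact: mulr_ge0.
  by apply: mulr_ge0 => //; apply: mulr_ge0 => //; exact: sqr_ge0.
- by rewrite !lt_min h00 !invr_gt0 ltr0n /= divr_gt0.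
move=> h s hp; rewrite !le_min => /andP[/andP[h2 hh0] /andP[_ hs0]] s0s ss1.
have h1 : h <= 1 by lra.
have hsq : h ^+ 2 <= h by rewrite expr2 ler_piMl// ltW.
have h20 : 0 <= h ^+ 2 by exact: sqr_ge0.
have s0s' : s0 <= s by apply: le_trans s0s _; rewrite gerBl.
have sp : 0 < s := lt_le_trans s00 s0s'.
have sp' : 0 < s - h ^+ 2 := lt_le_trans s00 s0s.
pose g y := thr e (heat f s y).
have gG y : `|g y| <= G by apply: le_trans (thr_le _ e0) _; exact: heat_bound cf fM fb _ _ sp.
have e1 i : en (h *: evec R i : V) = h.
  by rewrite enZ gtr0_norm// /en nsq_evec sqrtr1 mulr1.
pose Q y := h ^+ 2 * (lam ^+ 2 * (1 + del) * (psi y ^+ 2 * g y ^+ 2) +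
                      (lam ^+ 2 * (1 + del^-1) * G ^+ 2 + C3 * h) * theta y).
have cg : scont g by apply: (scont_comp (f := thr e)); [exact: thr_cont|exact: (scont_heat cf fb)].
have apg : adm (fun y => psi y ^+ 2 * g y ^+ 2).
  apply: eq_adm (adm_mulf cpsi psi_supp (F := fun y => psi y * g y ^+ 2) _); first by move=> y; ring.
  by apply: scontM => //; exact: scontX.
have aQ : adm Q by apply: admZ; apply: admD; apply: admZ.
have HQ y : \sum_(i < n) (psi y - psi (y + h *: evec R i)) ^+ 2 *
      (`|thr e (heat f s y)| * `|thr e (heat f s (y + h *: evec R i))|) <= Q y.
  have Q0 : 0 <= Q y.
    apply: mulr_ge0 => //; apply: addr_ge0.
      apply: mulr_ge0; last by apply: mulr_ge0; exact: sqr_ge0.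
      by apply: mulr_ge0; [exact: sqr_ge0|rewrite addr_ge0// ltW].
    apply: mulr_ge0; last exact: cutoff_ge0.
    apply: addr_ge0; last by apply: mulr_ge0 => //; exact: ltW.
    by apply: mulr_ge0; [apply: mulr_ge0 => //; exact: sqr_ge0|exact: sqr_ge0].
  (* [psi] lives within radius rho + 1 and h <= 1, so beyond rho + 2 it vanishes at y and at all
     shifted points. *)
  have [yb|yb] := leP (nsq (y - p)) ((rho + 2) ^+ 2); last first.
    rewrite big1// => i _.
    have r2 : 0 < rho + 2 by rewrite addr_gt0.
    have yb' : rho + 2 < en (y - p).
      by rewrite ltNge en_le_nsq ?(ltW r2)// -ltNge.
    have yi : rho + 1 < en (y + h *: evec R i - p).
      have := en_split (y - p) (- (h *: evec R i)) 0.
      rewrite !subr0 opprK enN e1 (_ : y - p + h *: evec R i = y + h *: evec R i - p); last by rewrite addrAC.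
      by move: yb' h1; lra.
    have r1 : 0 <= rho + 1 by rewrite addr_ge0// ltW.
    rewrite !psi_supp ?subrr ?expr0n ?mul0r//; rewrite -en_sq ltrXn2r ?nnegrE ?en_ge0//.
    by apply: lt_trans yb'; rewrite ltrD2l ltr1n.
  have [g0|gn0] := eqVneq (g y) 0.
    by rewrite -/(g y) g0 normr0 big1// => i _; rewrite mul0r mulr0.
  have Gdy : Gd y.
    apply: contrapT => nG; move/eqP: gn0; apply.
    by apply: thr_eq0 => //; exact: HG.
  have HS := HDh h y hp hh0 Gdy yb.
  have th1 : theta y = 1 by rewrite /theta cutoff_1.
  have Ch0 : 0 <= Cd * h by rewrite mulr_ge0// ltW.
  have Di i : `|D y - D (y + h *: evec R i)| <= h * (1 + Cd).
    have hc0 : 0 <= h * (1 + Cd) by apply: mulr_ge0; [exact: ltW|exact: addr_ge0].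
    rewrite -(ler_pXn2r (ltn0Sn 1)) ?nnegrE// real_normK ?num_real//.
    apply: (@le_trans _ _ (h ^+ 2 * (1 + Cd * h))).
      apply: le_trans HS; rewrite (bigD1 i)//= lerDl.
      by apply: sumr_ge0 => j _; exact: sqr_ge0.
    rewrite exprMn; apply: ler_wpM2l => //; rewrite expr2.
    have : Cd * h <= Cd by rewrite ler_piMr.
    have : 0 <= Cd * Cd by exact: mulr_ge0.
    lra.
  have Ei i : `|psi y - psi (y + h *: evec R i)| <= lam * (psi y + 1) * (1 + ka * h) * `|D y - D (y + h *: evec R i)|.
    have := expm1_lip (lam * (D y - eta)) (lam * (D (y + h *: evec R i) - eta)).
    rewrite -/(psi_of lam eta D y) -/(psi_of lam eta D (y + h *: evec R i)) -/(psi y) -/(psi (y + h *: evec R i)).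
    rewrite -mulrBr (_ : D y - eta - (D (y + h *: evec R i) - eta) = D y - D (y + h *: evec R i)); last by ring.
    rewrite normrM (gtr0_norm lam0); set d := `|D y - D (y + h *: evec R i)|.
    have ld : lam * d <= lam * (1 + Cd) * h.
      by rewrite -mulrA; apply: ler_wpM2l; [exact: ltW|rewrite mulrC; exact: Di].
    have d0 : 0 <= lam * d by apply: mulr_ge0; [exact: ltW|exact: normr_ge0].
    have ex : expR (lam * d) <= 1 + ka * h.
      apply: (@le_trans _ _ (expR (lam * (1 + Cd) * h))); first by rewrite ler_expR.
      have := exp_taylor1 (lam * (1 + Cd) * h).
      have lCh : 0 <= lam * (1 + Cd) * h by apply: mulr_ge0 => //; exact: ltW.
      rewrite (ger0_norm lCh) => /(le_trans (ler_norm _)).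
      have : lam * (1 + Cd) * h * expR (lam * (1 + Cd) * h) <= ka * h.
        rewrite /ka mulrAC; apply: ler_wpM2r; first exact: ltW.
        by apply: ler_wpM2l => //; rewrite ler_expR ler_piMr.
      lra.
    move=> /le_trans; apply; rewrite (_ : lam * (psi y + 1) * _ * d = (psi y + 1) * (lam * d * (1 + ka * h))); last by ring.
    apply: ler_wpM2l; first by rewrite addr_ge0.
    by apply: ler_wpM2l.
  have gi i : `|thr e (heat f s (y + h *: evec R i))| <= `|g y| + CL * h.
    have := thr_lip (heat f s (y + h *: evec R i)) (heat f s y) e0.
    have := HL s y (h *: evec R i) s0s'; rewrite e1 => /(_ h1 yb) l1 l2.
    rewrite -(subrK (g y) (thr e _)) (le_trans (ler_normD _ _))// addrC lerD2l.
    exact: le_trans l2 l1.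
  pose W := (lam * (psi y + 1) * (1 + ka * h)) ^+ 2 * (g y ^+ 2 + G * CL * h).
  have W0 : 0 <= W.
    apply: mulr_ge0; first exact: sqr_ge0.
    apply: addr_ge0; first exact: sqr_ge0.
    by apply: mulr_ge0; [exact: mulr_ge0|exact: ltW].
  apply: (@le_trans _ _ (\sum_(i < n) W * (D y - D (y + h *: evec R i)) ^+ 2)).
    apply: ler_sum => i _; rewrite /W [leRHS]mulrAC; apply: ler_pM.
    - exact: sqr_ge0.
    - exact: mulr_ge0.
    - rewrite -exprMn -[leLHS]real_normK ?num_real// -[leRHS]real_normK ?num_real//.
      rewrite lerXn2r ?nnegrE// normrM (ger0_norm (_ : 0 <= lam * (psi y + 1) * (1 + ka * h)))//.
      apply: mulr_ge0; last by rewrite addr_ge0// mulr_ge0// ltW.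
      by apply: mulr_ge0; [exact: ltW|rewrite addr_ge0].
    - rewrite -/(g y); apply: (@le_trans _ _ (`|g y| * (`|g y| + CL * h))); first exact: ler_wpM2l.
      rewrite mulrDr -expr2 real_normK ?num_real// lerD2l mulrA; apply: ler_wpM2r; first exact: ltW.
      exact: ler_wpM2r.
  rewrite -mulr_sumr; apply: le_trans (ler_wpM2l W0 HS) _.
  rewrite /Q th1 mulr1 mulrCA; apply: ler_wpM2l => //.
  have P1 : (1 + ka * h) ^+ 2 <= 1 + k2 * h.
    have : ka ^+ 2 * h ^+ 2 <= ka ^+ 2 * h by apply: ler_wpM2l; [exact: sqr_ge0|].
    move=> q; have -> : (1 + ka * h) ^+ 2 = 1 + 2 * ka * h + ka ^+ 2 * h ^+ 2 by ring.
    have -> : 1 + k2 * h = 1 + 2 * ka * h + ka ^+ 2 * h by rewrite /k2; ring.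
    by rewrite lerD2l.
  have P2 : (1 + ka * h) ^+ 2 * (1 + Cd * h) <= 1 + C4 * h.
    apply: (@le_trans _ _ ((1 + k2 * h) * (1 + Cd * h))).
      by apply: ler_wpM2r => //; exact: addr_ge0.
    have : k2 * Cd * h ^+ 2 <= k2 * Cd * h by apply: ler_wpM2l => //; exact: mulr_ge0.
    by rewrite /C4; lra.
  have X0 : 0 <= (psi y + 1) ^+ 2 by exact: sqr_ge0.
  have XP : (psi y + 1) ^+ 2 <= Psi ^+ 2.
    by rewrite lerXn2r ?nnegrE ?addr_ge0//; exact: psi_le.
  have gg : g y ^+ 2 <= G ^+ 2 by rewrite -[leLHS]real_normK ?num_real// lerXn2r ?nnegrE.
  have gg0 : 0 <= g y ^+ 2 by exact: sqr_ge0.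
  have young : (psi y + 1) ^+ 2 <= (1 + del) * psi y ^+ 2 + (1 + del^-1).
    have := sqr_ge0 (del * psi y - 1).
    have -> : (1 + del) * psi y ^+ 2 + (1 + del^-1) = (psi y + 1) ^+ 2 + (del * psi y - 1) ^+ 2 / del.
      by field; rewrite gt_eqF.
    by move=> ?; rewrite lerDl divr_ge0// ltW.
  rewrite (_ : W * (1 + Cd * h) = lam ^+ 2 * (((psi y + 1) ^+ 2 * (g y ^+ 2 + G * CL * h)) * ((1 + ka * h) ^+ 2 * (1 + Cd * h)))); last by rewrite /W; ring.
  have Y0 : 0 <= (psi y + 1) ^+ 2 * (g y ^+ 2 + G * CL * h).
    apply: mulr_ge0 => //; apply: addr_ge0 => //.
    by apply: mulr_ge0; [exact: mulr_ge0|exact: ltW].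
  apply: (@le_trans _ _ (lam ^+ 2 * (((psi y + 1) ^+ 2 * (g y ^+ 2 + G * CL * h)) * (1 + C4 * h)))).
    by apply: ler_wpM2l; [exact: sqr_ge0|exact: ler_wpM2l].
  rewrite [leRHS](_ : _ = lam ^+ 2 * (((1 + del) * psi y ^+ 2) * g y ^+ 2 + (1 + del^-1) * G ^+ 2 +
      h * (Psi ^+ 2 * (G ^+ 2 * C4 + G * CL * (1 + C4))))); last by rewrite /C3; ring.
  apply: ler_wpM2l; first exact: sqr_ge0.
  rewrite (_ : _ * (1 + C4 * h) = (psi y + 1) ^+ 2 * g y ^+ 2 + h * ((psi y + 1) ^+ 2 * (g y ^+ 2 * C4 + G * CL * (1 + C4 * h)))); last by ring.
  apply: lerD.
    apply: (@le_trans _ _ (((1 + del) * psi y ^+ 2 + (1 + del^-1)) * g y ^+ 2)); first exact: ler_wpM2r.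
    by rewrite mulrDl lerD2l; apply: ler_wpM2l.
  apply: ler_wpM2l; first exact: ltW.
  apply: ler_pM => //.
    apply: addr_ge0; first exact: mulr_ge0.
    apply: mulr_ge0; first exact: mulr_ge0.
    by apply: addr_ge0 => //; apply: mulr_ge0 => //; exact: ltW.
  apply: lerD; first exact: ler_wpM2r.
  by apply: ler_wpM2l; [exact: mulr_ge0|rewrite lerD2l ler_piMr].
have rr : (rho + 1) ^+ 2 <= (rho + 2) ^+ 2.
  by rewrite lerXn2r ?nnegrE ?addr_ge0 ?(ltW rho0)// lerD2l ler1n.
have HEs y : nsq (y - p) <= (rho + 1) ^+ 2 ->
   `|heat f s y - heat f (s - h ^+ 2) y - \sum_(i < n) (heat f s (y + h *: evec R i) + heat f s (y - h *: evec R i) - 2 * heat f s y)| <= CE * h ^+ 3.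
  move=> yb; apply: HE => //; first by apply: le_trans hsq _; lra.
  exact: le_trans yb rr.
have := energy_step e0 cpsi (scont_heat cf fb b0 sp) (scont_heat cf fb b0 sp') psi_supp aQ HEs HQ.
move=> /le_trans; apply.
have n1 : int_Rn (fun y => psi y ^+ 2 * `|thr e (heat f s y)|) <= Psi ^+ 2 * G * int_Rn theta.
  rewrite -int_RnZ//; apply: le_int_Rn; [|exact: admZ|].
    apply: eq_adm (adm_mulf cpsi psi_supp (F := fun y => psi y * `|g y|) _); first by move=> y; rewrite /g; ring.
    by apply: scontM => //; exact: scont_norm.
  move=> y; have [yb|yb] := leP (nsq (y - p)) ((rho + 2) ^+ 2); last first.
    rewrite psi_supp; last exact: le_lt_trans rr yb.
    by rewrite expr0n mul0r; apply: mulr_ge0; [apply: mulr_ge0 => //; exact: sqr_ge0|exact: cutoff_ge0].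
  rewrite /theta cutoff_1// mulr1; apply: ler_pM => //; [exact: sqr_ge0| |exact: gG].
  by rewrite lerXn2r ?nnegrE// (le_trans _ (psi_le y))// lerDl.
have iQ : int_Rn Q = h ^+ 2 * (lam ^+ 2 * (1 + del) * energy s + (lam ^+ 2 * (1 + del^-1) * G ^+ 2 + C3 * h) * int_Rn theta).
  by rewrite /Q int_RnZ ?int_RnD ?int_RnZ//; [exact: admZ|exact: admZ|apply: admD; exact: admZ].
have h30 : 0 <= CE * h ^+ 3 by apply: mulr_ge0 => //; apply: exprn_ge0; exact: ltW.
have n2 := ler_wpM2l h30 n1.
rewrite iQ /a /bb.
rewrite (_ : h ^+ 2 * (_ + _ + _) = 2 * (h ^+ 2 * (lam ^+ 2 * (1 + del) * energy s + (lam ^+ 2 * (1 + del^-1) * G ^+ 2 + C3 * h) * int_Rn theta)) + 2 * (CE * h ^+ 3 * (Psi ^+ 2 * G * int_Rn theta))); last by ring.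
by rewrite lerD2l; apply: ler_wpM2l.
Qed.

Lemma heat_energy k : 0 < k ->
  energy s1 <= 2 * (energy s0 + bb / a + k) * expR (a * (s1 - s0)).
Proof.
move=> k0; have [C [h1 [C0 h10 H]]] := heat_energy_step.
have dl0 : 0 < 1 + del^-1 by rewrite addr_gt0// invr_gt0.
apply: (gronwall_discrete (C := C) (h1 := h1)) => //.
- by rewrite /a !mulr_gt0// ?exprn_gt0// addr_gt0.
- rewrite /bb; apply: mulr_ge0; last by apply: int_Rn_ge0 => y; exact: cutoff_ge0.
  apply: mulr_ge0; last exact: sqr_ge0.
  apply: mulr_ge0; last exact: ltW.
  by apply: mulr_ge0 => //; exact: sqr_ge0.
- by move=> s; apply: int_Rn_ge0 => y; apply: mulr_ge0; exact: sqr_ge0.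
Qed.

End HeatEnergy.

(** * Chains and the intrinsic distance *)

Section Chains.
Variables (R : realType) (n : nat).
Local Notation V := 'rV[R]_n.

(** The real index is the length. [chain0] asks nothing of [p] itself. *)
Inductive chain (A : V -> Prop) (p : V) : R -> V -> Prop :=
| chain0 : chain A p 0 p
| chainS l x y : chain A p l x -> (forall t : R, 0 <= t -> t <= 1 -> A (x + t *: (y - x))) ->
    chain A p (l + en (y - x)) y.

Lemma chain_sub (A B : V -> Prop) p l x : (forall y, A y -> B y) -> chain A p l x -> chain B p l x.
Proof.
move=> AB; elim => [|l' x' y _ IH H]; first exact: chain0.
by apply: chainS => // t t0 t1; apply: AB; exact: H.
Qed.

Lemma chain_en (A : V -> Prop) p l x : chain A p l x -> en (x - p) <= l.
Proof.
elim => [|l' x' y _ IH _]; first by rewrite subrr en0.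
by apply: le_trans (en_split y x' p) _; rewrite addrC; apply: lerD.
Qed.

Lemma chain_ge0 (A : V -> Prop) p l x : chain A p l x -> 0 <= l.
Proof. by move=> /chain_en; apply: le_trans; exact: en_ge0. Qed.

Variable N : set V.

(* Truncated at 1, so that it makes sense for empty [N]. *)
Definition dN (x : V) : R := inf ([set 1] `|` [set en (x - z) | z in N]).

Let dN_has x : has_inf ([set 1] `|` [set en (x - z) | z in N]).
Proof.
split; first by exists 1; left.
by exists 0 => _ [->|[z _ <-]]; [exact: ler01|exact: en_ge0].
Qed.

Lemma dN_le x z : N z -> dN x <= en (x - z).
Proof. by move=> Nz; apply: ge_inf; [exact: (dN_has x).2|right; exists z]. Qed.

Lemma dN_lip x y : dN y <= dN x + en (y - x).
Proof.
rewrite -lerBlDr; apply: lb_le_inf; first exact: (dN_has x).1.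
move=> _ [->|[z Nz <-]]; rewrite lerBlDr.
  apply: (@le_trans _ _ 1); last by rewrite lerDl en_ge0.
  by apply: ge_inf; [exact: (dN_has y).2|left].
by apply: le_trans (dN_le y Nz) _; rewrite [leRHS]addrC; exact: en_split.
Qed.

Lemma dN_lt x c : c <= 1 -> dN x < c -> exists2 z, N z & en (x - z) < c.
Proof.
move=> c1 /(inf_lt (dN_has x).1) [_ [->|[z Nz <-]] h]; last by exists z.
by move: (lt_le_trans h c1); rewrite ltxx.
Qed.

Lemma dN_ge x c : c <= 1 -> (forall z, N z -> c <= en (x - z)) -> c <= dN x.
Proof.
by move=> c1 H; apply: lb_le_inf; [exact: (dN_has x).1|move=> _ [->|[z Nz <-]]//; exact: H].
Qed.

Lemma dN_notin x : 0 < dN x -> ~ N x.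
Proof. by move=> d0 Nx; have := dN_le x Nx; rewrite subrr en0; lra. Qed.

Lemma dN_seg x y (t c : R) : 0 <= t -> t <= 1 -> c + en (y - x) <= dN x -> c <= dN (x + t *: (y - x)).
Proof.
move=> t0 t1 h; have := dN_lip (x + t *: (y - x)) x.
rewrite opprD addrA subrr sub0r enN enZ ger0_norm//.
have : t * en (y - x) <= en (y - x) by rewrite ler_piMl// en_ge0.
lra.
Qed.

Variables (p : V) (rho c : R).
Hypotheses (rho0 : 0 < rho) (c0 : 0 < c) (c1 : c <= 1).

Let A x := c <= dN x.

(* [rho] minus the intrinsic distance to [p], cut off at 0. *)
Definition slack (x : V) : R := sup ([set 0] `|` [set rho - l | l in chain A p ^~ x]).

Let slack_has x : has_sup ([set 0] `|` [set rho - l | l in chain A p ^~ x]).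
Proof.
split; first by exists 0; left.
exists rho => _ [->|[l /chain_ge0 l0 <-]]; first exact: ltW.
by rewrite gerBl.
Qed.

Lemma slack_ge0 x : 0 <= slack x.
Proof. by apply: ub_le_sup; [exact: (slack_has x).2|left]. Qed.

Lemma slack_le x : slack x <= rho.
Proof.
apply: ge_sup; first exact: (slack_has x).1.
by move=> _ [->|[l /chain_ge0 l0 <-]]; [exact: ltW|rewrite gerBl].
Qed.

Lemma slack_ge x l : chain A p l x -> rho - l <= slack x.
Proof. by move=> h; apply: ub_le_sup; [exact: (slack_has x).2|right; exists l]. Qed.

Lemma slack_pos x : 0 < slack x -> exists2 l, l < rho & chain A p l x.
Proof.
by move=> /(sup_gt (slack_has x).1) [_ [->|[l h <-]]]; rewrite ?ltxx// subr_gt0; exists l.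
Qed.

(** A chain to x is prolonged by the segment from x to y, which keeps distance at least c from
    [N]. *)
Lemma slack_lip x y : c + en (y - x) <= dN x -> slack x <= slack y + en (y - x).
Proof.
move=> h; apply: ge_sup; first exact: (slack_has x).1.
move=> _ [->|[l hl <-]]; first by rewrite addr_ge0 ?slack_ge0 ?en_ge0.
rewrite -lerBlDr -addrA -opprD; apply: slack_ge; apply: chainS hl _.
by move=> t t0 t1; exact: dN_seg.
Qed.

Lemma slack_lip2 x y : c + 2 * en (y - x) <= dN x -> `|slack y - slack x| <= en (y - x).
Proof.
move=> h; have e0 := en_ge0 (y - x); have exy : en (x - y) = en (y - x) by exact: enC.
have h1 : c + en (y - x) <= dN x by lra.
have := dN_lip y x; rewrite exy => h2.
have h3 : c + en (x - y) <= dN y by rewrite exy; lra.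
have := slack_lip h1; have := slack_lip h3; rewrite exy ler_norml => ? ?; lra.
Qed.

Lemma slack_near x : c + en (x - p) <= dN p -> rho - en (x - p) <= slack x.
Proof.
move=> h; rewrite -[en _]add0r; apply: slack_ge; apply: chainS; first exact: chain0.
by move=> t t0 t1; exact: dN_seg.
Qed.

Lemma slack_far x : rho <= en (x - p) -> slack x = 0.
Proof.
move=> h; apply/eqP; rewrite eq_le slack_ge0 andbT leNgt; apply/negP.
by move=> /slack_pos [l lr /chain_en hl]; have := le_lt_trans (le_trans h hl) lr; rewrite ltxx.
Qed.

(** [slack] is controlled only where [dN] exceeds c. The factor vanishes up to 3c/2 and is 1 from 2c
    on, which makes the product continuous everywhere without changing it on the region that
    matters. *)
Let clamp (a : R) := Num.min 1 (Num.max 0 (2 / c * (a - 3 / 2 * c))).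
Let cslack x := slack x * clamp (dN x).

Let clamp0 a : a <= 3 / 2 * c -> clamp a = 0.
Proof.
move=> h; rewrite /clamp max_l ?min_r//; rewrite pmulr_rle0 ?subr_le0//.
by rewrite divr_gt0.
Qed.

Let clamp1 a : 2 * c <= a -> clamp a = 1.
Proof.
move=> h; rewrite /clamp min_l// le_max; apply/orP; right.
rewrite mulrAC ler_pdivlMr//; lra.
Qed.

Let clamp_ge0 a : 0 <= clamp a.
Proof. by rewrite /clamp le_min ler01 le_max lexx. Qed.

Let clamp_le1 a : clamp a <= 1.
Proof. by rewrite /clamp ge_min lexx. Qed.

Let scont_dN : scont dN.
Proof.
apply: scont_of_en => x e e0; exists e => // y h.
have := dN_lip x y; have := dN_lip y x; rewrite (enC x) ler_norml => ? ?; lra.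
Qed.

Let scont_clamp : scont (fun x => clamp (dN x)).
Proof.
apply: scont_min; first exact: scont_cst.
apply: scont_max; first exact: scont_cst.
apply: scontM; first exact: scont_cst.
by apply: scontB => //; exact: scont_cst.
Qed.

Let scont_cslack : scont cslack.
Proof.
move=> u x ux; have [hx|hx] := ltP (dN x) (3 / 2 * c).
  rewrite /cslack (clamp0 (ltW hx)) mulr0; apply: cvg_near_cst.
  have := scont_dN ux; move=> /cvgrPdist_lt/(_ (3 / 2 * c - dN x)).
  rewrite subr_gt0 => /(_ hx); apply: filterS => j /=.
  rewrite distrC => h; rewrite clamp0 ?mulr0// ltW//.
  by have := le_lt_trans (ler_norm _) h; lra.
apply: cvgM; last exact: (scont_clamp ux).
apply/cvgrPdist_le => e e0.
have : en (u j - x) @[j --> \oo] --> en (x - x) by exact: (@scont_en R n x u x ux).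
rewrite subrr en0 => /cvgrPdist_lt/(_ (Num.min e (c / 4))).
rewrite lt_min e0 divr_gt0// => /(_ isT); apply: filterS => j.
rewrite sub0r normrN ger0_norm ?en_ge0// lt_min => /andP[h1 h2].
rewrite distrC; apply: le_trans (ltW h1); apply: slack_lip2; lra.
Qed.

Let cslack_ge0 x : 0 <= cslack x.
Proof. by apply: mulr_ge0; [exact: slack_ge0|exact: clamp_ge0]. Qed.

Let cslack_le x : cslack x <= rho.
Proof.
by apply: le_trans (slack_le x); rewrite ler_piMr ?slack_ge0 ?clamp_le1.
Qed.

Let cslack_eq x : 2 * c <= dN x -> cslack x = slack x.
Proof. by move=> h; rewrite /cslack clamp1// mulr1. Qed.

(** A 1-Lipschitz function alone would give only n h^2 for the sum over the coordinate directions.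
    Mollification at scale at most c/4 supplies a gradient: where dN >= 3c it averages only points
    with dN >= 2c, so the gradient has norm at most 1, and the sum is h^2 |grad D|^2 + O(h^3). *)
Lemma smooth_slack eta : 0 < eta -> exists D : V -> R, [/\ scont D,
  forall y, 0 <= D y <= rho,
  forall y, (rho + 1) ^+ 2 < nsq (y - p) -> D y = 0,
  exists Cd h0, [/\ 0 <= Cd, 0 < h0 & forall h y, 0 < h -> h <= h0 -> 3 * c <= dN y ->
    \sum_(i < n) (D y - D (y + h *: evec R i)) ^+ 2 <= h ^+ 2 * (1 + Cd * h)] &
  forall y, 3 * c <= dN y -> `|D y - slack y| <= eta].
Proof.
move=> eta0; pose r := Num.min eta (c / 4).
have r0 : 0 < r by rewrite lt_min eta0 divr_gt0.
have rc : r <= c / 4 by rewrite ge_min lexx orbT.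
have re : r <= eta by rewrite ge_min lexx.
have rr0 : 0 < r ^+ 2 by exact: exprn_gt0.
pose D := moll (r ^+ 2) cslack.
have near y a q : (forall z, en z < r -> `|cslack (z + y) - a| <= q) -> `|D y - a| <= q.
  by move=> H; apply: moll_near => // z hz; apply: H; rewrite en_lt_nsq.
have cM y : `|cslack y| <= rho by rewrite ger0_norm.
have [C C0 [HC _]] := moll_C1 rr0 scont_cslack cM.
have Dlip y v : 3 * c <= dN y -> en v <= c / 8 -> `|D (y + v) - D y| <= en v.
  move=> hy hv; apply: moll_diff => // z; rewrite -en_lt_nsq// => hz.
  have ev0 := en_ge0 v.
  have h1 : dN y <= dN (z + y) + en z.
    by have := dN_lip (z + y) y; rewrite opprD addrCA subrr addr0 enN.
  have h2 : dN (z + y) <= dN (z + (y + v)) + en v.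
    by have := dN_lip (z + (y + v)) (z + y); rewrite addrA opprD addrA subrr sub0r enN.
  rewrite !cslack_eq; [|lra|lra].
  have e1 : z + (y + v) - (z + y) = v by rewrite addrA (addrC (z + y)) addrK.
  by rewrite -{2}e1; apply: slack_lip2; rewrite e1; lra.
exists D; split.
- exact: (scont_moll rr0 scont_cslack cM).
- move=> y; have : `|D y - rho / 2| <= rho / 2.
    apply: near => z _; have := cslack_ge0 (z + y); have := cslack_le (z + y).
    by rewrite ler_norml => ? ?; lra.
  by rewrite ler_norml => ?; lra.
- move=> y; rewrite -en_sq => h; apply/eqP; rewrite -normr_le0 -[D y]subr0; apply: near => z hz.
  have r1 : 0 <= rho + 1 by rewrite addr_ge0// ltW.
  move: h; rewrite ltr_pXn2r ?nnegrE ?en_ge0// => h.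
  rewrite subr0 /cslack slack_far ?mul0r ?normr0//.
  have := en_split (y - p) (- z) 0; rewrite !subr0 opprK enN.
  rewrite (_ : y - p + z = z + y - p); last by rewrite addrC addrA.
  by have := c1 => ? ?; lra.
- have gle y : 3 * c <= dN y -> nsq (mgrad (r ^+ 2) cslack y) <= 1.
    move=> hy; set g := mgrad _ _ _.
    have g0 := en_ge0 g; rewrite -en_sq expr_le1//; apply/ler_addgt0Pr => k k0.
    have [->|gn0] := eqVneq (en g) 0; first lra.
    have gp : 0 < en g by rewrite lt_neqAle eq_sym gn0.
    (* The Lipschitz bound is tested along the gradient itself. The three bounds on t keep the step
       within c/8 and within 1, and the Taylor error C t |g| below k. *)
    pose t := Num.min (Num.min (c / 8 / en g) (1 / en g)) (k / (C * en g)).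
    have t0 : 0 < t by rewrite !lt_min !divr_gt0// mulr_gt0.
    have et : en (t *: g) = t * en g by rewrite enZ gtr0_norm.
    have t1 : t * en g <= c / 8 by rewrite -ler_pdivlMr// ge_min ge_min lexx.
    have t2 : t * en g <= 1 by rewrite -ler_pdivlMr// ge_min ge_min lexx orbT.
    have t3 : t * (C * en g) <= k by rewrite -ler_pdivlMr ?mulr_gt0// ge_min lexx orbT.
    have := HC y (t *: g); rewrite et => /(_ t2); rewrite dotZr -/g -/(nsq g) nsqZ -en_sq => h1.
    have := Dlip y (t *: g) hy; rewrite et => /(_ t1) h2.
    have h3 : t * en g ^+ 2 <= t * en g + C * (t ^+ 2 * en g ^+ 2).
      move: h1 h2; rewrite -/D !ler_norml => /andP[h1 _] /andP[_ h2]; lra.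
    rewrite -(ler_pM2l t0) -(ler_pM2r gp).
    have h4 : t * en g * (t * (C * en g)) <= t * en g * k.
      by apply: ler_wpM2l => //; apply: mulr_ge0 => //; exact: ltW.
    lra.
  exists (n%:R * (2 * C + C ^+ 2)), (Num.min 1 (c / 8)).
  split; first by rewrite mulr_ge0// addr_ge0 ?sqr_ge0// mulr_ge0// ltW.
    by rewrite lt_min ltr01 divr_gt0.
  move=> h y hp; rewrite le_min => /andP[h1 h2] hy.
  set g := mgrad (r ^+ 2) cslack y.
  have gi i : `|g ord0 i| <= 1.
    have := le_trans (nsq_coord g i) (gle y hy).
    by rewrite -real_normK ?num_real// expr_le1.
  have step i : (D y - D (y + h *: evec R i)) ^+ 2 <= h ^+ 2 * (g ord0 i) ^+ 2 + h ^+ 3 * (2 * C + C ^+ 2).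
    have eh : nsq (h *: evec R i : V) = h ^+ 2 by rewrite nsqZ nsq_evec mulr1.
    have eh1 : en (h *: evec R i : V) <= 1 by rewrite en_le_nsq// eh expr1n expr_le1// ltW.
    have := HC y (h *: evec R i) eh1; rewrite -/D -/g eh dotZr dot_evec.
    set d := D (y + _) - D y; move=> hd.
    rewrite -(sqrrN (D y - _)) opprB -/d.
    have -> : d = h * g ord0 i + (d - h * g ord0 i) by ring.
    set q := d - _ in hd *; rewrite sqrrD exprMn -addrA lerD2l.
    have gq : `|h * g ord0 i| <= h by rewrite normrM gtr0_norm// ler_piMr// ltW.
    have b1 : h * g ord0 i * q <= h * (C * h ^+ 2).
      apply: le_trans (ler_norm _) _; rewrite normrM; exact: ler_pM.
    have Ch : 0 <= C * h ^+ 2 by rewrite mulr_ge0 ?sqr_ge0// ltW.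
    have b2 : q ^+ 2 <= (C * h ^+ 2) ^+ 2.
      by rewrite -real_normK ?num_real// lerXn2r ?nnegrE.
    have b3 : h ^+ 4 * C ^+ 2 <= h ^+ 3 * C ^+ 2.
      apply: ler_wpM2r; first exact: sqr_ge0.
      by rewrite exprS ler_piMl// exprn_ge0// ltW.
    have e4 : (C * h ^+ 2) ^+ 2 = h ^+ 4 * C ^+ 2 by ring.
    have e5 : h * (C * h ^+ 2) = h ^+ 3 * C by ring.
    rewrite mulr2n; lra.
  apply: le_trans (ler_sum _ (fun i _ => step i)) _.
  rewrite big_split/= -mulr_sumr sumr_const card_ord -nsq_sum -[_ *+ n]mulr_natr.
  have := ler_wpM2l (sqr_ge0 h) (gle y hy); rewrite mulr1 => ?.
  have e3 : h ^+ 2 * (1 + n%:R * (2 * C + C ^+ 2) * h) = h ^+ 2 + h ^+ 3 * (2 * C + C ^+ 2) * n%:R by ring.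
  by rewrite e3 lerD2r.
- move=> y hy; apply: near => z hz.
  have := dN_lip (z + y) y; rewrite opprD addrCA subrr addr0 enN => h.
  rewrite cslack_eq; last lra.
  have e1 : z + y - y = z by rewrite addrK.
  apply: (@le_trans _ _ (en z)); last lra.
  by rewrite -{2}e1; apply: slack_lip2; rewrite e1; lra.
Qed.

End Chains.

(** * Decay of the heat evolution near [p] *)

Section HeatDecay.
Variables (R : realType) (n : nat).
Local Notation V := 'rV[R]_n.

(** The power s^(-n/2) is absorbed by the gap r2 - r1, through - ln s <= a / s - 1 - ln a. Using
    [n.+1] in [a] avoids a division by zero when n = 0. *)
Lemma hk_decay (r1 r2 : R) : r1 < r2 -> exists2 C, 0 < C &
  forall s, 0 < s -> hk n s r2 <= C * expR (- (r1 / (4 * s))).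
Proof.
move=> r12; pose a := (r2 - r1) / (2 * n.+1%:R).
have n0 : 0 < n.+1%:R :> R by rewrite ltr0n.
have a0 : 0 < a by rewrite divr_gt0 ?subr_gt0// mulr_gt0.
exists (expR (- (n%:R / 2 * (1 + ln a)))); first exact: expR_gt0.
move=> s s0; rewrite /hk -expRD ler_expR.
have h : - ln s <= a / s - 1 - ln a.
  have as0 : -1 < a / s - 1 by rewrite ltrBrDr addNr divr_gt0.
  have := le_ln1Dx as0; rewrite addrC subrK.
  by rewrite lnM ?posrE ?invr_gt0// lnV ?posrE// => ?; lra.
have n2 : 0 <= n%:R / 2 :> R by rewrite divr_ge0.
have h2 := ler_wpM2l n2 h.
have h3 : n%:R / 2 * (a / s) <= (r2 - r1) / (4 * s).
  rewrite (_ : n%:R / 2 * (a / s) = (r2 - r1) / (4 * s) * (n%:R / n.+1%:R)); last first.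
    by rewrite /a; field; rewrite !gt_eqF.
  rewrite ler_piMr//; last by rewrite ler_pdivrMr// mul1r ler_nat.
  by rewrite divr_ge0 ?subr_ge0 ?ltW// mulr_gt0.
rewrite mulrBl in h3; lra.
Qed.

Lemma hk_mono (s a b : R) : 0 < s -> a <= b -> hk n s b <= hk n s a.
Proof.
move=> s0 ab; rewrite /hk ler_expR lerD2l lerN2 ler_pM2r// invr_gt0 mulr_gt0//.
Qed.

(** The excess of the kernel over its value at squared distance [B] is a continuous radial profile
    supported in that ball, so it integrates to 0; what remains of the kernel is at most
    [hk n s B]. *)
Lemma heat_on_zero_balls (f1 f : V -> R) (L : R) (p x : V) (s B : R) : scont f1 ->
  (forall y, L < nsq (y - p) -> f1 y = 0) -> 0 < s -> 0 < B ->
  (forall y, nsq (y - x) < B -> f1 y = f y) -> (forall b, 0 < b -> ballint f x b = 0) ->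
  `|heat f1 s x| <= hk n s B * int_Rn (fun y => `|f1 y|).
Proof.
move=> c1 f1L s0 B0 ff1 Hb.
pose k a := Num.max 0 (hk n s a - hk n s B).
have kc : continuous k.
  move=> a; have cm (g : R -> R) : {for a, continuous g} -> {for a, continuous (fun x => Num.max 0 (g x))}.
    by move=> cg; apply: continuous_max => //; exact: cst_continuous.
  by apply: cm; apply: cvgB; [exact: hk_cont|exact: cvg_cst].
have k0 a : B <= a -> k a = 0.
  by move=> h; rewrite /k max_l// subr_le0 hk_mono.
have z : int_Rn (fun y => f1 y * k (nsq (y - x))) = 0.
  apply: (radial_kernel0 B0 c1 kc k0) => b b0 bB; rewrite -[RHS](Hb b b0).
  apply: eq_int_Rn => y; rewrite /ballfun; case: ltP => // h.
  by rewrite ff1// (lt_le_trans h bB).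
have sk : scont (fun y : V => k (nsq (y - x))).
  by apply: (scont_comp (f := k)) => //; exact: scont_nsq.
rewrite -[heat _ _ _]subr0 -[X in _ - X]z /heat -int_RnB; [|exact: (adm_heat c1 f1L)|exact: (adm_mulf c1 f1L)].
rewrite (eq_int_Rn (G := fun y => f1 y * (hk n s (nsq (y - x)) - k (nsq (y - x))))); last first.
  by move=> y; rewrite mulrBr.
apply: (int_mulf_bound c1 f1L); first by apply: scontB => //; exact: scont_hk.
move=> y _; have e1 := expR_ge0 (- (n%:R / 2 * ln s) - nsq (y - x) / (4 * s)).
have e2 := expR_ge0 (- (n%:R / 2 * ln s) - B / (4 * s)).
rewrite /k -/(hk n s _) -/(hk n s B) in e1 e2 *; rewrite ler_norml.
have [h|h] := leP (hk n s (nsq (y - x)) - hk n s B) 0; lra.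
Qed.

Variables (f : V -> R) (N : set V) (p : V) (rho : R).
Hypotheses (cf : scont f) (HN : forall x, N x -> forall b, 0 < b -> ballint f x b = 0).
Hypotheses (rho0 : 0 < rho) (dNp : 0 < dN N p).
Hypothesis Hch : forall l x, chain (fun y => ~ N y) p l x -> l < rho -> f x = 0.

(** The centres used lie within rho + 3 of [p], and their balls of radius rho must not feel the
    truncation. *)
Let L := (2 * rho + 4) ^+ 2.
Let f1 := trunc f p L.
Let bump (r0 : R) (y : V) := cutoff 1 (nsq (y - p) / r0 ^+ 2).

Lemma scont_bump r0 : scont (bump r0).
Proof.
apply: scont_cutoff; apply: scontM; first exact: scont_nsq.
exact: scont_cst.
Qed.

Lemma heat_decay rho' : 0 < rho' -> rho' < rho -> exists r0 C, [/\ 0 < r0, 0 <= C &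
  forall s1, 0 < s1 -> s1 <= 1 ->
    int_Rn (fun y => bump r0 y * `|heat f1 s1 y|) <= C * expR (- (rho' ^+ 2 / (4 * s1)))].
Proof.
move=> r'0 r'r; have rp := rho0.
have aux (r c d : R) : 0 < r -> c < r -> d <= r + 3 -> c + d <= 2 * r + 4 by lra.
have c1 : scont f1 by exact: scont_trunc.
have [M M0 f1M] := trunc_bounded p L cf.
have f1L y : L + 1 < nsq (y - p) -> f1 y = 0 by move=> h; apply: trunc_eq0; exact: ltW.
have L0 : 0 <= L by exact: sqr_ge0.
have L10 : 0 <= L + 1 by exact: addr_ge0.
(* The radius rho loses [r1] three times: to the cut [eta], to the mollification of [slack] and to
   the extent of the bump. The rest, [rho3], still exceeds rho'. The bound by [dN N p / 4] keeps the
   bump away from [N]. *)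
pose r1 := Num.min ((rho - rho') / 6) (dN N p / 4).
have r10 : 0 < r1 by rewrite lt_min !divr_gt0// subr_gt0.
have r1a : r1 <= (rho - rho') / 6 by rewrite ge_min lexx.
have r1b : r1 <= dN N p / 4 by rewrite ge_min lexx orbT.
pose rho3 := rho - 3 * r1.
have r3 : rho' < rho3 by rewrite /rho3; lra.
have r30 : 0 < rho3 := lt_trans r'0 r3.
pose del := (rho3 / rho') ^+ 2 - 1.
have del0 : 0 < del.
  rewrite subr_gt0 -[1](expr1n _ 2) ltr_pXn2r ?nnegrE ?divr_ge0 ?(ltW r'0) ?(ltW r30)//.
  by rewrite ltr_pdivlMr// mul1r.
have del1 : 1 + del = (rho3 / rho') ^+ 2 by rewrite /del addrC subrK.
have rsq : rho' ^+ 2 < rho ^+ 2 by rewrite ltr_pXn2r ?nnegrE ?ltW.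
have [C1 C10 HC1] := hk_decay rsq.
pose I1 := int_Rn (fun y => `|f1 y|).
have I10 : 0 <= I1 by apply: int_Rn_ge0.
pose theta y := cutoff ((rho + 2) ^+ 2) (nsq (y - p)).
pose Th := int_Rn theta.
have Th0 : 0 <= Th by apply: int_Rn_ge0 => y; exact: cutoff_ge0.
pose G := M * hmass R n.
have G0 : 0 <= G by apply: mulr_ge0; [exact: ltW|exact: hmass_ge0].
pose C2 := 2 * (Th + G ^+ 2 * Th / del + 1).
have C20 : 0 <= C2.
  apply: mulr_ge0 => //; apply: addr_ge0 => //; apply: addr_ge0 => //.
  by apply: divr_ge0; [apply: mulr_ge0 => //; exact: sqr_ge0|exact: ltW].
have aTh : adm theta.
  apply: (csupp_adm (x := p) (b := (rho + 2) ^+ 2 + 1)); first by apply: scont_cutoff; exact: scont_nsq.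
  by move=> y h; rewrite /theta cutoff_0// ltW.
have ab (X : V -> R) : scont X -> adm (fun y => bump (r1 / 2) y * X y).
  move=> cX; apply: (@adm_mulf _ _ _ (2 * (r1 / 2) ^+ 2) p) => //; first exact: scont_bump.
  move=> y h; rewrite /bump cutoff_0// ler_pdivlMr; last by rewrite exprn_gt0// divr_gt0.
  by apply: ltW; rewrite (_ : 1 + 1 = 2 :> R)//; lra.
have bsup y : bump (r1 / 2) y != 0 -> en (y - p) <= r1.
  move=> /eqP h; rewrite leNgt; apply/negP => h1; apply: h; rewrite /bump cutoff_0//.
  rewrite ler_pdivlMr; last by rewrite exprn_gt0// divr_gt0.
  have : r1 ^+ 2 < nsq (y - p) by rewrite ltNge -en_le_nsq ?(ltW r10)// -ltNge.
  have := sqr_ge0 r1; rewrite exprMn; lra.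
pose Bp := int_Rn (bump (r1 / 2)).
have aB : adm (bump (r1 / 2)).
  by apply: eq_adm (ab (fun=> 1) _); [move=> y; rewrite mulr1|exact: scont_cst].
have bge y : 0 <= bump (r1 / 2) y by exact: cutoff_ge0.
have ble y : bump (r1 / 2) y <= 1 by exact: cutoff_le1.
have Bp0 : 0 <= Bp by apply: int_Rn_ge0.
have dc (s : R) : 0 < s -> (rho3 ^+ 2 / ((1 + del) * s)) = rho' ^+ 2 / s.
  by move=> s_; rewrite del1; field; rewrite !gt_eqF.
pose C3 := 2 * C2 + 2 * (G ^+ 2 * Bp).
have C30 : 0 <= C3.
  apply: addr_ge0; apply: mulr_ge0 => //; apply: mulr_ge0 => //; exact: sqr_ge0.
exists (r1 / 2), (C3 + Bp + 2 * C1 * (I1 + 1) * Bp); split.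
- exact: divr_gt0.
- by apply: addr_ge0; [exact: addr_ge0|apply: mulr_ge0 => //; apply: mulr_ge0; [apply: mulr_ge0 => //; exact: ltW|exact: addr_ge0]].
move=> s1 s10 s11.
pose ex := expR (- (rho' ^+ 2 / (4 * s1))).
have ex0 : 0 < ex by exact: expR_gt0.
pose e := 2 * (C1 * (I1 + 1)) * ex.
have CI0 : 0 < C1 * (I1 + 1) by apply: mulr_gt0 => //; exact: ltr_wpDl.
have e0 : 0 < e by apply: mulr_gt0 => //; exact: mulr_gt0.
(* The minimizer of 2 lam^2 (1 + del) s1 - 2 lam rho3. As 1 + del = (rho3 / rho')^2, the minimum is
   -2 rho'^2 / (4 s1), so the energy near p will be O([ex ^+ 2]). *)
pose lam := rho3 / (2 * (1 + del) * s1).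
have del10 : 0 < 1 + del by rewrite addr_gt0.
have lam0 : 0 < lam by rewrite divr_gt0// !mulr_gt0.
(* The initial time is chosen after lam: at zeros of [f1] the evolution is then below the reciprocal
   of the largest weight, and the initial energy is bounded independently of [s1]. *)
have [s0' s0'0 Hs0] := heat_small c1 f1M f1L ((rho + 2) ^+ 2) (expR_gt0 (- (lam * rho))).
pose s0 := Num.min s0' (s1 / 2).
have s00 : 0 < s0 by rewrite lt_min s0'0 divr_gt0.
have s01 : s0 < s1 by rewrite gt_min ltr_pdivrMr// ltr_pMr// ltr1n orbT.
have rr0 : 0 <= (rho + 3) ^+ 2 by exact: sqr_ge0.
have [CL CL0 HL] := heat_lip c1 f1L s00 L10 rr0.
(* Within 3c of a point of [N] the evolution exceeds its value there by at most half the threshold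
   [e]. The dependence of c on [s1] is harmless, since no constant in the conclusion involves c. *)
pose c := Num.min (Num.min (1 / 3) (r1 / 3)) (C1 * (I1 + 1) * ex / (3 * (CL + 1))).
have CL1 : 0 < CL + 1 by rewrite ltr_wpDl.
have c0 : 0 < c by rewrite !lt_min !divr_gt0// mulr_gt0.
have c_1 : c <= 1 / 3 by rewrite ge_min ge_min lexx.
have c_2 : c <= r1 / 3 by rewrite ge_min ge_min lexx orbT.
have c_3 : 3 * (CL * c) <= C1 * (I1 + 1) * ex.
  have : c <= C1 * (I1 + 1) * ex / (3 * (CL + 1)) by rewrite ge_min lexx orbT.
  rewrite ler_pdivlMr ?mulr_gt0//; move: c0; clear; lra.
have c1' : c <= 1 by move: c_1; clear; lra.
have [D [cD Drho Dsupp [Cd [h0 [Cd0 h00 HD]]] Dslack]] := smooth_slack N p rho0 c0 c1' r10.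
have onN z s : N z -> en (z - p) <= rho + 3 -> 0 < s -> s <= s1 -> `|heat f1 s z| <= C1 * (I1 + 1) * ex.
  move=> Nz hz sp ss1.
  have B0 : 0 < rho ^+ 2 by exact: exprn_gt0.
  have ff y : nsq (y - z) < rho ^+ 2 -> f1 y = f y.
    rewrite -en_lt_nsq// => hy; apply: trunc_eq; rewrite -en_le_nsq.
      apply: le_trans (en_split y z p) _; exact: aux.
    by rewrite addr_ge0// mulr_ge0// ltW.
  have h := heat_on_zero_balls c1 f1L sp B0 ff (HN Nz).
  apply: le_trans h _; apply: (@le_trans _ _ (C1 * ex * I1)).
    apply: ler_wpM2r => //; apply: le_trans (HC1 s sp) _; apply: ler_wpM2l; first exact: ltW.
    rewrite ler_expR lerN2; apply: ler_wpM2l; first exact: sqr_ge0.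
    by rewrite lef_pV2 ?posrE ?mulr_gt0// ler_pM2l.
  by rewrite mulrAC; apply: ler_wpM2r; [exact: ltW|apply: ler_wpM2l; [exact: ltW|rewrite lerDl]].
have HG s y : s0 <= s -> s <= s1 -> nsq (y - p) <= (rho + 2) ^+ 2 -> ~ (3 * c <= dN N y) -> `|heat f1 s y| <= e.
  move=> s0s ss1 hy /negP; rewrite -ltNge => hd.
  have c31 : 3 * c <= 1 by move: c_1; clear; lra.
  have [z Nz hz] := dN_lt c31 hd.
  have yp : en (y - p) <= rho + 2 by rewrite en_le_nsq ?addr_ge0 ?(ltW rho0).
  have zp : en (z - p) <= rho + 3 by move: (en_split z y p) hz yp c31; rewrite (enC z y); clear; lra.
  have sp : 0 < s := lt_le_trans s00 s0s.
  have yz1 : en (y - z) <= 1 by move: hz c31; clear; lra.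
  have zL : nsq (z - p) <= (rho + 3) ^+ 2 by rewrite -en_le_nsq ?addr_ge0 ?(ltW rho0).
  have := HL s z (y - z) s0s yz1 zL; rewrite (addrC z) subrK => h1.
  - have h2 := onN z s Nz zp sp ss1.
    have h3 : CL * en (y - z) <= CL * (3 * c) by apply: ler_wpM2l => //; exact: ltW.
    rewrite -(subrK (heat f1 s z) (heat f1 s y)); apply: le_trans (ler_normD _ _) _.
    by move: h1 h2 h3 c_3; rewrite /e; clear; lra.
have HD' : exists Cd h0, [/\ 0 <= Cd, 0 < h0 & forall h y, 0 < h -> h <= h0 -> 3 * c <= dN N y ->
  nsq (y - p) <= (rho + 2) ^+ 2 ->
  \sum_(i < n) (D y - D (y + h *: evec R i)) ^+ 2 <= h ^+ 2 * (1 + Cd * h)].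
  by exists Cd, h0; split=> // h y hp hh hy _; exact: HD.
have := heat_energy c1 f1M f1L L10 rho0 (ltW e0) s00 s01 lam0 del0 (ltW r10) cD Drho Dsupp
   (Gd := fun y => 3 * c <= dN N y) HG HD' ltr01.
cbv beta; set E1 := int_Rn _; set E0 := int_Rn _; move=> HE.
have psi0 y : 0 <= psi_of lam r1 D y by rewrite /psi_of le_max lexx.
have psile y : psi_of lam r1 D y <= expR (lam * rho).
  rewrite /psi_of ge_max expR_ge0/= lerBlDr; apply: (@le_trans _ _ (expR (lam * rho))); last by rewrite lerDl.
  rewrite ler_expR; apply: ler_wpM2l; first exact: ltW.
  by have /andP[_ h2] := Drho y; rewrite (le_trans _ h2)// gerBl ltW.
have psic : scont (psi_of lam r1 D).
  apply: scont_max; first exact: scont_cst.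
  apply: scontB; last exact: scont_cst.
  apply: (scont_comp (f := expR)); first exact: continuous_expR.
  apply: scontM; first exact: scont_cst.
  by apply: scontB => //; exact: scont_cst.
have psis y : (rho + 1) ^+ 2 < nsq (y - p) -> psi_of lam r1 D y = 0.
  move=> /Dsupp h; rewrite /psi_of h max_l// subr_le0 -expR0 ler_expR sub0r mulrN oppr_le0.
  by rewrite mulr_ge0// ltW.
have cthr s : 0 < s -> scont (fun y => thr e (heat f1 s y)).
  by move=> s_; apply: (scont_comp (f := thr e)); [exact: thr_cont|exact: (scont_heat c1 f1L)].
have aE s : 0 < s -> adm (fun y => psi_of lam r1 D y ^+ 2 * thr e (heat f1 s y) ^+ 2).
  move=> s_; apply: eq_adm (adm_mulf psic psis (F := fun y => psi_of lam r1 D y * thr e (heat f1 s y) ^+ 2) _).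
    by move=> y; ring.
  by apply: scontM => //; apply: scontX; exact: cthr.
have r12 : (rho + 1) ^+ 2 <= (rho + 2) ^+ 2 by rewrite lerXn2r ?nnegrE ?addr_ge0 ?(ltW rho0)// lerD2l ler1n.
have E0le : E0 <= Th.
  apply: le_int_Rn => //; first exact: aE.
  move=> y; have [yb|yb] := leP (nsq (y - p)) ((rho + 1) ^+ 2); last first.
    by rewrite psis// expr0n mul0r; exact: cutoff_ge0.
  have yb2 := le_trans yb r12.
  rewrite /theta cutoff_1//.
  have [p0|pn0] := eqVneq (psi_of lam r1 D y) 0; first by rewrite p0 expr0n mul0r.
  have [g0|gn0] := eqVneq (thr e (heat f1 s0 y)) 0; first by rewrite g0 expr0n mulr0.
  (* A nonzero weighted value forces y to be far enough from [N] and its slack to be positive; so a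
     chain shorter than rho ends at y, and f vanishes there. *)
  have Gdy : 3 * c <= dN N y.
    apply: contrapT => nG; move/eqP: gn0; apply.
    by apply: thr_eq0; [exact: ltW|apply: HG => //; exact: ltW].
  have Dy : r1 < D y.
    rewrite ltNge; apply/negP => h; move/eqP: pn0; apply; rewrite /psi_of max_l// subr_le0 -expR0 ler_expR.
    by rewrite pmulr_rle0// subr_le0.
  have sl : 0 < slack N p rho c y by move: (Dslack y Gdy) Dy; rewrite ler_norml; clear; lra.
  have [l lr hc] := slack_pos rho0 sl.
  have fy : f1 y = 0.
    rewrite /f1 /trunc (Hch _ lr) ?mul0r//; apply: chain_sub hc => z hz.
    by apply: dN_notin; exact: lt_le_trans hz.
  have := Hs0 s0 y s00 _ yb2 fy; rewrite ge_min lexx => /(_ isT) hh.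
  have ht := le_trans (thr_le (heat f1 s0 y) (ltW e0)) hh.
  rewrite -exprMn -[leLHS]real_normK ?num_real// expr_le1// normrM (ger0_norm (psi0 y)).
  rewrite -[leRHS]expR0 -(addrN (lam * rho)) expRD; exact: ler_pM.
have E1le : E1 <= C2 * expR (2 * lam ^+ 2 * (1 + del) * s1).
  apply: le_trans HE _; apply: ler_pM.
  - have E00 : 0 <= E0 by apply: int_Rn_ge0 => y; apply: mulr_ge0; exact: sqr_ge0.
    apply: mulr_ge0 => //; apply: addr_ge0 => //; apply: addr_ge0 => //; apply: divr_ge0.
      apply: mulr_ge0 => //; apply: mulr_ge0; last exact: sqr_ge0.
      apply: mulr_ge0; first by apply: mulr_ge0 => //; exact: sqr_ge0.
      by rewrite addr_ge0// invr_ge0 ltW.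
    by apply: mulr_ge0; [apply: mulr_ge0 => //; exact: sqr_ge0|exact: ltW].
  - exact: expR_ge0.
  - rewrite /C2; apply: ler_wpM2l => //; rewrite lerD2r; apply: lerD => //.
    rewrite le_eqVlt; apply/orP; left; apply/eqP; rewrite -/theta -/Th -/G.
    by field; rewrite !gt_eqF.
  - rewrite ler_expR; apply: ler_wpM2l; last by rewrite gerBl ltW.
    by apply: mulr_ge0; [apply: mulr_ge0 => //; exact: sqr_ge0|exact: ltW].
have low y : bump (r1 / 2) y != 0 -> expR (lam * rho3) <= psi_of lam r1 D y + 1.
  move=> /bsup hy.
  have Gdy : 3 * c <= dN N y by move: (dN_lip N y p) hy r1b c_2 r10; rewrite enC; clear; lra.
  have cd : c + en (y - p) <= dN N p by move: hy r1b c_2 r10; clear; lra.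
  have := slack_near rho0 cd; have := Dslack y Gdy; rewrite ler_norml => h1 h2.
  rewrite -lerBlDr /psi_of le_max; apply/orP; right; rewrite lerD2r ler_expR.
  by apply: ler_wpM2l; [exact: ltW|move: h1 h2 hy; rewrite /rho3; clear; lra].
pose J := int_Rn (fun y => bump (r1 / 2) y * thr e (heat f1 s1 y) ^+ 2).
have aJ : adm (fun y => bump (r1 / 2) y * thr e (heat f1 s1 y) ^+ 2).
  by apply: ab; apply: scontX; exact: cthr.
have Jle : expR (2 * lam * rho3) * J <= 2 * E1 + 2 * (G ^+ 2 * Bp).
  have -> : 2 * E1 + 2 * (G ^+ 2 * Bp) = int_Rn (fun y => 2 * (psi_of lam r1 D y ^+ 2 *
      thr e (heat f1 s1 y) ^+ 2) + 2 * (G ^+ 2 * bump (r1 / 2) y)).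
    rewrite int_RnD; [|by apply: admZ; exact: aE|by apply: admZ; exact: admZ].
    rewrite int_RnZ; last exact: aE.
    by rewrite int_RnZ; [rewrite int_RnZ|exact: admZ].
  rewrite -int_RnZ//.
  apply: le_int_Rn; [exact: admZ|apply: admD; [apply: admZ; exact: aE|by apply: admZ; exact: admZ]|].
  move=> y; set t := thr e (heat f1 s1 y); have t0 : 0 <= t ^+ 2 by exact: sqr_ge0.
  set ps := psi_of lam r1 D y; have ps0 : 0 <= ps ^+ 2 by exact: sqr_ge0.
  have [b0|bn0] := eqVneq (bump (r1 / 2) y) 0.
    rewrite b0 mul0r !mulr0 addr0; apply: mulr_ge0 => //; exact: mulr_ge0.
  have h1 : expR (2 * lam * rho3) <= 2 * ps ^+ 2 + 2.
    apply: (@le_trans _ _ ((ps + 1) ^+ 2)); last by move: (sqr_ge0 (ps - 1)); rewrite sqrrB1 sqrrD1; clear; lra.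
    rewrite -mulrA (expRM_natl 2); apply: lerXn2r; rewrite ?nnegrE ?expR_ge0//; last exact: low.
    by rewrite addr_ge0//; exact: psi0.
  have tG : t ^+ 2 <= G ^+ 2.
    rewrite -[leLHS]real_normK ?num_real//; apply: lerXn2r; rewrite ?nnegrE//.
    by apply: le_trans (thr_le _ (ltW e0)) _; exact: heat_bound c1 f1M f1L _ _ s10.
  apply: (@le_trans _ _ ((2 * ps ^+ 2 + 2) * (bump (r1 / 2) y * t ^+ 2))).
    by apply: ler_wpM2r => //; apply: mulr_ge0.
  rewrite mulrDl; apply: lerD.
    rewrite -mulrA; apply: ler_wpM2l => //; apply: ler_wpM2l => //; exact: ler_piMl.
  by apply: ler_wpM2l => //; rewrite mulrC; exact: ler_wpM2r.
have ex2 : expR (2 * lam ^+ 2 * (1 + del) * s1) * expR (- (2 * lam * rho3)) = ex ^+ 2.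
  rewrite -expRD /ex -expRM_natl; congr expR.
  have -> : 2%:R * - (rho' ^+ 2 / (4 * s1)) = - (rho3 ^+ 2 / ((1 + del) * s1)) / 2.
    by rewrite dc//; field; rewrite gt_eqF.
  by rewrite /lam; field; rewrite !gt_eqF.
have ll : 1 <= expR (2 * lam ^+ 2 * (1 + del) * s1).
  by rewrite -[leLHS]expR0 ler_expR; apply: mulr_ge0; [apply: mulr_ge0; [apply: mulr_ge0 => //; exact: sqr_ge0|exact: ltW]|exact: ltW].
have JJ : J <= C3 * ex ^+ 2.
  rewrite -ex2 mulrA; rewrite expRN ler_pdivlMr ?expR_gt0// mulrC.
  apply: le_trans Jle _; rewrite /C3 [leRHS]mulrDl; apply: lerD.
    by rewrite -mulrA; apply: ler_wpM2l.
  by rewrite ler_peMr//; apply: mulr_ge0 => //; apply: mulr_ge0 => //; exact: sqr_ge0.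
have ae : adm (fun y => bump (r1 / 2) y * `|heat f1 s1 y|).
  by apply: ab; apply: scont_norm; exact: (scont_heat c1 f1L).
(* The energy bound becomes an L^1 bound through |u| <= |thr u| + e and |q| <= q^2 / ex + ex. *)
apply: (@le_trans _ _ (ex^-1 * J + (ex + e) * Bp)).
  rewrite -!int_RnZ//; rewrite -int_RnD; [|exact: admZ|exact: admZ].
  apply: le_int_Rn => //; first by apply: admD; exact: admZ.
  move=> y; set t := heat f1 s1 y.
  have := thr_ge t (ltW e0); set q := thr e t => h1.
  rewrite mulrCA [X in _ <= _ + X]mulrC -mulrDr; apply: ler_wpM2l => //.
  apply: le_trans h1 _; rewrite addrA lerD2r.
  rewrite -(ler_pM2l ex0) mulrDr mulrA mulfV ?gt_eqF// mul1r.
  have := sqr_ge0 (`|q| - ex); rewrite sqrrB real_normK ?num_real//.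
  by move: (mulr_ge0 (ltW ex0) (normr_ge0 q)); clear; lra.
rewrite -/ex [leRHS](_ : _ = C3 * ex + (ex + e) * Bp); last by rewrite /e; ring.
rewrite lerD2r.
have : ex^-1 * J <= C3 * ex.
  by rewrite mulrC ler_pdivrMr// -mulrA -expr2.
by [].
Qed.

End HeatDecay.

(** * From Gaussian decay to ball integrals *)

Section Decode.
Variables (R : realType) (n : nat).
Local Notation V := 'rV[R]_n.
Implicit Types (x y z u v : V).

Lemma scont_ballint (f : V -> R) M b : scont f -> (forall y, `|f y| <= M) ->
  scont (fun x => ballint f x b).
Proof.
move=> cf fM u x ux.
pose F_ j := fun z => ballfun (fun z => f (z + u j)) 0 b z.
have E w : ballint f w b = int_Rn (fun z => ballfun (fun z => f (z + w)) 0 b z).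
  rewrite /ballint -(int_shift w (adm_ballfun _ _ cf)); apply: eq_int_Rn => z.
  by rewrite /ballfun addrK subr0.
rewrite E; under eq_fun do rewrite E.
have [C HC] := @dominated_ball R n 0 b M.
have dF j : dominated C (F_ j).
  apply: HC => y; rewrite /F_ /ballfun; last by move=> h; rewrite ltNge (ltW h).
  by case: ifP => _ //; rewrite normr0 (le_trans _ (fM 0)).
have [] // := @int_dct _ _ C F_ (ballfun (fun z => f (z + x)) 0 b) dF.
  by move=> j; apply: adm_ballfun; exact: scont_shift.
move=> y; rewrite /F_ /ballfun; case: ifP => _; last exact: cvg_cst.
apply: cf => i; rewrite mxE; under eq_fun do rewrite mxE.
by apply: cvgD; [exact: cvg_cst|exact: ux].
Qed.

Section Compact.
Variables (f1 : V -> R) (M L : R) (p : V).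
Hypotheses (c1 : scont f1) (f1M : forall y, `|f1 y| <= M) (f1L : forall y, L < nsq (y - p) -> f1 y = 0).

Lemma mulf_dct (G_ : nat -> V -> R) G K : (forall j, scont (G_ j)) ->
  (forall j y, nsq (y - p) <= L -> `|G_ j y| <= K) ->
  (forall y, G_ j y @[j --> \oo] --> G y) ->
  adm (fun y => f1 y * G y) /\
  int_Rn (fun y => f1 y * G_ j y) @[j --> \oo] --> int_Rn (fun y => f1 y * G y).
Proof.
move=> cG GK Gc; have [C HC] := dominated_ball p L (M * `|K|).
have dF j : dominated C (fun y => f1 y * G_ j y).
  apply: HC => y; last by move=> /f1L->; rewrite mul0r.
  have [h|/f1L->] := leP (nsq (y - p)) L; last by rewrite mul0r normr0 mulr_ge0// (le_trans _ (f1M y)).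
  by rewrite normrM; apply: ler_pM => //; exact: le_trans (GK j y h) (ler_norm _).
apply: (int_dct dF); first by move=> j; apply: (adm_scont (dF j)); exact: scontM.
by move=> y; apply: cvgM; [exact: cvg_cst|exact: Gc].
Qed.

Lemma scont_radial_int (k : R -> R) K : continuous k -> (forall a, 0 <= a -> `|k a| <= K) ->
  scont (fun x => int_Rn (fun y => f1 y * k (nsq (y - x)))).
Proof.
move=> ck kK u x ux.
apply: (@mulf_dct (fun j y => k (nsq (y - u j))) (fun y => k (nsq (y - x))) K _ _ _).2.
- by move=> j; apply: (scont_comp (f := k)) => //; exact: scont_nsq.
- by move=> j y _; apply: kK; exact: nsq_ge0.
- by move=> y; exact: (scont_comp (f := k) ck (@scont_nsqC R n y) ux).
Qed.

Variables (chi : V -> R) (q C B : R).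
Hypotheses (cchi : scont chi) (chi0 : forall x, 0 <= chi x) (chi1 : forall x, chi x <= 1)
  (chiq : forall x, q < nsq (x - p) -> chi x = 0) (C0 : 0 <= C).
Hypothesis HD : forall Lam : R, 1 <= Lam ->
  int_Rn (fun x => chi x * `|int_Rn (fun y => f1 y * expR (- (Lam * nsq (y - x))))|) <=
  C * expR (- (Lam * B)).

Let M0 : 0 <= M. Proof. exact: le_trans (f1M 0). Qed.

(* [1 - exp (- exp (J^2 (b - a) - J))] is a power series in [exp (- J^2 a)]
   and tends to the indicator of [a < b]. *)
Lemma gauss_decay_ballint b x : 0 < b -> b <= B -> 0 < chi x -> ballint f1 x b = 0.
Proof.
move=> b0 bB chix.
pose J (j : nat) : R := j.+1%:R.
have J1 j : 1 <= J j by rewrite /J ler1n.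
have J0 j : 0 < J j by exact: lt_le_trans (J1 j).
pose th j a := J j ^+ 2 * (b - a) - J j.
pose U j := expR (J j ^+ 2 * b).
have thU j a : 0 <= a -> expR (th j a) <= U j.
  move=> a0; rewrite ler_expR /th; have := J0 j.
  have : 0 <= J j ^+ 2 * a by apply: mulr_ge0 => //; exact: sqr_ge0.
  rewrite mulrBr; lra.
pose T j K a := \sum_(0 <= i < K) exp_coeff (- expR (th j a)) i.+1.
have Tb j K a : 0 <= a -> `|T j K a| <= expR (U j).
  move=> a0; apply: le_trans (ler_norm_sum _ _ _) _.
  apply: (@le_trans _ _ (\sum_(0 <= i < K.+1) exp_coeff (expR (th j a)) i)).
    rewrite big_nat_recl//; apply: (@le_trans _ _ (\sum_(0 <= i < K) exp_coeff (expR (th j a)) i.+1)).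
      apply: ler_sum => i _; rewrite /exp_coeff /= normrM normrX normrN (ger0_norm (expR_ge0 _)).
      by rewrite ger0_norm// invr_ge0.
    by rewrite lerDr exp_coeff_ge0 ?expR_ge0.
  by apply: le_trans (exp_partial_le _ (expR_ge0 _)) _; rewrite ler_expR thU.
have thc j : continuous (th j).
  move=> a; apply: cvgB; last exact: cvg_cst.
  by apply: cvgM; [exact: cvg_cst|apply: cvgB; [exact: cvg_cst|exact: cvg_id]].
have expc (g : R -> R) : continuous g -> continuous (fun a => expR (g a)).
  by move=> cg a; apply: continuous_comp; [exact: cg|exact: continuous_expR].
have oppc (g : R -> R) : continuous g -> continuous (fun a => - g a).
  by move=> cg a; apply: cvgN; exact: cg.
have powc (g : R -> R) k : continuous g -> continuous (fun a => g a ^+ k).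
  move=> cg; elim: k => [|k IH] a.
    by under [X in continuous_at a X]eq_fun do rewrite expr0; exact: cvg_cst.
  under [X in continuous_at a X]eq_fun do rewrite exprS.
  by apply: cvgM; [exact: cg|exact: IH].
have Tc j K : continuous (T j K).
  elim: K => [|K IH].
    have -> : T j 0%N = fun=> 0 by apply/funext => a; rewrite /T big_geq.
    by move=> a; exact: cvg_cst.
  have -> : T j K.+1 = fun a => T j K a + (- expR (th j a)) ^+ K.+1 / (K.+1)`!%:R.
    by apply/funext => a; rewrite /T big_nat_recr.
  have h : continuous (fun a => (- expR (th j a)) ^+ K.+1).
    by apply: powc; apply: oppc; apply: expc; exact: thc.
  by move=> a; apply: cvgD; [exact: IH|apply: cvgM; [exact: h|exact: cvg_cst]].
pose Phi j K z := int_Rn (fun y => f1 y * T j K (nsq (y - z))).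
pose W j a := expR (- expR (th j a)) - 1.
pose Ph j z := int_Rn (fun y => f1 y * W j (nsq (y - z))).
have Wc j : continuous (W j).
  have h : continuous (fun a => expR (- expR (th j a))) := expc _ (oppc _ (expc _ (thc j))).
  by move=> a; apply: cvgB; [exact: h|exact: cvg_cst].
have Wb j a : `|W j a| <= 1.
  have h1 := expR_gt0 (- expR (th j a)).
  have h2 : expR (- expR (th j a)) <= 1 by rewrite -[leRHS]expR0 ler_expR oppr_le0 expR_ge0.
  by rewrite /W ler_norml; lra.
have skx (k : R -> R) z : continuous k -> scont (fun y : V => k (nsq (y - z))).
  by move=> ck; apply: (scont_comp (f := k)) => //; exact: scont_nsq.
have PhiPh j z : Phi j K z @[K --> \oo] --> Ph j z.
  apply: (@mulf_dct (fun K y => T j K (nsq (y - z))) (fun y => W j (nsq (y - z))) (expR (U j)) _ _ _).2.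
  - by move=> K; exact: skx.
  - by move=> K y _; apply: Tb; exact: nsq_ge0.
  - move=> y; set a := nsq _.
    have e1 K : T j K a = series (exp_coeff (- expR (th j a))) K.+1 - 1.
      rewrite /series /= big_nat_recl// /T [in RHS]/exp_coeff/= expr0 fact0 divr1 addrAC subrr add0r.
      by apply: eq_bigr.
    under eq_fun do rewrite e1.
    apply: cvgB; last exact: cvg_cst.
    by move: (@exp_cvg R (- expR (th j a))); rewrite -cvg_shiftS.
pose I1 := int_Rn (fun y => `|f1 y|).
have bnd (k : R -> R) K z : continuous k -> (forall a, 0 <= a -> `|k a| <= K) ->
    `|int_Rn (fun y => f1 y * k (nsq (y - z)))| <= K * I1.
  move=> ck kK; apply: (int_mulf_bound c1 f1L); first exact: skx.
  by move=> y _; apply: kK; exact: nsq_ge0.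
have chidct (P_ : nat -> V -> R) P K : (forall j, scont (P_ j)) -> (forall j z, `|P_ j z| <= K) ->
    (forall z, P_ j z @[j --> \oo] --> P z) ->
    (exists C, dominated C (fun z => chi z * `|P z|)) /\
    int_Rn (fun z => chi z * `|P_ j z|) @[j --> \oo] --> int_Rn (fun z => chi z * `|P z|).
  move=> cP PK Pc; have [D HDD] := dominated_ball p q K.
  have dF j : dominated D (fun z => chi z * `|P_ j z|).
    apply: HDD => y; last by move=> /chiq->; rewrite mul0r.
    rewrite normrM normr_id ger0_norm// (le_trans _ (PK j y))// ler_piMl//.
  have cc z : (fun j => chi z * `|P_ j z|) @ \oo --> chi z * `|P z|.
    by apply: cvgM; [exact: cvg_cst|apply: cvg_norm; exact: Pc].
  have aP j : adm (fun z => chi z * `|P_ j z|).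
    by apply: (adm_scont (dF j)); apply: scontM => //; exact: scont_norm.
  by have [[? ?] ?] := int_dct dF aP cc.
have cPhi j K : scont (Phi j K) by exact: (@scont_radial_int (T j K) (expR (U j)) (Tc j K) (Tb j K)).
have cPh j : scont (Ph j) by exact: (@scont_radial_int (W j) 1 (Wc j) (fun a _ => Wb j a)).
pose e j := expR (- J j).
(* The term of index i has Lam = (i+1) J^2. The decay exp(-Lam B) cancels its coefficient exp((i+1)
   J^2 b) because b <= B; exp(-(i+1) J) / (i+1)! remains, and these sum to at most exp(exp(-J)) -
   1. *)
have step1 j K : int_Rn (fun z => chi z * `|Phi j K z|) <= C * (expR (e j) - 1).
  pose Lam i := i.+1%:R * J j ^+ 2.
  have Lam1 i : 1 <= Lam i.
    have l1 : 1 <= J j ^+ 2 by rewrite expr_ge1.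
    by apply: le_trans l1 _; rewrite ler_peMl ?sqr_ge0// ler1n.
  pose H i z := int_Rn (fun y => f1 y * expR (- (Lam i * nsq (y - z)))).
  pose co i := expR (i.+1%:R * (J j ^+ 2 * b - J j)) / (i.+1)`!%:R.
  have co0 i : 0 <= co i by rewrite divr_ge0// expR_ge0.
  have gc i : continuous (fun a : R => expR (- (Lam i * a))).
    apply: expc; apply: oppc => a.
    by apply: cvgM; [exact: cvg_cst|exact: cvg_id].
  have cH i : scont (H i).
    apply: (@scont_radial_int (fun a => expR (- (Lam i * a))) 1) => // a a0.
    rewrite ger0_norm ?expR_ge0// -[leRHS]expR0 ler_expR oppr_le0; apply: mulr_ge0 => //.
    exact: le_trans (Lam1 i).
  have aH i : adm (fun z => chi z * `|H i z|).
    apply: (csupp_adm (x := p) (b := q)); last by move=> y /chiq->; rewrite mul0r.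
    by apply: scontM => //; exact: scont_norm.
  have PE z : Phi j K z = \sum_(0 <= i < K) (-1) ^+ i.+1 * co i * H i z.
    rewrite /Phi (eq_int_Rn (G := fun y => \sum_(0 <= i < K) ((-1) ^+ i.+1 * co i) * (f1 y * expR (- (Lam i * nsq (y - z)))))).
      rewrite int_Rn_sum.
        apply: eq_bigr => i _; rewrite int_RnZ//.
        by apply: (adm_mulf c1 f1L); exact: (skx (fun a => expR (- (Lam i * a)))).
      move=> i; apply: admZ.
      by apply: (adm_mulf c1 f1L); exact: (skx (fun a => expR (- (Lam i * a)))).
    move=> y; rewrite /T mulr_sumr; apply: eq_bigr => i _.
    have -> : exp_coeff (- expR (th j (nsq (y - z)))) i.+1 = (- expR (th j (nsq (y - z)))) ^+ i.+1 / (i.+1)`!%:R by [].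
    rewrite [(- expR _) ^+ _]exprNn -[expR _ ^+ _]expRM_natl /co.
    rewrite (_ : i.+1%:R * th j (nsq (y - z)) = i.+1%:R * (J j ^+ 2 * b - J j) + - (Lam i * nsq (y - z))).
      by rewrite expRD; ring.
    by rewrite /th /Lam; ring.
  apply: (@le_trans _ _ (\sum_(0 <= i < K) co i * int_Rn (fun z => chi z * `|H i z|))).
    rewrite (eq_bigr (fun i => int_Rn (fun z => co i * (chi z * `|H i z|)))); last first.
      by move=> i _; rewrite int_RnZ.
    rewrite -int_Rn_sum; last by move=> i; exact: admZ.
    apply: le_int_Rn.
    - apply: (csupp_adm (x := p) (b := q)); last by move=> y /chiq->; rewrite mul0r.
      by apply: scontM => //; exact: scont_norm.
    - by apply: adm_sum => i; exact: admZ.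
    - move=> z; rewrite PE; apply: (@le_trans _ _ (chi z * \sum_(0 <= i < K) co i * `|H i z|)).
        apply: ler_wpM2l => //; apply: le_trans (ler_norm_sum _ _ _) _.
        apply: ler_sum => i _; rewrite !normrM normrX normrN1 expr1n mul1r.
        by rewrite -normrM (ger0_norm (co0 i)).
      by rewrite mulr_sumr; apply: ler_sum => i _; rewrite mulrCA.
  apply: (@le_trans _ _ (\sum_(0 <= i < K) C * exp_coeff (e j) i.+1)).
    apply: ler_sum => i _; apply: le_trans (ler_wpM2l (co0 i) (HD (Lam1 i))) _.
    rewrite mulrCA; apply: ler_wpM2l => //; rewrite /co /exp_coeff/= mulrAC; apply: ler_wpM2r.
      by rewrite invr_ge0.
    rewrite -expRM_natl -expRD ler_expR /Lam.
    have : J j ^+ 2 * b <= J j ^+ 2 * B by apply: ler_wpM2l => //; exact: sqr_ge0.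
    have i0 : 0 <= i.+1%:R :> R by [].
    move=> /(ler_wpM2l i0); lra.
  rewrite -mulr_sumr; apply: ler_wpM2l => //.
  rewrite lerBrDl; have := exp_partial_le K.+1 (expR_ge0 (- J j)); rewrite big_nat_recl//.
  by rewrite {1}/exp_coeff/= expr0 fact0 divr1.
have step2 j : int_Rn (fun z => chi z * `|Ph j z|) <= C * (expR (e j) - 1).
  have [_ h] := chidct (Phi j) (Ph j) (expR (U j) * I1) (cPhi j)
    (fun K z => bnd _ _ z (Tc j K) (Tb j K)) (PhiPh j).
  rewrite -(cvg_lim _ h)//; apply: limr_le; first by apply/cvg_ex; eexists; exact: h.
  by apply: nearW => K; exact: step1.
have Jinf : J j @[j --> \oo] --> +oo by rewrite /J; have := @cvgr_idn R; rewrite -cvg_shiftS.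
have e0 : e j @[j --> \oo] --> (0 : R) by rewrite /e /J; have := @cvgn_expR R; rewrite -cvg_shiftS.
pose bz z := - ballint f1 z b.
(* For a < b the quadratic term J^2 (b - a) beats J; for a >= b, the boundary case a = b included,
   the summand -J drives the inner exponential to 0. *)
have Wlim (a : R) : W j a @[j --> \oo] --> (if a < b then -1 else 0 : R).
  have Jb (y : R) : \forall j \near \oo, y <= J j by move/cvgryPge : Jinf; exact.
  have einv (y : R) : 0 < y -> expR (- y) <= y^-1.
    by move=> y0; rewrite expRN lef_pV2 ?posrE ?expR_gt0//; have := expR_ge1Dx y; lra.
  apply/cvgrPdist_le => d d0; case: ltP => ab.
    have ba : 0 < b - a by rewrite subr_gt0.
    near=> j; have h1 : 2 / (b - a) <= J j by near: j; exact: Jb.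
    have h2 : d^-1 <= J j by near: j; exact: Jb.
    have h3 : J j <= th j a.
      rewrite ler_pdivrMr// in h1; have := ler_wpM2l (ltW (J0 j)) h1; rewrite /th expr2; lra.
    have e1 : 0 < expR (th j a) by exact: expR_gt0.
    have h4 : expR (- expR (th j a)) <= d.
      apply: le_trans (einv _ e1) _; rewrite -[leRHS]invrK lef_pV2 ?posrE ?invr_gt0//.
      apply: le_trans h2 _; apply: le_trans h3 _; have := expR_ge1Dx (th j a); lra.
    have h6 := expR_gt0 (- expR (th j a)).
    by rewrite /W ler_norml; lra.
  near=> j; have h2 : d^-1 <= J j by near: j; exact: Jb.
  have h3 : th j a <= - J j.
    rewrite /th gerDr; apply: mulr_ge0_le0; [exact: sqr_ge0|by rewrite subr_le0].
  have h4 : expR (th j a) <= d.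
    apply: (@le_trans _ _ (expR (- J j))); first by rewrite ler_expR.
    by apply: le_trans (einv _ (J0 j)) _; rewrite -[leRHS]invrK lef_pV2 ?posrE ?invr_gt0.
  have h5 := expR_ge1Dx (- expR (th j a)).
  have h6 : expR (- expR (th j a)) <= 1 by rewrite -[leRHS]expR0 ler_expR oppr_le0 expR_ge0.
  by rewrite sub0r normrN /W ler_norml; lra.
have Phlim z : Ph j z @[j --> \oo] --> bz z.
  have [_] := @mulf_dct (fun j y => W j (nsq (y - z))) (fun y => if nsq (y - z) < b then -1 else 0) 1
    (fun j => skx _ z (Wc j)) (fun j y _ => Wb j _) (fun y => Wlim _).
  congr (_ --> _); rewrite /bz /ballint -int_RnN; last exact: adm_ballfun.
  by apply: eq_int_Rn => y; rewrite /ballfun; case: ifP; rewrite ?mulrN1 ?mulr0 ?oppr0.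
have PhI j z : `|Ph j z| <= I1.
  by rewrite -[leRHS]mul1r; apply: bnd => // a _; exact: Wb.
have [[D dD] h] := chidct Ph bz I1 cPh PhI Phlim.
have z0 : int_Rn (fun z => chi z * `|bz z|) = 0.
  apply/eqP; rewrite eq_le; apply/andP; split; last first.
    by apply: int_Rn_ge0 => z; exact: mulr_ge0.
  have l0 : C * (expR (e j) - 1) @[j --> \oo] --> (0 : R).
    rewrite -(mulr0 C) -[X in C * X](subrr 1) -{2}(@expR0 R); apply: cvgM; first exact: cvg_cst.
    apply: cvgB; last exact: cvg_cst.
    by apply: continuous_cvg; [exact: continuous_expR|exact: e0].
  rewrite -(cvg_lim _ h)// -(cvg_lim _ l0)//; apply: ler_lim.
  - by apply/cvg_ex; eexists; exact: h.
  - by apply/cvg_ex; eexists; exact: l0.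
  - by apply: nearW => j; exact: step2.
have cb : scont (fun z => chi z * `|bz z|).
  apply: scontM => //; apply: scont_norm; apply: scontN.
  by apply: scont_ballint; [exact: c1|exact: f1M].
have := int_eq0 dD cb _ z0 x => /(_ (fun z => mulr_ge0 (chi0 z) (normr_ge0 _))).
by move=> /eqP; rewrite mulf_eq0 gt_eqF//= normr_eq0 oppr_eq0 => /eqP.
Unshelve. all: by end_near. Qed.

End Compact.
End Decode.

(** * From ball integrals to pointwise vanishing *)

Section Localization.
Variables (R : realType) (n : nat).
Local Notation V := 'rV[R]_n.
Implicit Types (x y z u v q : V).

Lemma scont_hk0 s : scont (fun z : V => hk n s (nsq z)).
Proof.
move=> u x ux; have := @scont_hk R n s 0 u x ux; rewrite subr0.
by under eq_fun do rewrite subr0.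
Qed.

Lemma hmass_gt0 : 0 < hmass R n.
Proof.
have [[C dC] _] := @adm_hk R n 1 ltr01.
have ch : scont (fun z : V => hk n 1 (nsq z)).
  exact: scont_hk0.
by apply: (int_gt0 (x0 := 0) dC ch) => [y|]; [exact: expR_ge0|exact: expR_gt0].
Qed.

Lemma adm_bounded_hk (F : V -> R) M q s : scont F -> (forall y, `|F y| <= M) -> 0 < s ->
  adm (fun z => F (z + q) * hk n s (nsq z)).
Proof.
move=> cF FM s0; have [[C dC] _] := @adm_hk R n s s0.
apply: (@adm_scont _ _ (M * C)).
  move=> y; rewrite normrM -mulrA; apply: ler_pM => //; exact: dC.
apply: scontM; first exact: scont_shift.
exact: scont_hk0.
Qed.

(** Continuity and boundedness give F(z + q) >= F(q)/2 - K |z|^2. The second moment of the kernel is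
    s times a constant, so a small s leaves a positive integral. *)
Lemma gauss_pos (F : V -> R) M q : scont F -> (forall y, `|F y| <= M) -> 0 < F q ->
  exists2 s, 0 < s & 0 < int_Rn (fun z => F (z + q) * hk n s (nsq z)).
Proof.
move=> cF FM Fq; have M0 : 0 <= M := le_trans (normr_ge0 _) (FM q).
have c2 : 0 < F q / 2 by exact: divr_gt0.
have [d d0 hd] := scont_eps q cF c2.
pose K := (M + F q / 2) / d ^+ 2.
have K0 : 0 <= K by rewrite divr_ge0 ?sqr_ge0// addr_ge0// ltW.
have low z : F q / 2 - K * nsq z <= F (z + q).
  have [h|h] := ltP (nsq z) (d ^+ 2).
    have := hd (z + q); rewrite ltr_norml => /(_ _)/andP[|h1 _].
      move=> i; rewrite mxE addrK -(ltr_pXn2r (ltn0Sn 1)) ?nnegrE ?(ltW d0)// real_normK ?num_real//.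
      exact: le_lt_trans (nsq_coord z i) h.
    by have := mulr_ge0 K0 (nsq_ge0 z); lra.
  have : M + F q / 2 <= K * nsq z by rewrite /K mulrAC ler_pdivlMr ?exprn_gt0//; apply: ler_wpM2l => //; rewrite addr_ge0// ltW.
  have := FM (z + q); rewrite ler_norml; lra.
have h0 := hmass_gt0; have h2 := hmass2_ge0 R n.
pose s := F q / 2 * hmass R n / (K * hmass2 R n + 1).
have k1 : 0 < K * hmass2 R n + 1 by rewrite ltr_wpDl// mulr_ge0.
have s0 : 0 < s by rewrite divr_gt0// mulr_gt0.
exists s => //.
have a1 := admZ (F q / 2) (@adm_hk R n s s0).
have a2 := admZ K (@adm_nsq_hk R n s s0).
apply: (@lt_le_trans _ _ (int_Rn (fun z => F q / 2 * hk n s (nsq z) - K * (nsq z * hk n s (nsq z))))).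
  rewrite int_RnB// !int_RnZ//; [|exact: adm_nsq_hk|exact: adm_hk].
  rewrite hk_mass// hk_mass2// subr_gt0.
  rewrite mulrCA mulrC.
  have -> : F q / 2 * hmass R n = s * (K * hmass2 R n + 1) by rewrite /s divfK// gt_eqF.
  by rewrite mulrC ltr_pM2l// ltrDl.
apply: le_int_Rn; first exact: admB.
  exact: adm_bounded_hk FM s0.
move=> z; rewrite mulrA -mulrBl; apply: ler_wpM2r; first exact: expR_ge0.
exact: low.
Qed.

Lemma gauss_eq0 (F : V -> R) M q : scont F -> (forall y, `|F y| <= M) ->
  (forall s, 0 < s -> int_Rn (fun z => F (z + q) * hk n s (nsq z)) = 0) -> F q = 0.
Proof.
move=> cF FM H; apply/eqP; case: ltgtP => // Fq.
  have [s s0] := gauss_pos (F := fun y => - F y) (M := M) (q := q) (scontN cF)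
    (fun y => eq_ind_r (fun a => a <= M) (FM y) (normrN _)) (eq_ind_r is_true Fq (oppr_gt0 _)).
  rewrite (eq_int_Rn (G := fun z => - (F (z + q) * hk n s (nsq z)))); last by move=> z; rewrite mulNr.
  by rewrite int_RnN ?H ?oppr0 ?ltxx//; exact: adm_bounded_hk FM s0.
by have [s s0] := gauss_pos cF FM Fq; rewrite H// ltxx.
Qed.

Lemma pow_convex (a b : R) m : 0 <= a -> 0 <= b -> m.+1%:R * b ^+ m * (a - b) <= a ^+ m.+1 - b ^+ m.+1.
Proof.
move=> a0 b0; elim: m => [|m IH]; first by rewrite expr0 !mul1r !expr1.
have h1 : 0 <= a ^+ m.+1 - b ^+ m.+1 - m.+1%:R * b ^+ m * (a - b) by rewrite subr_ge0.
have h2 := mulr_ge0 a0 h1.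
have h3 : 0 <= m.+1%:R * b ^+ m * (a - b) ^+ 2.
  by apply: mulr_ge0; [apply: mulr_ge0 => //; exact: exprn_ge0|exact: sqr_ge0].
rewrite -subr_ge0.
have -> : a ^+ m.+2 - b ^+ m.+2 - m.+2%:R * b ^+ m.+1 * (a - b) =
  a * (a ^+ m.+1 - b ^+ m.+1 - m.+1%:R * b ^+ m * (a - b)) + m.+1%:R * b ^+ m * (a - b) ^+ 2.
  by rewrite !exprS -!natr1; ring.
exact: addr_ge0.
Qed.

(** From exponent 2 on these are convex and C^1, and differentiation only lowers the exponent. *)
Definition pospow (m : nat) (s : R) : R := (Num.max 0 s) ^+ m.

Lemma pospow_continuous m : continuous (pospow m).
Proof.
move=> a; have h : {for a, continuous (fun x : R => Num.max 0 x)}.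
  by apply: continuous_max; [exact: cst_continuous|exact: cvg_id].
exact: (continuous_comp h (@exprn_continuous R m _)).
Qed.

Lemma pospow_convex m (r s : R) : m.+2%:R * pospow m.+1 r * (s - r) <= pospow m.+2 s - pospow m.+2 r.
Proof.
have [r0|r0] := leP r 0.
  by rewrite /pospow (max_l r0) !expr0n mulr0 mul0r subr0 exprn_ge0// le_max lexx.
apply: le_trans (pow_convex m.+1 _ _); rewrite ?le_max ?lexx//.
apply: ler_wpM2l; first by apply: mulr_ge0 => //; apply: exprn_ge0; rewrite le_max lexx.
by rewrite (max_r (ltW r0)) lerD2r le_max lexx orbT.
Qed.

Lemma pospow_bound m (s t : R) : s <= t -> `|pospow m s| <= `|t| ^+ m.
Proof.
move=> st; have t0 := normr_ge0 t.
rewrite /pospow normrX; apply: lerXn2r; rewrite ?nnegrE// ger0_norm ?le_max ?lexx//.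
by rewrite ge_max t0/= (le_trans st)// ler_norm.
Qed.

Lemma scont_pospow m (F : V -> R) : scont F -> scont (fun y => pospow m (F y)).
Proof. by move=> cF; apply: scontX; apply: scont_max => //; exact: scont_cst. Qed.

(** All exponents occur at once because differentiating in the centre trades one power of the kernel
    for a linear factor. Exponents start at 1, where the kernel is still continuous. *)
Definition zero_moments (p : V) (r0 t : R) (F : V -> R) :=
  forall x m, nsq (x - p) < r0 ^+ 2 -> int_Rn (fun y => F y * pospow m.+1 (t - nsq (y - x))) = 0.

(* Differentiate in the centre [x], in the direction [u]. *)
Lemma zero_moments_dot p r0 t u (F : V -> R) M L : scont F -> (forall y, `|F y| <= M) ->
  (forall y, L < nsq (y - p) -> F y = 0) -> 0 < r0 -> zero_moments p r0 t F ->
  zero_moments p r0 t (fun y => F y * dot u (y - p)).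
Proof.
move=> cF FM FL r00 H x m hx.
pose tau (k : nat) : R := k.+1%:R^-1.
have tau0 k : 0 < tau k by rewrite invr_gt0.
have tau1 k : tau k <= 1 by rewrite invf_le1 ?ltr0n// ler1n.
have tauc : tau k @[k --> \oo] --> (0 : R) by exact: cvg_harmonic.
pose r y := t - nsq (y - x).
pose sg k y := t - nsq (y - (x + tau k *: u)).
pose d y := dot u (y - x).
have sgE k y : sg k y - r y = tau k * (2 * d y - tau k * nsq u).
  rewrite /sg /r (_ : y - (x + tau k *: u) = (y - x) - tau k *: u); last by rewrite opprD addrA.
  by rewrite (nsqB (y - x)) dotZr nsqZ /d (dotC u); ring.
pose G_ k y := k.+1%:R * (pospow m.+2 (sg k y) - pospow m.+2 (r y)).
pose G y := m.+2%:R * pospow m.+1 (r y) * (2 * d y).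
have kt k a : k.+1%:R * (tau k * a) = a by rewrite mulrA mulfV ?mul1r// pnatr_eq0.
(* Tangent inequalities at the two ends sandwich the difference quotient between expressions with
   the same limit, so no derivative is taken. *)
have low k y : m.+2%:R * pospow m.+1 (r y) * (2 * d y - tau k * nsq u) <= G_ k y.
  have := pospow_convex m (r y) (sg k y); rewrite sgE => h.
  by rewrite -[leLHS](kt k); apply: ler_wpM2l => //; rewrite mulrCA.
have upp k y : G_ k y <= m.+2%:R * pospow m.+1 (sg k y) * (2 * d y - tau k * nsq u).
  have := pospow_convex m (sg k y) (r y); rewrite -opprB sgE mulrN -[leRHS]opprB lerN2 => h.
  by rewrite -[leRHS](kt k); apply: ler_wpM2l => //; rewrite mulrCA.
have [Md Md0 hMd] := scont_bounded_ball p L (@scont_dot R n u x).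
have cr : scont r by apply: scontB; [exact: scont_cst|exact: scont_nsq].
have csg k : scont (sg k) by apply: scontB; [exact: scont_cst|exact: scont_nsq].
have cG k : scont (G_ k).
  by apply: scontM; [exact: scont_cst|apply: scontB; exact: scont_pospow].
have rt y : r y <= t by rewrite gerBl nsq_ge0.
have st k y : sg k y <= t by rewrite gerBl nsq_ge0.
pose K := m.+2%:R * `|t| ^+ m.+1 * (2 * Md + nsq u).
have inner k y : nsq (y - p) <= L -> `|2 * d y - tau k * nsq u| <= 2 * Md + nsq u.
  move=> hy; apply: le_trans (ler_normB _ _) _; rewrite !normrM (ger0_norm (ltW (tau0 k))).
  rewrite (ger0_norm (nsq_ge0 u)) ger0_norm//; apply: lerD; first by apply: ler_wpM2l => //; exact: hMd.
  by apply: ler_piMl => //; exact: nsq_ge0.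
have prod (a c : R) : `|a| <= `|t| ^+ m.+1 -> `|c| <= 2 * Md + nsq u -> `|m.+2%:R * a * c| <= K.
  move=> ha hc; rewrite !normrM normr_nat; by apply: ler_pM => //; rewrite ?mulr_ge0//; apply: ler_wpM2l.
have GK k y : nsq (y - p) <= L -> `|G_ k y| <= K.
  move=> hy; have i1 := inner k y hy.
  have := prod _ _ (pospow_bound m.+1 (rt y)) i1; have := prod _ _ (pospow_bound m.+1 (st k y)) i1.
  rewrite !ler_norml => /andP[_ h1] /andP[h2 _].
  by rewrite (le_trans h2 (low k y)) (le_trans (upp k y) h1).
have lim0 (a b c : R) : a + tau k * (b + tau k * c) @[k --> \oo] --> a.
  have : a + tau k * (b + tau k * c) @[k --> \oo] --> a + 0 * (b + 0 * c).
    apply: cvgD; first exact: cvg_cst.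
    by apply: cvgM => //; apply: cvgD; [exact: cvg_cst|apply: cvgM => //; exact: cvg_cst].
  by rewrite mul0r addr0.
have sgc y : sg k y @[k --> \oo] --> r y.
  rewrite (_ : (fun k => sg k y) = fun k => r y + tau k * (2 * d y + tau k * - nsq u)); first exact: lim0.
  by apply/funext => k; rewrite mulrN -sgE addrC subrK.
have inc y : (2 * d y - tau k * nsq u) @[k --> \oo] --> 2 * d y.
  have : 2 * d y - tau k * nsq u @[k --> \oo] --> 2 * d y - 0 * nsq u.
    by apply: cvgB; [exact: cvg_cst|apply: cvgM; [exact: tauc|exact: cvg_cst]].
  by rewrite mul0r subr0.
have Gc y : G_ k y @[k --> \oo] --> G y.
  apply: (squeeze_cvgr (f := fun k => m.+2%:R * pospow m.+1 (r y) * (2 * d y - tau k * nsq u))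
    (h := fun k => m.+2%:R * pospow m.+1 (sg k y) * (2 * d y - tau k * nsq u))).
  - by apply: nearW => k; rewrite low upp.
  - by apply: cvgM; [exact: cvg_cst|exact: inc].
  - apply: cvgM; last exact: inc.
    apply: cvgM; first exact: cvg_cst.
    by apply: continuous_cvg; [exact: pospow_continuous|exact: sgc].
have [_ lim] := mulf_dct cF FM FL cG GK Gc.
have aF (X : V -> R) : scont X -> adm (fun y => F y * X y) by exact: (adm_mulf cF FL).
have xk : \forall k \near \oo, nsq (x + tau k *: u - p) < r0 ^+ 2.
  have : nsq (x + tau k *: u - p) @[k --> \oo] --> nsq (x - p).
    rewrite (_ : (fun k => nsq (x + tau k *: u - p)) = fun k => nsq (x - p) + tau k * (2 * dot (x - p) u + tau k * nsq u)); first exact: lim0.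
    by apply/funext => k; rewrite addrAC (nsqD (x - p)) dotZr nsqZ; ring.
  by move=> /cvgr_lt; exact.
have z0 : int_Rn (fun y => F y * G y) = 0.
  rewrite -(cvg_lim _ lim)//; apply: (cvg_lim (@norm_hausdorff _ _)).
  apply: cvg_near_cst; near=> k.
  have hk' : nsq (x + tau k *: u - p) < r0 ^+ 2 by near: k; exact: xk.
  rewrite (eq_int_Rn (G := fun y => k.+1%:R * (F y * pospow m.+2 (sg k y) - F y * pospow m.+2 (r y)))); last first.
    by move=> y; rewrite /G_; ring.
  have b1 : adm (fun y => F y * pospow m.+2 (sg k y)) by apply: aF; exact: scont_pospow.
  have b2 : adm (fun y => F y * pospow m.+2 (r y)) by apply: aF; exact: scont_pospow.
  by rewrite int_RnZ ?int_RnB// ?(H _ _ hk') ?(H _ _ hx) ?subrr ?mulr0//; exact: admB.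
have b3 : adm (fun y => F y * pospow m.+1 (r y)) by apply: aF; exact: scont_pospow.
have b4 : adm (fun y => F y * (dot u (y - p) * pospow m.+1 (r y))).
  by apply: aF; apply: scontM; [exact: scont_dot|exact: scont_pospow].
(* Differentiation yields the factor <u, y - x>; splitting it as <u, y - p> - <u, x - p> gives a
   factor independent of the centre, and the second part vanishes by [H]. *)
have E : int_Rn (fun y => F y * G y) = 2 * m.+2%:R * (int_Rn (fun y => F y * (dot u (y - p) * pospow m.+1 (r y))) -
    dot u (x - p) * int_Rn (fun y => F y * pospow m.+1 (r y))).
  rewrite -int_RnZ// -int_RnB//; last exact: admZ.
  rewrite -int_RnZ; last by apply: admB => //; exact: admZ.
  apply: eq_int_Rn => y; rewrite /G /d (_ : y - x = (y - p) - (x - p)); last by rewrite opprB addrA subrK.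
  by rewrite dotDr dotNr; ring.
move: E; rewrite z0 (H x m hx) mulr0 subr0 => /esym/eqP; rewrite mulf_eq0 mulf_eq0 !pnatr_eq0/= => /eqP <-.
by apply: eq_int_Rn => y; rewrite mulrA.
Unshelve. all: by end_near. Qed.

(** Put l = <q - p, y - p> and w = B - |y - p|^2. Repeated differentiation makes f1 orthogonal to
    all l^j w_+^(m+1). Since -|y - q|^2 = w + 2 l - B - |q - p|^2, the heat kernel centred at q is,
    up to a constant, the exponential of a combination of w and l; so all Gaussian averages at q of
    f1 w_+ vanish, and w(q) > 0. *)
Lemma zero_ballint_near (f1 : V -> R) M L p r0 B q : scont f1 -> (forall y, `|f1 y| <= M) ->
  (forall y, L < nsq (y - p) -> f1 y = 0) -> 0 < r0 ->
  (forall x, nsq (x - p) < r0 ^+ 2 -> forall b, 0 < b -> b <= B -> ballint f1 x b = 0) ->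
  nsq (q - p) < B -> f1 q = 0.
Proof.
move=> c1 f1M f1L r00 H qB.
have B0 : 0 < B := le_lt_trans (nsq_ge0 _) qB.
pose l y := dot (q - p) (y - p).
pose w y := B - nsq (y - p).
have cl : scont l by exact: scont_dot.
have cw : scont w by apply: scontB; [exact: scont_cst|exact: scont_nsq].
have aF (X : V -> R) : scont X -> adm (fun y => f1 y * X y) by exact: (adm_mulf c1 f1L).
have Z j : zero_moments p r0 B (fun y => f1 y * l y ^+ j).
  elim: j => [|j IH].
    move=> x m hx; rewrite (eq_int_Rn (G := fun y => f1 y * pospow m.+1 (B - nsq (y - x)))); last first.
      by move=> y; rewrite expr0 mulr1.
    apply: (radial_kernel0 (k := fun a => pospow m.+1 (B - a)) B0 c1).
    - have cB : continuous (fun a : R => B - a) by move=> a; apply: cvgB; [exact: cvg_cst|exact: cvg_id].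
      by move=> a; exact: (continuous_comp (cB a) (@pospow_continuous m.+1 _)).
    - by move=> a h; rewrite /pospow max_l ?expr0n// subr_le0.
    - by move=> b b0 bB; exact: H.
  have cj : scont (fun y => f1 y * l y ^+ j) by apply: scontM => //; exact: scontX.
  have jL y : L < nsq (y - p) -> f1 y * l y ^+ j = 0 by move=> /f1L->; rewrite mul0r.
  have [M' M'0 hM'] := scont_bounded_ball p L cj.
  have jM y : `|f1 y * l y ^+ j| <= M'.
    by have [/hM'//|/jL->] := leP (nsq (y - p)) L; rewrite normr0 ltW.
  have := zero_moments_dot (q - p) cj jM jL r00 IH.
  move=> h x m hx; rewrite -[RHS](h x m hx); apply: eq_int_Rn => y.
  by rewrite exprSr mulrA.
(* Multiplying by w raises m and multiplying by l raises j, so powers of [be * w + ga * l] are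
   absorbed by the moments. *)
have Q (be ga : R) k : forall j m, int_Rn (fun y => f1 y * (l y ^+ j * pospow m.+1 (w y) * (be * w y + ga * l y) ^+ k)) = 0.
  elim: k => [|k IH] j m.
    rewrite -[RHS](Z j p m); last by rewrite subrr nsq0 exprn_gt0.
    by apply: eq_int_Rn => y; rewrite expr0 mulr1 mulrA.
  have cz k' j' m' : scont (fun y => l y ^+ j' * pospow m'.+1 (w y) * (be * w y + ga * l y) ^+ k').
    apply: scontM; first by apply: scontM; [exact: scontX|exact: scont_pospow].
    by apply: scontX; apply: scontD; apply: scontM => //; exact: scont_cst.
  rewrite (eq_int_Rn (G := fun y => be * (f1 y * (l y ^+ j * pospow m.+2 (w y) * (be * w y + ga * l y) ^+ k)) +
     ga * (f1 y * (l y ^+ j.+1 * pospow m.+1 (w y) * (be * w y + ga * l y) ^+ k)))).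
    rewrite int_RnD; [|by apply: admZ; apply: aF|by apply: admZ; apply: aF].
    by rewrite !int_RnZ ?IH ?mulr0 ?addr0//; exact: aF.
  move=> y; have -> : pospow m.+2 (w y) = w y * pospow m.+1 (w y).
    rewrite /pospow exprS; have [h|h] := leP (w y) 0; rewrite ?expr0n ?mulr0//.
  by rewrite !exprS; ring.
pose F y := f1 y * pospow 1 (w y).
have cF : scont F by apply: scontM => //; exact: scont_pospow.
have FM y : `|F y| <= M * `|B| ^+ 1.
  rewrite normrM; apply: ler_pM => //; apply: pospow_bound; by rewrite gerBl nsq_ge0.
have F0 : F q = 0.
  apply: (gauss_eq0 cF FM) => s s0.
  have E : int_Rn (fun z => F (z + q) * hk n s (nsq z)) = int_Rn (fun y => F y * hk n s (nsq (y - q))).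
    have a : adm (fun y => F y * hk n s (nsq (y - q))).
      by apply: (adm_mulf (b := L) (p := p) cF) => [y /f1L|]; [rewrite /F => ->; rewrite mul0r|exact: scont_hk].
    by rewrite -(int_shift q a); apply: eq_int_Rn => y; rewrite addrK.
  rewrite E.
  pose be := (4 * s)^-1; pose ga := 2 * be.
  pose z y := be * w y + ga * l y.
  have cz : scont z by apply: scontD; apply: scontM => //; exact: scont_cst.
  pose kap := - (n%:R / 2 * ln s) - be * (B + nsq (q - p)).
  have hkE y : hk n s (nsq (y - q)) = expR kap * expR (z y).
    rewrite /hk -expRD; congr expR; rewrite /kap /z /ga /w /l.
    rewrite (_ : y - q = (y - p) - (q - p)); last by rewrite opprB addrA subrK.
    by rewrite nsqB (dotC (y - p)) /be; ring.
  have [Mz Mz0 hMz] := scont_bounded_ball p L cz.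
  pose P_ N y := pospow 1 (w y) * series (exp_coeff (z y)) N.
  have cP N : scont (P_ N).
    apply: scontM; first exact: scont_pospow.
    by apply: scont_sum => i; apply: scontM; [exact: scontX|exact: scont_cst].
  have PK N y : nsq (y - p) <= L -> `|P_ N y| <= `|B| ^+ 1 * expR Mz.
    move=> hy; rewrite normrM; apply: ler_pM => //.
      by apply: pospow_bound; rewrite gerBl nsq_ge0.
    apply: le_trans (ler_norm_sum _ _ _) _.
    apply: (@le_trans _ _ (\sum_(0 <= i < N) exp_coeff `|z y| i)).
      by apply: ler_sum => i _; rewrite /exp_coeff/= normrM normrX (ger0_norm (_ : 0 <= _^-1))// invr_ge0.
    by apply: le_trans (exp_partial_le _ _) _ => //; rewrite ler_expR; exact: hMz.
  have Pc y : P_ N y @[N --> \oo] --> pospow 1 (w y) * expR (z y).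
    by apply: cvgM; [exact: cvg_cst|exact: exp_cvg].
  have [_ lim] := mulf_dct c1 f1M f1L cP PK Pc.
  have z0 : int_Rn (fun y => f1 y * (pospow 1 (w y) * expR (z y))) = 0.
    apply: (cvg_cst_eq (c := 0)); apply: cvg_trans lim; apply: near_eq_cvg; apply: nearW => N.
    rewrite (eq_int_Rn (G := fun y => \sum_(0 <= i < N) i`!%:R^-1 * (f1 y * (l y ^+ 0 * pospow 1 (w y) * z y ^+ i)))).
      have ai i : adm (fun y => f1 y * (l y ^+ 0 * pospow 1 (w y) * z y ^+ i)).
        by apply: aF; apply: scontM; [apply: scontM; [exact: scontX|exact: scont_pospow]|exact: scontX].
      rewrite int_Rn_sum; last by move=> i; exact: admZ.
      by rewrite big1// => i _; rewrite int_RnZ// Q mulr0.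
    move=> y; rewrite /P_ /series/= !mulr_sumr; apply: eq_bigr => i _.
    by rewrite /exp_coeff/= expr0; ring.
  rewrite (eq_int_Rn (G := fun y => expR kap * (f1 y * (pospow 1 (w y) * expR (z y))))).
    by rewrite int_RnZ ?z0 ?mulr0//; apply: aF; apply: scontM; [exact: scont_pospow|apply: (scont_comp (f := expR)) => //; exact: continuous_expR].
  by move=> y; rewrite hkE /F; ring.
move: F0 => /eqP; rewrite mulf_eq0 => /orP[/eqP//|]; rewrite /pospow expr1 max_r ?subr_ge0 ?ltW//.
by rewrite subr_eq0 => /eqP e; move: qB; rewrite -e ltxx.
Qed.

End Localization.

(** * Vanishing on a Euclidean ball; the set of null centres *)

Section Core.
Variables (R : realType) (n : nat).
Local Notation V := 'rV[R]_n.
Implicit Types (x y z u v p q : V).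

Lemma continuous_cutoff (b : R) : continuous (cutoff b).
Proof.
move=> a; have h : {for a, continuous (fun x : R => Num.max 0 (b + 1 - x))}.
  by apply: continuous_max; [exact: cst_continuous|apply: cvgB; [exact: cvg_cst|exact: cvg_id]].
have : {for a, continuous (fun x : R => Num.min 1 (Num.max 0 (b + 1 - x)))}.
  by apply: continuous_min; [exact: cst_continuous|exact: h].
exact.
Qed.

Lemma chain_support (f : V -> R) (N : set V) p q (rho : R) : scont f ->
  (forall x, N x -> forall b, 0 < b -> ballint f x b = 0) -> 0 < dN N p ->
  (forall l x, chain (fun y => ~ N y) p l x -> l < rho -> f x = 0) -> en (q - p) < rho -> f q = 0.
Proof.
move=> cf HN dNp H qr.
have e0 := en_ge0 (q - p).
have rho0 : 0 < rho := le_lt_trans e0 qr.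
pose rho' := (en (q - p) + rho) / 2.
have r'0 : 0 < rho' by rewrite divr_gt0// ltr_wpDl.
have r'r : rho' < rho by rewrite /rho'; lra.
have [r0 [C [r00 C0 HC]]] := heat_decay cf HN rho0 dNp H r'0 r'r.
move: HC; set L := (2 * rho + 4) ^+ 2; set f1 := trunc f p L => HC.
have c1 : scont f1 by exact: scont_trunc.
have [M M0 f1M] := trunc_bounded p L cf.
have f1L y : L + 1 < nsq (y - p) -> f1 y = 0 by move=> h; apply: trunc_eq0; exact: ltW.
pose chi y := cutoff 1 (nsq (y - p) / r0 ^+ 2).
have cchi : scont chi by exact: scont_bump.
have chiq y : 2 * r0 ^+ 2 < nsq (y - p) -> chi y = 0.
  move=> h; rewrite /chi cutoff_0// ler_pdivlMr ?exprn_gt0//; exact: ltW.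
have HD (Lam : R) : 1 <= Lam ->
    int_Rn (fun x => chi x * `|int_Rn (fun y => f1 y * expR (- (Lam * nsq (y - x))))|) <=
    C * expR (- (Lam * rho' ^+ 2)).
  move=> L1; have L0 : 0 < Lam := lt_le_trans ltr01 L1.
  (* The heat kernel at time s is exp(-Lam |.|^2) times s^(-n/2), and that factor is at least 1
     because s <= 1. *)
  pose s := (4 * Lam)^-1.
  have s0 : 0 < s by rewrite invr_gt0 mulr_gt0.
  have s1 : s <= 1 by rewrite invf_le1 ?mulr_gt0//; lra.
  have s4 a : a / (4 * s) = Lam * a by rewrite /s; field; rewrite gt_eqF.
  have := HC s s0 s1; rewrite s4; apply: le_trans.
  have aH (X : V -> R) : scont X -> adm (fun y => chi y * `|X y|).
    by move=> cX; apply: (adm_mulf cchi chiq); exact: scont_norm.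
  have ec : continuous (fun a : R => expR (- (Lam * a))).
    have h : continuous (fun a : R => - (Lam * a)).
      by move=> a; apply: cvgN; apply: cvgM; [exact: cvg_cst|exact: cvg_id].
    by move=> a; apply: (continuous_comp (h a)); exact: continuous_expR.
  have eb a : 0 <= a -> `|expR (- (Lam * a))| <= 1.
    move=> a0; rewrite ger0_norm ?expR_ge0// -[leRHS]expR0 ler_expR oppr_le0; apply: mulr_ge0 => //; exact: ltW.
  apply: le_int_Rn.
  - apply: aH; exact: (scont_radial_int c1 f1M f1L ec eb).
  - by apply: aH; apply: (scont_heat c1 f1L) => //; rewrite addr_ge0 ?sqr_ge0.
  - move=> x; apply: ler_wpM2l; first exact: cutoff_ge0.
    have E : heat f1 s x = expR (- (n%:R / 2 * ln s)) * int_Rn (fun y => f1 y * expR (- (Lam * nsq (y - x)))).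
      rewrite -int_RnZ; last first.
        apply: (adm_mulf c1 f1L); apply: (scont_comp (f := fun a => expR (- (Lam * a)))) => //.
        exact: scont_nsq.
      by rewrite /heat; apply: eq_int_Rn => y; rewrite /hk expRD s4; ring.
    rewrite E normrM ger0_norm ?expR_ge0// ler_peMl// -[leLHS]expR0 ler_expR oppr_ge0.
    by apply: mulr_ge0_le0; [exact: divr_ge0|exact: ln_le0].
have f1q : f1 q = 0.
  apply: (zero_ballint_near (r0 := r0) (B := rho' ^+ 2) c1 f1M f1L) => //.
    move=> x hx b b0 bB; apply: (gauss_decay_ballint c1 f1M f1L cchi _ _ chiq C0 HD) => //.
    - by move=> y; exact: cutoff_ge0.
    - by move=> y; exact: cutoff_le1.
    - by rewrite /chi cutoff_1// ler_pdivrMr ?exprn_gt0// mul1r ltW.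
  by rewrite -en_lt_nsq// /rho'; lra.
rewrite -f1q /f1 trunc_eq// -en_le_nsq; [lra|lra].
Qed.

Definition ball_null (f : V -> R) : set V := [set x | forall b : R, 0 < b -> ballint f x b = 0].

(** For a fixed radius the ball integral is continuous in its centre, so the null centres form a
    closed set. Truncation supplies the global bound that [scont_ballint] asks for. *)
Lemma dN_ball_null (f : V -> R) p : scont f -> ~ ball_null f p -> 0 < dN (ball_null f) p.
Proof.
move=> cf /existsNP[b /not_implyP[b0 /eqP hb]].
pose L := (Num.sqrt b + 1) ^+ 2.
have [M M0 fM] := trunc_bounded p L cf.
have cB : scont (fun x => ballint (trunc f p L) x b) by apply: scont_ballint; [exact: scont_trunc|exact: fM].
have s0 := sqrtr_ge0 b.
have E x : en (x - p) < 1 -> ballint (trunc f p L) x b = ballint f x b.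
  move=> hx; apply: eq_int_Rn => y; rewrite /ballfun; case: ltP => // hy.
  rewrite trunc_eq// -en_le_nsq; last by rewrite addr_ge0.
  have := en_split y x p; have : en (y - x) < Num.sqrt b by rewrite en_lt_nsq ?sqrtr_gt0// sqr_sqrtr// ltW.
  lra.
have c0 : 0 < `|ballint f p b| by rewrite normr_gt0.
have [d d0 hd] := scont_eps p cB c0.
pose m := Num.min 1 d.
have m0 : 0 < m by rewrite lt_min ltr01.
apply: (lt_le_trans m0); apply: dN_ge; first by rewrite ge_min lexx.
move=> z Nz; rewrite leNgt lt_min; apply/negP => /andP[h1 h2].
have zp : en (z - p) = en (p - z) by exact: enC.
have := hd z; rewrite !E ?subrr ?en0 ?zp// Nz// sub0r normrN ltxx => /(_ _)/notF; apply=> i.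
have := en_coord (z - p) i; rewrite !mxE zp => h; exact: le_lt_trans h h2.
Qed.

Lemma chain_cat (A : V -> Prop) p q l x l0 : chain A p l0 q -> chain A q l x -> chain A p (l0 + l) x.
Proof.
move=> h0; elim => [|l' x' y _ IH H]; first by rewrite addr0.
by rewrite addrA; apply: chainS.
Qed.

Section GaussLine.
Variables (F : V -> R) (M s : R) (v : V).
Hypotheses (cF : scont F) (FM : forall y, `|F y| <= M) (s0 : 0 < s).

Let m z := F z * hk n s (nsq z).

(** By the inequality B |v| |z| <= 2 s B^2 |v|^2 + |z|^2 / (8 s), half of the Gaussian exponent pays
    for the exponential. *)
Lemma gauss_exp_dominated (B A : R) : 0 <= B -> exists C, forall X : V -> R,
  (forall z, `|X z| <= A * expR (B * `|dot v z|)) -> dominated C (fun z => m z * X z).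
Proof.
move=> B0; have e1 : 0 < (8 * s)^-1 by rewrite invr_gt0 mulr_gt0.
have [C C0 HC] := @gauss_weight R n _ e1.
pose K := expR (- (n%:R / 2 * ln s)) * expR (2 * s * B ^+ 2 * nsq v).
exists (M * (A * (K * C))) => X XA z.
rewrite /m normrM normrM (_ : M * (A * (K * C)) * weight z = M * (A * (K * (C * weight z)))); last by ring.
rewrite -mulrA; apply: ler_pM => //.
have h0 : 0 <= hk n s (nsq z) by exact: expR_ge0.
rewrite (ger0_norm h0); apply: (@le_trans _ _ (hk n s (nsq z) * (A * expR (B * `|dot v z|)))).
  by apply: ler_wpM2l.
have A0 : 0 <= A.
  have := le_trans (normr_ge0 _) (XA 0); rewrite dotC dot0l normr0 mulr0 expR0 mulr1; exact.
rewrite mulrCA; apply: ler_wpM2l => //.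
apply: (@le_trans _ _ (K * expR (- ((8 * s)^-1 * nsq z)))); last first.
  by apply: ler_wpM2l; [rewrite mulr_ge0 ?expR_ge0|exact: HC].
rewrite /hk /K -!expRD ler_expR -!addrA lerD2l.
have h1 : `|dot v z| <= en v * en z by exact: en_dot.
have h2 := ler_wpM2l B0 h1.
have h3 := sqr_ge0 (4 * s * B * en v - en z).
have h4 : B * (en v * en z) <= 2 * s * B ^+ 2 * nsq v + (8 * s)^-1 * nsq z.
  rewrite -subr_ge0 -!en_sq.
  have -> : 2 * s * B ^+ 2 * en v ^+ 2 + (8 * s)^-1 * en z ^+ 2 - B * (en v * en z) =
    (8 * s)^-1 * (4 * s * B * en v - en z) ^+ 2 by field; rewrite gt_eqF.
  by apply: mulr_ge0 => //; exact: ltW.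
have h5 : nsq z / (4 * s) = 2 * ((8 * s)^-1 * nsq z) by field; rewrite gt_eqF.
rewrite h5; lra.
Qed.

Let kap := (2 * s)^-1.
Let H t := int_Rn (fun z => m z * expR (t * (kap * dot v z))).

Let kap0 : 0 < kap. Proof. by rewrite invr_gt0 mulr_gt0. Qed.
Let cm : scont m. Proof. by apply: scontM => //; exact: scont_hk0. Qed.
Let cdot : scont (fun z : V => kap * dot v z).
Proof.
apply: scontM; first exact: scont_cst.
move=> u x ux; have := @scont_dot R n v 0 u x ux; rewrite subr0.
by under eq_fun do rewrite subr0.
Qed.

Let pow_exp (a : R) k : 0 <= a -> a ^+ k <= k`!%:R * expR a.
Proof.
move=> a0; have := exp_partial_le k.+1 a0; rewrite big_nat_recr//= => h.
rewrite mulrC -ler_pdivrMr ?ltr0n ?fact_gt0//; apply: le_trans h.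
by rewrite lerDr sumr_ge0// => i _; exact: exp_coeff_ge0.
Qed.

Let adm_gauss (B A : R) (X : V -> R) : 0 <= B -> scont X ->
  (forall z, `|X z| <= A * expR (B * `|dot v z|)) -> adm (fun z => m z * X z).
Proof.
by move=> B0 cX XA; have [C HC] := gauss_exp_dominated A B0; apply: (adm_scont (HC X XA)); exact: scontM.
Qed.

(* [H] is entire, so its first nonzero Taylor coefficient at 0 isolates the zero. *)
Lemma gauss_line_isolated t1 : H t1 != 0 ->
  exists2 t0, 0 < t0 & forall t, 0 < t -> t <= t0 -> H t != 0.
Proof.
move=> Ht1.
pose u z := kap * dot v z.
have uE z : `|u z| = kap * `|dot v z| by rewrite normrM gtr0_norm.
pose c k := int_Rn (fun z => m z * u z ^+ k).
have aP k : adm (fun z => m z * u z ^+ k).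
  apply: (adm_gauss (B := kap) (A := k`!%:R) (ltW kap0)); first exact: scontX.
  by move=> z; rewrite normrX -uE; exact: pow_exp.
(* Otherwise the everywhere convergent Taylor series of [H] would give H(t1) = 0. *)
have ck : exists k, c k != 0.
  apply: contrapT => /forallNP hc; move/eqP: Ht1; apply.
  have [C HC] := gauss_exp_dominated 1 (mulr_ge0 (normr_ge0 t1) (ltW kap0)).
  pose P_ N z := m z * series (exp_coeff (t1 * u z)) N.
  have dP N : dominated C (P_ N).
    apply: HC => z; apply: le_trans (ler_norm_sum _ _ _) _.
    apply: (@le_trans _ _ (\sum_(0 <= i < N) exp_coeff `|t1 * u z| i)).
      by apply: ler_sum => i _; rewrite /exp_coeff/= normrM normrX (ger0_norm (_ : 0 <= _^-1))// invr_ge0.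
    by rewrite mul1r -mulrA -uE -normrM; apply: exp_partial_le.
  have cP N : scont (P_ N).
    apply: scontM => //; apply: scont_sum => i; apply: scontM; last exact: scont_cst.
    by apply: scontX; apply: scontM => //; exact: scont_cst.
  have lim z : P_ N z @[N --> \oo] --> m z * expR (t1 * u z).
    by apply: cvgM; [exact: cvg_cst|exact: exp_cvg].
  have [_ h] := int_dct dP (fun N => adm_scont (dP N) (cP N)) lim.
  apply: (cvg_cst_eq (c := 0)); apply: cvg_trans h; apply: near_eq_cvg; apply: nearW => N.
  rewrite (eq_int_Rn (G := fun z => \sum_(0 <= i < N) (t1 ^+ i / i`!%:R) * (m z * u z ^+ i))).
    rewrite int_Rn_sum; last by move=> i; exact: admZ.
    rewrite big1// => i _; rewrite int_RnZ//; have := hc i; rewrite -/(c i) => /negP; rewrite negbK => /eqP->.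
    by rewrite mulr0.
  by move=> z; rewrite /P_ /series/= mulr_sumr; apply: eq_bigr => i _; rewrite /exp_coeff/= [(_ * u z) ^+ i]exprMn; ring.
have [k ck0 kmin] := ex_minnP ck.
have cz i : (i < k)%N -> c i = 0.
  by move=> ik; apply/eqP; apply: contraLR ik => h; rewrite -leqNgt; exact: kmin.
pose D z := `|u z| ^+ k.+1 * expR `|u z|.
have cD : scont D.
  apply: scontM; first by apply: scontX; exact: scont_norm.
  by apply: (scont_comp (f := expR)); [exact: continuous_expR|exact: scont_norm].
have aD : adm (fun z => `|m z| * D z).
  have [C HC] := gauss_exp_dominated (k.+1)`!%:R (mulr_ge0 (ler0n R 2) (ltW kap0)).
  have DB z : `|D z| <= (k.+1)`!%:R * expR (2 * kap * `|dot v z|).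
    have -> : expR (2 * kap * `|dot v z|) = expR `|u z| * expR `|u z|.
      by rewrite -expRD uE; congr expR; ring.
    rewrite mulrA ger0_norm; last by rewrite mulr_ge0 ?exprn_ge0 ?expR_ge0.
    by apply: ler_wpM2r; [exact: expR_ge0|exact: pow_exp].
  apply: (@adm_scont _ _ C); last by apply: scontM => //; exact: scont_norm.
  by move=> z; rewrite normrM normr_id -normrM; exact: HC.
pose K := int_Rn (fun z => `|m z| * D z).
have K0 : 0 <= K.
  apply: int_Rn_ge0 => z; apply: mulr_ge0 => //; apply: mulr_ge0; [exact: exprn_ge0|exact: expR_ge0].
have kf : 0 < k`!%:R :> R by rewrite ltr0n fact_gt0.
(* For such t the remainder t^(k+1) K is smaller than the leading term t^k |c k| / k!. *)
exists (Num.min 1 (`|c k| / k`!%:R / (K + 1) / 2)).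
  by rewrite lt_min ltr01 !divr_gt0 ?normr_gt0// ltr_wpDl.
move=> t tp; rewrite le_min => /andP[t1' tK].
have aH : adm (fun z => m z * expR (t * u z)).
  apply: (adm_gauss (B := kap) (A := 1) (ltW kap0)).
    apply: (scont_comp (f := expR)); first exact: continuous_expR.
    by apply: scontM => //; exact: scont_cst.
  move=> z; rewrite mul1r ger0_norm ?expR_ge0// ler_expR -uE; apply: le_trans (ler_norm _) _.
  by rewrite normrM ler_piMl// gtr0_norm.
have aS : adm (fun z => m z * \sum_(0 <= i < k.+1) exp_coeff (t * u z) i).
  apply: eq_adm (adm_sum (F := fun i z => (t ^+ i / i`!%:R) * (m z * u z ^+ i)) (index_iota 0 k.+1) _).
    by move=> z; rewrite mulr_sumr; apply: eq_bigr => i _; rewrite /exp_coeff/= [(_ * u z) ^+ i]exprMn; ring.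
  by move=> i; exact: admZ.
have main : `|H t - t ^+ k / k`!%:R * c k| <= t ^+ k.+1 * K.
  have -> : t ^+ k / k`!%:R * c k = int_Rn (fun z => m z * \sum_(0 <= i < k.+1) exp_coeff (t * u z) i).
    rewrite (eq_int_Rn (G := fun z => \sum_(0 <= i < k.+1) (t ^+ i / i`!%:R) * (m z * u z ^+ i))).
      rewrite int_Rn_sum; last by move=> i; exact: admZ.
      rewrite big_nat_recr//= big_nat big1 ?add0r ?int_RnZ// => i ik.
      by rewrite int_RnZ// -/(c i) cz ?mulr0.
    by move=> z; rewrite mulr_sumr; apply: eq_bigr => i _; rewrite /exp_coeff/= [(_ * u z) ^+ i]exprMn; ring.
  rewrite /H -int_RnB// -int_RnZ//; apply: le_norm_int; [exact: admB|exact: admZ|].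
  move=> z; rewrite -mulrBr normrM [leRHS]mulrCA; apply: ler_wpM2l => //.
  apply: le_trans (exp_taylor _ _) _; rewrite /D normrM exprMn gtr0_norm// -mulrA.
  apply: ler_wpM2l; first by apply: exprn_ge0; exact: ltW.
  apply: ler_wpM2l; first exact: exprn_ge0.
  by rewrite ler_expR ler_piMl.
apply/negP => /eqP H0; move: main; rewrite H0 sub0r normrN normrM ger0_norm; last first.
  by rewrite divr_ge0// exprn_ge0// ltW.
rewrite exprSr -!mulrA ler_pM2l ?exprn_gt0// => h.
have c0 : 0 < `|c k| by rewrite normr_gt0.
have K1 : 0 < K + 1 by rewrite ltr_wpDl.
move: tK; rewrite ler_pdivlMr// ler_pdivlMr// => h2.
move: h h2; rewrite [_^-1 * _]mulrC; set w := `|c k| / _ => h h2.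
have w0 : 0 < w by exact: divr_gt0.
lra.
Qed.

End GaussLine.

(** The Gaussian is cut off at growing radii to become a profile that [radial_kernel0] accepts; the
    bound on f then allows the cutoff to be removed. *)
Lemma ball_null_gauss (f : V -> R) M x s : scont f -> (forall y, `|f y| <= M) -> 0 < s ->
  ball_null f x -> int_Rn (fun z => f (z + x) * hk n s (nsq z)) = 0.
Proof.
move=> cf fM s0 Nx.
have [[C dC] _] := @adm_hk R n s s0.
pose F_ (j : nat) z := f (z + x) * (hk n s (nsq z) * cutoff j%:R (nsq z)).
have dF j : dominated (M * C) (F_ j).
  move=> z; rewrite normrM -mulrA; apply: ler_pM => //; apply: le_trans (dC z).
  rewrite normrM ler_piMr// ger0_norm ?cutoff_ge0// cutoff_le1//.
have cn : scont (fun z : V => nsq z).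
  move=> u y uy; have := @scont_nsq R n 0 u y uy; rewrite subr0.
  by under eq_fun do rewrite subr0.
have cF j : scont (F_ j).
  apply: scontM; first exact: scont_shift.
  by apply: scontM; [exact: scont_hk0|exact: scont_cutoff].
have lim z : F_ j z @[j --> \oo] --> f (z + x) * hk n s (nsq z).
  apply: cvg_near_cst; near=> j; rewrite /F_ cutoff_1 ?mulr1//.
  by near: j; exact: nbhs_infty_ger.
have [_ h] := int_dct dF (fun j => adm_scont (dF j) (cF j)) lim.
apply: (cvg_cst_eq (c := 0)); apply: cvg_trans h; apply: near_eq_cvg; apply: nearW => j.
pose k a := hk n s a * cutoff j%:R a.
have ck : continuous k.
  by move=> a; apply: cvgM; [exact: hk_cont|exact: continuous_cutoff].
have B0 : 0 < j%:R + 1 :> R by rewrite ltr_wpDl.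
have k0 a : j%:R + 1 <= a -> k a = 0 by move=> ha; rewrite /k cutoff_0// mulr0.
have := radial_kernel0 B0 cf ck k0 (fun b b0 _ => Nx b b0) => <-.
have aK : adm (fun y => f y * k (nsq (y - x))).
  apply: eq_adm (adm_shift (- x) (adm_scont (dF j) (cF j))) => y.
  by rewrite /F_ subrK.
by rewrite -(int_shift x aK); apply: eq_int_Rn => y; rewrite addrK.
Unshelve. all: by end_near. Qed.

(** Completing the square turns the Gaussian average at p + t v into a positive factor times the
    function of [gauss_line_isolated]. With v = x0 - p the time t = 1 reaches x0, where some
    Gaussian average is nonzero. *)
Lemma ball_null_isolated (f : V -> R) M p x0 : scont f -> (forall y, `|f y| <= M) -> f x0 != 0 ->
  exists v, exists2 t0 : R, 0 < t0 & forall t, 0 < t -> t <= t0 -> ~ ball_null f (p + t *: v).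
Proof.
move=> cf fM fx0.
have [s s0 Gs] : exists2 s, 0 < s & int_Rn (fun z => f (z + x0) * hk n s (nsq z)) != 0.
  apply: contrapT => h; move/eqP: fx0; apply; apply: (gauss_eq0 cf fM) => s s0.
  by apply/eqP; apply: contrapT => /negP h'; apply: h; exists s.
pose v := x0 - p.
pose F y := f (y + p).
have cF : scont F by exact: scont_shift.
have FM y : `|F y| <= M by exact: fM.
have E t : int_Rn (fun z => f (z + (p + t *: v)) * hk n s (nsq z)) = expR (- (t ^+ 2 * nsq v / (4 * s))) *
    int_Rn (fun z => F z * hk n s (nsq z) * expR (t * ((2 * s)^-1 * dot v z))).
  have cX : scont (fun z : V => expR (t * ((2 * s)^-1 * dot v z))).
    apply: (scont_comp (f := expR)); first exact: continuous_expR.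
    apply: scontM; first exact: scont_cst.
    apply: scontM; first exact: scont_cst.
    move=> u x ux; have := @scont_dot R n v 0 u x ux; rewrite subr0.
    by under eq_fun do rewrite subr0.
  have k0 : 0 <= `|t| * (2 * s)^-1 by rewrite mulr_ge0// invr_ge0 mulr_ge0// ltW.
  have [C HC] := gauss_exp_dominated v FM s0 1 k0.
  have aX : adm (fun z => F z * hk n s (nsq z) * expR (t * ((2 * s)^-1 * dot v z))).
    apply: (@adm_scont _ _ C); last by apply: scontM => //; apply: scontM => //; exact: scont_hk0.
    apply: HC => z; rewrite mul1r ger0_norm ?expR_ge0// ler_expR; apply: le_trans (ler_norm _) _.
    by rewrite !normrM mulrA (ger0_norm (_ : 0 <= (2 * s)^-1))// invr_ge0 mulr_ge0// ltW.
  rewrite -int_RnZ//.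
  have e1 z : expR (- (t ^+ 2 * nsq v / (4 * s))) * (F z * hk n s (nsq z) * expR (t * ((2 * s)^-1 * dot v z))) =
     F z * hk n s (nsq (z - t *: v)).
    have -> : hk n s (nsq (z - t *: v)) = expR (- (t ^+ 2 * nsq v / (4 * s))) * hk n s (nsq z) * expR (t * ((2 * s)^-1 * dot v z)).
      rewrite /hk -!expRD; congr expR.
      by rewrite (nsqB z) dotZr nsqZ (dotC z); field; rewrite gt_eqF.
    by ring.
  have aS : adm (fun z => F z * hk n s (nsq (z - t *: v))) by exact: eq_adm e1 (admZ _ aX).
  rewrite (eq_int_Rn e1) -(int_shift (t *: v) aS).
  by apply: eq_int_Rn => z; rewrite addrK /F addrAC addrA.
have [|t0 t00 Ht0] := @gauss_line_isolated F M s v cF FM s0 1.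
  apply: contra Gs => /eqP h; have := E 1; rewrite h mulr0 scale1r /v addrC subrK => ->.
  exact: eqxx.
exists v; exists t0 => // t tp tt0 Nt.
have := ball_null_gauss cf fM s0 Nt; rewrite E => /eqP; rewrite mulf_eq0 gt_eqF ?expR_gt0//=.
by rewrite (negbTE (Ht0 t tp tt0)).
Qed.

End Core.

(** * Paths *)

Section Pieces.
Variable R : realType.
Local Notation mu := (@lebesgue_measure R).
Implicit Types (h phi : R -> R) (a b : R).

Lemma integrable_setU_disj (A B : set R) h : measurable A -> measurable B -> [disjoint A & B] ->
  mu.-integrable A (EFin \o h) -> mu.-integrable B (EFin \o h) -> mu.-integrable (A `|` B) (EFin \o h).
Proof.
move=> mA mB AB /integrableP[mfA iA] /integrableP[mfB iB].
have mU : measurable_fun (A `|` B) (EFin \o h) by apply/measurable_funU.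
apply/integrableP; split => //.
rewrite ge0_integral_setU//; first exact: lte_add_pinfty.
by apply: measurableT_comp.
Qed.

Lemma integrable_pt h b : mu.-integrable [set b] (EFin \o h).
Proof.
apply/integrableP; split; first exact: measurable_fun_set1.
by rewrite integral_set1.
Qed.

(** Open pieces only: at the breakpoints the derivative of a path has no meaningful value, and
    single points are null. *)
Lemma integrable_pieces h (t : nat -> R) k : (forall i, (i < k)%N -> t i < t i.+1) ->
  (forall i, (i < k)%N -> mu.-integrable `]t i, t i.+1[ (EFin \o h)) ->
  mu.-integrable `[t 0%N, t k] (EFin \o h) /\
  Rintegral mu `[t 0%N, t k] h = \sum_(i < k) Rintegral mu `]t i, t i.+1[ h.
Proof.
elim: k => [_ _|k IH tlt ih].
  by rewrite set_itv1 big_ord0 Rintegral_set1; split => //; exact: integrable_pt.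
have [i1 e1] := IH (fun i ik => tlt i (leqW ik)) (fun i ik => ih i (leqW ik)).
have t0k : t 0%N <= t k.
  elim: k {IH ih i1 e1} tlt => [//|k IH] tlt.
  by apply: le_trans (IH (fun i ik => tlt i (leqW ik))) _; apply: ltW; apply: tlt; rewrite ltnS leqnSn.
have ik := ih k (ltnSn k); have tk := tlt k (ltnSn k).
have oc : `]t k, t k.+1]%classic = `]t k, t k.+1[%classic `|` [set t k.+1] :> set R.
  apply/seteqP; split=> x /=; rewrite !in_itv/=.
    case/andP=> h1; rewrite le_eqVlt => /predU1P[->|h2]; [by right|by left; rewrite h1].
  by case=> [/andP[-> /ltW//]| ->]; rewrite tk lexx.
have dj : [disjoint `]t k, t k.+1[%classic & [set t k.+1]].
  rewrite disj_set2E; apply/eqP/seteqP; split => // x [/=]; rewrite in_itv/= => /andP[_ h1] e.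
  by move: h1; rewrite e ltxx.
have ioc : mu.-integrable `]t k, t k.+1] (EFin \o h).
  by rewrite oc; apply: integrable_setU_disj => //; exact: integrable_pt.
have U : `[t 0%N, t k.+1]%classic = `[t 0%N, t k]%classic `|` `]t k, t k.+1]%classic :> set R.
  by rewrite -itv_bndbnd_setU// bnd_simp// ltW.
have dj2 : [disjoint `[t 0%N, t k]%classic & `]t k, t k.+1]%classic].
  rewrite disj_set2E; apply/eqP/seteqP; split => // x [/=]; rewrite !in_itv/= => /andP[_ h1] /andP[h2 _].
  by have := le_lt_trans h1 h2; rewrite ltxx.
have iU : mu.-integrable `[t 0%N, t k.+1] (EFin \o h) by rewrite U; exact: integrable_setU_disj.
split => //; rewrite U Rintegral_setU -?U// e1 big_ord_recr/=; congr (_ + _).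
by rewrite -Rintegral_itv_bndo_bndc.
Qed.

(** A piecewise C^1 path provides one-sided limits of its derivative; replacing the end values by
    them gives a function to which the fundamental theorem on a closed interval applies. *)
Lemma oo_extension h a b : a < b -> {in `]a, b[, continuous h} -> cvg (h @ a^'+) -> cvg (h @ b^'-) ->
  exists2 h', {within `[a, b], continuous h'} & {in `]a, b[, h' =1 h}.
Proof.
move=> ab ch ca cb.
pose h' x := if x == a then lim (h @ a^'+) else if x == b then lim (h @ b^'-) else h x.
have E : {in `]a, b[, h' =1 h}.
  by move=> x; rewrite in_itv/= => /andP[ax xb]; rewrite /h' gt_eqF// lt_eqF.
exists h' => //; apply/continuous_within_itvP => //; split.
- move=> x xab; have := ch x xab; rewrite /continuous_at E//; apply: cvg_trans.
  apply: near_eq_cvg; have := near_in_itvoo xab; apply: filterS => y yab.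
  by rewrite E.
- rewrite {2}/h' eqxx; apply: cvg_trans ca; apply: near_eq_cvg; near=> x.
  by rewrite E// in_itv/=; apply/andP; split; near: x; [exact: nbhs_right_gt|exact: nbhs_right_lt].
- rewrite {2}/h' eqxx (gt_eqF ab); apply: cvg_trans cb; apply: near_eq_cvg; near=> x.
  by rewrite E// in_itv/=; apply/andP; split; near: x; [exact: nbhs_left_gt|exact: nbhs_left_lt].
Unshelve. all: by end_near. Qed.

Lemma integrable_oo h a b : a < b -> {in `]a, b[, continuous h} -> cvg (h @ a^'+) -> cvg (h @ b^'-) ->
  mu.-integrable `]a, b[ (EFin \o h).
Proof.
move=> ab ch ca cb; have [h' ch' E] := oo_extension ab ch ca cb.
have i' : mu.-integrable `]a, b[ (EFin \o h').
  apply: (@integrableS _ _ _ mu `[a, b]) => //; first exact: subset_itv_oo_cc.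
  by apply: continuous_compact_integrable => //; exact: segment_compact.
by apply: eq_integrable i' => // x /set_mem xab /=; rewrite E.
Qed.

Lemma FTC_oo h phi a b : a < b -> {in `]a, b[, continuous h} -> cvg (h @ a^'+) -> cvg (h @ b^'-) ->
  (forall x, x \in `]a, b[ -> is_derive x 1 phi (h x)) -> {within `[a, b], continuous phi} ->
  Rintegral mu `]a, b[ h = phi b - phi a.
Proof.
move=> ab ch ca cb dphi /continuous_within_itvP-/(_ ab)[_ pa pb].
have [h' ch' E] := oo_extension ab ch ca cb.
have D : derivable_oo_LRcontinuous phi a b.
  by split; [move=> x xab; have [] := dphi x xab|exact: pa|exact: pb].
have D' : {in `]a, b[, derive1 phi =1 h'}.
  by move=> x xab; rewrite derive1E E//; have [_ ->] := dphi x xab.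
have := continuous_FTC2 ab ch' D D'; rewrite -EFinB => I.
have i' : mu.-integrable `[a, b] (EFin \o h').
  by apply: continuous_compact_integrable => //; exact: segment_compact.
have -> : Rintegral mu `]a, b[ h = Rintegral mu `]a, b[ h'.
  by apply: eq_Rintegral => x /set_mem xab; rewrite E.
rewrite /Rintegral -(integral_itv_bndoo true false).
  by rewrite I.
have := measurable_int _ i'; apply: measurable_funS => //; exact: subset_itv_oo_cc.
Qed.

End Pieces.

Section Paths.
Variables (R : realType) (n : nat).
Local Notation V := 'rV[R]_n.
Local Notation mu := (@lebesgue_measure R).

(** Projection to the unit vector along g(1) - g(0) reduces the claim to the fundamental theorem for
    a scalar function on each piece. *)
Lemma path_length_ge (g : R -> V) : piecewise_C1 g -> en (g 1 - g 0) <= path_length g.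
Proof.
move=> [cg [k [t [t0 tk tlt tC]]]].
have dotc u : continuous (fun y : V => dot u y).
  apply: scont_continuous => v x vx; have := @scont_dot R n u 0 v x vx; rewrite subr0.
  by under eq_fun do rewrite subr0.
have enc : continuous (fun y : V => en y).
  apply: scont_continuous => v x vx; have := @scont_en R n 0 v x vx; rewrite subr0.
  by under eq_fun do rewrite subr0.
have tle i j : (i <= j)%N -> (j <= k)%N -> t i <= t j.
  elim: j => [|j IH]; first by rewrite leqn0 => /eqP->.
  rewrite leq_eqVlt => /predU1P[->//|ij] jk.
  by apply: le_trans (IH ij (ltnW jk)) _; exact: ltW (tlt j jk).
set w := g 1 - g 0.
have plE : path_length g = Rintegral mu `[t 0%N, t k] (fun x => en (derive1 g x)).
  by rewrite t0 tk /path_length; under eq_Rintegral do rewrite e2normE.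
have [w0|wn0] := eqVneq (en w) 0.
  by rewrite w0 plE; apply: Rintegral_ge0 => x _; exact: en_ge0.
have wp : 0 < en w by rewrite lt_neqAle eq_sym wn0 en_ge0.
pose u := (en w)^-1 *: w.
have uw : dot u w = en w by rewrite dotZl -/(nsq w) -en_sq expr2 mulrA mulVf ?mul1r.
have u1 : en u = 1 by rewrite enZ gtr0_norm ?invr_gt0// mulVf.
have comp (F : V -> R) i : continuous F -> (i < k)%N ->
    [/\ {in `]t i, t i.+1[, continuous (fun x => F (derive1 g x))},
        cvg ((fun x => F (derive1 g x)) @ (t i)^'+) & cvg ((fun x => F (derive1 g x)) @ (t i.+1)^'-)].
  move=> cF ik; have [_ c1 /cvg_ex[l hl] /cvg_ex[r hr]] := tC i ik; split.
  - move=> x xi; apply: continuous_comp; [exact: c1|exact: cF].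
  - by apply/cvg_ex; exists (F l); apply: continuous_cvg hl; exact: cF.
  - by apply/cvg_ex; exists (F r); apply: continuous_cvg hr; exact: cF.
have int i (ik : (i < k)%N) : mu.-integrable `]t i, t i.+1[ (EFin \o (fun x => en (derive1 g x))).
  by have [] := comp _ i enc ik; apply: integrable_oo; exact: tlt.
have [_ E] := integrable_pieces tlt int.
rewrite plE E -uw.
have -> : dot u w = \sum_(i < k) (dot u (g (t i.+1)) - dot u (g (t i))).
  rewrite -(big_mkord xpredT (fun i => dot u (g (t i.+1)) - dot u (g (t i)))) telescope_sumr//.
  by rewrite t0 tk /w dotDr dotNr.
apply: ler_sum => i _; have ik := ltn_ord i.
have [h1 h2 h3] := comp _ i (dotc u) ik.
have F : Rintegral mu `]t i, t i.+1[ (fun x => dot u (derive1 g x)) = dot u (g (t i.+1)) - dot u (g (t i)).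
  apply: (FTC_oo (tlt i ik) h1 h2 h3 (phi := fun x => dot u (g x))).
    move=> x; rewrite in_itv/= => xi; have [dg _ _ _] := tC i ik.
    have := dg x xi; rewrite derive1E => dgx.
    have L : (fun h => h^-1 *: (dot u (g (h *: 1 + x)) - dot u (g x))) @ 0^' --> dot u ('D_1 g x).
      have : (fun h => dot u (h^-1 *: (g (h *: 1 + x) - g x))) @ 0^' --> dot u ('D_1 g x).
        by apply: continuous_cvg dgx; exact: dotc.
      apply: cvg_trans; apply: near_eq_cvg; apply: nearW => h.
      by rewrite dotZr dotDr dotNr.
    by split; [apply/cvg_ex; eexists; exact: L|exact/cvg_lim].
  have sub : {within `[t i, t i.+1], continuous g}.
    apply: continuous_subspaceW cg => x /=; rewrite !in_itv/= => /andP[h4 h5].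
    rewrite -t0 -tk (le_trans (tle 0%N i _ _) h4) ?(ltnW ik)//=.
    by apply: le_trans h5 _; exact: tle.
  by move=> x; apply: continuous_comp; [exact: sub|exact: dotc].
rewrite -F; apply: le_Rintegral => //.
- exact: integrable_oo (tlt i ik) h1 h2 h3.
- exact: int.
- move=> x _; apply: le_trans (ler_norm _) _.
  by have := en_dot u (derive1 g x); rewrite u1 mul1r.
Qed.

Lemma dist_le_dist_S (S A : set V) p : (dist p A <= dist_S S p A)%E.
Proof.
apply: le_ereal_inf_tmp => _ [g [pg g0 Ag _] <-].
apply: le_trans (_ : ((e2norm (p - g 1))%:E <= _)%E).
  by apply: ereal_inf_lbound; exists (g 1).
by rewrite lee_fin e2normE enC -g0; exact: path_length_ge.
Qed.

End Paths.

(** * Chains as piecewise C^1 paths *)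

Section Polygon.
Variables (R : realType) (n : nat).
Local Notation V := 'rV[R]_n.
Local Notation mu := (@lebesgue_measure R).
Implicit Types (A : V -> Prop).

(** At least one segment is produced, since [polygon] divides the unit interval by their number; the
    empty chain becomes a degenerate segment, and for this [A p] is needed. *)
Lemma chain_vertices A (p : V) l x : A p -> chain A p l x -> exists k (xs : nat -> V),
  [/\ xs 0%N = p, xs k.+1 = x, l = \sum_(i < k.+1) en (xs i.+1 - xs i) &
   forall i (t : R), (i < k.+1)%N -> 0 <= t -> t <= 1 -> A (xs i + t *: (xs i.+1 - xs i))].
Proof.
move=> Ap; elim => [|l' x' y _ [k [xs [e0 e1 e2 H]]] Hy].
  exists 0%N, (fun=> p); split => //; first by rewrite big_ord1 subrr en0.
  by move=> i t _ _ _; rewrite subrr scaler0 addr0.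
exists k.+1, (fun i => if (i <= k.+1)%N then xs i else y); split => //.
- by rewrite ltnn.
- rewrite big_ord_recr/= leqnn ltnn e1 e2; congr (_ + _).
  by apply: eq_bigr => i _; rewrite ltn_ord (ltnW (ltn_ord i)).
- move=> i t it t0 t1; have [ik|ik] := ltnP i k.+1; first by rewrite (ltnW ik); exact: H.
  have -> : i = k.+1 by apply/eqP; rewrite eqn_leq ik andbT -ltnS.
  by rewrite leqnn e1; exact: Hy.
Qed.

Definition clamp01 (a : R) := Num.min 1 (Num.max 0 a).

Lemma clamp01_0 a : a <= 0 -> clamp01 a = 0.
Proof. by move=> h; rewrite /clamp01 max_l// min_r. Qed.
Lemma clamp01_1 a : 1 <= a -> clamp01 a = 1.
Proof. by move=> h; rewrite /clamp01 max_r ?min_l// (le_trans ler01). Qed.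
Lemma clamp01_id a : 0 <= a -> a <= 1 -> clamp01 a = a.
Proof. by move=> h0 h1; rewrite /clamp01 max_r// min_r. Qed.

Lemma clamp01_continuous : continuous clamp01.
Proof.
move=> a; have h : {for a, continuous (fun x : R => Num.max 0 x)}.
  by apply: continuous_max; [exact: cst_continuous|exact: cvg_id].
have : {for a, continuous (fun x : R => Num.min 1 (Num.max 0 x))}.
  by apply: continuous_min; [exact: cst_continuous|exact: h].
exact.
Qed.

Variables (k : nat) (xs : nat -> V).
Let K : R := k.+1%:R.
Let w i := xs i.+1 - xs i.

(** A sum of clamped ramps instead of a case distinction on the piece: continuity is then immediate,
    and [polygonE] recovers the affine formulas. *)
Definition polygon (t : R) : V :=
  xs 0%N + \sum_(0 <= i < k.+1) clamp01 (K * t - i%:R) *: w i.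

Lemma polygonE i t : (i <= k)%N -> i%:R <= K * t -> K * t <= i.+1%:R ->
  polygon t = xs i + (K * t - i%:R) *: w i.
Proof.
move=> ik h1 h2; rewrite /polygon (@big_cat_nat _ _ _ i)//=; last exact: leqW.
rewrite (big_ltn (m := i))// clamp01_id; [|by rewrite subr_ge0|by rewrite lerBlDr nat1r].
rewrite [X in _ + (_ + (_ + X))]big_nat [X in _ + (_ + (_ + X))]big1; last first.
  move=> j /andP[ij _]; rewrite clamp01_0 ?scale0r// subr_le0 (le_trans h2)// ler_nat//.
rewrite addr0 addrA; congr (_ + _).
rewrite big_nat (eq_bigr (fun j => w j)); last first.
  move=> j /andP[_ ji]; rewrite clamp01_1 ?scale1r// lerBrDr (le_trans _ h1)//.
  by rewrite nat1r ler_nat.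
by rewrite -big_nat telescope_sumr// addrC subrK.
Qed.

Let K0 : 0 < K. Proof. by rewrite ltr0n. Qed.

Lemma polygon_continuous : continuous polygon.
Proof.
have H m : continuous (fun t : R => \sum_(0 <= i < m) clamp01 (K * t - i%:R) *: w i).
  elim: m => [|m IH] t.
    by under [X in continuous_at t X]eq_fun do rewrite big_geq//; exact: cvg_cst.
  under [X in continuous_at t X]eq_fun do rewrite big_nat_recr//.
  apply: cvgD; first exact: IH.
  apply: cvgZl; apply: (continuous_comp (f := fun t : R => K * t - m%:R)); last exact: clamp01_continuous.
  by apply: cvgB; [apply: cvgM; [exact: cvg_cst|exact: cvg_id]|exact: cvg_cst].
by move=> t; apply: cvgD; [exact: cvg_cst|exact: H].
Qed.

Let tt (i : nat) : R := i%:R / K.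

Let in_piece i x : x \in `]tt i, tt i.+1[ -> i%:R < K * x /\ K * x < i.+1%:R.
Proof.
by rewrite in_itv/= => /andP[h1 h2]; rewrite -ltr_pdivrMl// mulrC h1 -ltr_pdivlMl// mulrC.
Qed.

Lemma polygon_derive i x : (i <= k)%N -> x \in `]tt i, tt i.+1[ -> is_derive x 1 polygon (K *: w i).
Proof.
move=> ik xi.
apply: (@near_eq_is_derive _ _ _ (fun y : R => xs i + (K * y - i%:R) *: w i)).
  have := near_in_itvoo xi; apply: filterS => y /in_piece[h1 h2].
  by rewrite (polygonE ik (ltW h1) (ltW h2)).
have L : (fun h => h^-1 *: ((xs i + (K * (h *: 1 + x) - i%:R) *: w i) - (xs i + (K * x - i%:R) *: w i))) @ 0^' --> K *: w i.
  apply: cvg_near_cst; near=> h.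
  have h0 : h != 0 by near: h; exact: nbhs_dnbhs_neq.
  rewrite opprD addrACA subrr add0r -scalerBl scalerA; congr (_ *: _).
  by rewrite [h *: 1]mulr1; field.
by split; [apply/cvg_ex; eexists; exact: L|exact/cvg_lim].
Unshelve. all: by end_near. Qed.

Let derive1_polygon i x : (i <= k)%N -> x \in `]tt i, tt i.+1[ -> derive1 polygon x = K *: w i.
Proof. by move=> ik xi; rewrite derive1E; have [_ ->] := polygon_derive ik xi. Qed.

Let tlt i : tt i < tt i.+1.
Proof. by rewrite ltr_pM2r ?invr_gt0// ltr_nat. Qed.

Lemma polygon_piecewise_C1 : piecewise_C1 polygon.
Proof.
split; first exact/continuous_subspaceT/polygon_continuous.
exists k.+1, tt; split.
- by rewrite /tt mul0r.
- by rewrite /tt divff// gt_eqF.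
- by move=> i _; exact: tlt.
- move=> i; rewrite ltnS => ik; split.
  + by move=> x xi; have [] := polygon_derive ik (x := x); rewrite ?in_itv.
  + move=> x xi; rewrite /continuous_at (derive1_polygon ik xi); apply: cvg_near_cst.
    by have := near_in_itvoo xi; apply: filterS => y; exact: derive1_polygon.
  + apply/cvg_ex; exists (K *: w i); apply: cvg_near_cst; near=> x.
    apply: derive1_polygon => //; rewrite in_itv/=; apply/andP.
    by split; near: x; [exact: nbhs_right_gt|exact: nbhs_right_lt].
  + apply/cvg_ex; exists (K *: w i); apply: cvg_near_cst; near=> x.
    apply: derive1_polygon => //; rewrite in_itv/=; apply/andP.
    by split; near: x; [exact: nbhs_left_gt|exact: nbhs_left_lt].
Unshelve. all: by end_near. Qed.

Lemma polygon_length : path_length polygon = \sum_(i < k.+1) en (w i).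
Proof.
have E i x : (i < k.+1)%N -> x \in `]tt i, tt i.+1[ -> e2norm (derive1 polygon x) = K * en (w i).
  by move=> ik xi; rewrite (derive1_polygon _ xi)// e2normE enZ gtr0_norm.
have int i : (i < k.+1)%N -> mu.-integrable `]tt i, tt i.+1[ (EFin \o (fun x => e2norm (derive1 polygon x))).
  move=> ik; have : mu.-integrable `]tt i, tt i.+1[ (EFin \o cst (K * en (w i))).
    apply: integrable_oo => //; last by apply: is_cvg_cst.
      by move=> x _; exact: cst_continuous.
    exact: is_cvg_cst.
  by apply: eq_integrable => // x /set_mem xi /=; rewrite (E i).
have [_ I] := integrable_pieces (fun i _ => tlt i) int.
have -> : path_length polygon = Rintegral mu `[tt 0%N, tt k.+1] (fun x => e2norm (derive1 polygon x)).
  by rewrite /tt mul0r divff ?gt_eqF.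
rewrite I; apply: eq_bigr => i _.
have -> : Rintegral mu `]tt i, tt i.+1[ (fun x => e2norm (derive1 polygon x)) = Rintegral mu `]tt i, tt i.+1[ (cst (K * en (w i))).
  by apply: eq_Rintegral => x /set_mem xi; rewrite (E i)//= ltn_ord.
have ml : (lebesgue_measure (`]tt i, tt i.+1[%classic : set R) = (tt i.+1 - tt i)%:E :> \bar R)%E.
  by rewrite lebesgue_measure_itv/= lte_fin tlt -EFinB.
apply: (eq_trans (Rintegral_cst mu (measurable_itv _) _)).
rewrite [X in fine X](_ : _ = (tt i.+1 - tt i)%:E); last exact: ml.
rewrite /=.
by rewrite /tt -mulrBl -natr1 addrAC subrr add0r mul1r mulrAC divff ?mul1r// gt_eqF.
Qed.

End Polygon.

Section ChainDist.
Variables (R : realType) (n : nat).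
Local Notation V := 'rV[R]_n.

Lemma dist_S_le_chain (S A : set V) p x l : ~ S p -> chain (fun y => ~ S y) p l x -> A x ->
  (dist_S S p A <= l%:E)%E.
Proof.
move=> Sp hc Ax; have [k [xs [e0 e1 el H]]] := chain_vertices Sp hc.
have K0 : 0 < k.+1%:R :> R by rewrite ltr0n.
apply: ereal_inf_lbound; exists (polygon k xs); last by rewrite polygon_length -el.
split.
- exact: polygon_piecewise_C1.
- by rewrite (@polygonE _ _ k xs 0%N)// ?mulr0// subr0 scale0r addr0.
- rewrite (@polygonE _ _ k xs k)// ?mulr1 ?ler_nat//.
  by rewrite -natr1 addrAC subrr add0r scale1r addrC subrK e1.
- move=> t /andP[t0 t1]; set y := k.+1%:R * t.
  have y0 : 0 <= y by rewrite mulr_ge0// ltW.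
  have /andP[h1 h2] := truncn_itv y0.
  have ik : (Num.truncn y <= k)%N.
    rewrite -ltnS -(ltr_nat R); apply: le_lt_trans h1 _.
    by rewrite -[ltRHS]mulr1 ltr_pM2l.
  rewrite (polygonE xs ik h1 (ltW h2)); apply: H; rewrite ?ltnS// ?subr_ge0//.
  by rewrite lerBlDr nat1r ltW.
Qed.

(** If the distances differ, choose rho above |p - a| for some support point a and at most [dist_S],
    which may be infinite. Chains shorter than rho miss the support, so f vanishes on B(p, rho), a
    neighbourhood of a. *)
Lemma dist_S_eq (S : set V) (f : V -> R) p : ~ S p ->
  (forall rho q, (forall l x, chain (fun y => ~ S y) p l x -> l < rho -> f x = 0) ->
     en (q - p) < rho -> f q = 0) ->
  dist_S S p (supp f) = dist p (supp f).
Proof.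
move=> Sp H; apply/eqP; rewrite eq_le dist_le_dist_S andbT leNgt; apply/negP => lt.
have [_ [a fa <-] ha] := ereal_inf_lt lt.
have [rho h1 h2] : exists2 rho : R, e2norm (p - a) < rho & (rho%:E <= dist_S S p (supp f))%E.
  move: ha; case: (dist_S S p (supp f)) => [r| |] h.
  - by exists r; rewrite ?lte_fin in h *.
  - by exists (e2norm (p - a) + 1); rewrite ?ltrDl ?leey.
  - by [].
have Hc l x : chain (fun y => ~ S y) p l x -> l < rho -> f x = 0.
  move=> hc lr; apply/eqP; apply: contraPT (lr) => fx; apply/negP; rewrite -leNgt -lee_fin.
  by apply: le_trans h2 _; apply: (dist_S_le_chain Sp hc); exact: subset_closure.
have z q : en (q - p) < rho -> f q = 0 := H rho q Hc.
rewrite e2normE enC in h1.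
have enc : continuous (fun y : V => en (y - p)) by apply: scont_continuous; exact: scont_en.
have /(fa _)[y [/eqP fy hy]] : nbhs a [set y | en (y - p) < rho].
  by have := enc a; move=> /cvgr_lt; exact.
by apply: fy; apply: z.
Qed.

End ChainDist.

(** * The two cases: closed centre sets and bounded functions *)

Section ZeroSets.
Variables (R : realType) (n : nat).
Local Notation V := 'rV[R]_n.

Lemma dN_zero_set (F : V -> R) p : scont F -> F p != 0 -> 0 < dN [set x | F x = 0] p.
Proof.
move=> cF Fp; have F0 : 0 < `|F p| by rewrite normr_gt0.
have [d d0 hd] := scont_eps p cF F0.
have m0 : 0 < Num.min 1 d by rewrite lt_min ltr01.
apply: (lt_le_trans m0); apply: dN_ge; first by rewrite ge_min lexx.
move=> z Fz; rewrite leNgt lt_min; apply/negP => /andP[_ h2].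
have := hd z; rewrite Fz sub0r normrN ltxx => /(_ _)/notF; apply => i.
have := en_coord (p - z) i; rewrite !mxE distrC => h; exact: le_lt_trans h h2.
Qed.

Lemma scont_meval (P : mpoly.mpoly n R) : scont (fun x : V => mpoly.meval (fun i => x ord0 i) P).
Proof.
under [X in scont X]eq_fun do rewrite mpoly.mevalE.
apply: scont_sum => m; apply: scontM; first exact: scont_cst.
elim: (index_enum _) => [|i s IH].
  by under [X in scont X]eq_fun do rewrite big_nil; exact: scont_cst.
under [X in scont X]eq_fun do rewrite big_cons.
by apply: scontM => //; apply: scontX; exact: scont_coord.
Qed.

Lemma RS_zero_ballint (S : set V) (f : V -> R) x b : (0 < n)%N -> scont f -> RS_zero S f -> S x ->
  0 < b -> ballint f x b = 0.
Proof. by move=> n0 cf HR Sx b0; apply: Rsph0_ballint => // r r0; exact: HR. Qed.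

Lemma chain_support_closed (S : set V) (f : V -> R) p rho q : scont f -> RS_zero S f -> 0 < dN S p ->
  (forall l x, chain (fun y => ~ S y) p l x -> l < rho -> f x = 0) -> en (q - p) < rho -> f q = 0.
Proof.
(* In dimension 0 the passage to ball integrals breaks down, but the space is a single point,
   reached by the empty chain. *)
move=> cf HR dp Hc qr; have [n0|n0] := posnP n; last first.
  by apply: (chain_support cf _ dp Hc qr) => x Sx b b0; exact: (RS_zero_ballint n0 cf HR Sx b0).
have -> : q = p by apply/rowP => i; have := ltn_ord i; rewrite {2}n0.
by apply: (Hc 0); [exact: chain0|exact: le_lt_trans (en_ge0 _) qr].
Qed.

(** A short hop takes p to a point p' off [ball_null f]. It avoids S, because p itself is off S and
    the rest of the segment is off [ball_null f]; chains from p' thus extend to chains from p. *)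
Lemma chain_support_bounded (S : set V) (f : V -> R) M x0 p rho q : scont f -> (forall y, `|f y| <= M) ->
  f x0 != 0 -> RS_zero S f -> ~ S p ->
  (forall l x, chain (fun y => ~ S y) p l x -> l < rho -> f x = 0) -> en (q - p) < rho -> f q = 0.
Proof.
move=> cf fM fx0 HR Sp Hc qr; have [n0|n0] := posnP n.
  have -> : q = p by apply/rowP => i; have := ltn_ord i; rewrite {2}n0.
  by apply: (Hc 0); [exact: chain0|exact: le_lt_trans (en_ge0 _) qr].
have SN x : S x -> ball_null f x by move=> Sx b b0; exact: (RS_zero_ballint n0 cf HR Sx b0).
have [v [t0 t00 Ht0]] := ball_null_isolated p cf fM fx0.
have v1 : 0 < en v + 1 by rewrite ltr_wpDl// en_ge0.
(* The hop costs twice its length, once in the radius and once in the distance to q; a third of the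
   gap rho - |q - p| therefore suffices. *)
pose t := Num.min t0 ((rho - en (q - p)) / 3 / (en v + 1)).
have tp : 0 < t by rewrite lt_min t00 !divr_gt0// subr_gt0.
have tt0 : t <= t0 by rewrite ge_min lexx.
have tv : t * en v <= (rho - en (q - p)) / 3.
  have : t * (en v + 1) <= (rho - en (q - p)) / 3 by rewrite -ler_pdivlMr// ge_min lexx orbT.
  by apply: le_trans; rewrite mulrDr mulr1 lerDl ltW.
pose p' := p + t *: v.
have ep : en (p' - p) = t * en v by rewrite /p' addrC addKr enZ gtr0_norm.
have hop : chain (fun y => ~ S y) p (en (p' - p)) p'.
  rewrite -[en _]add0r; apply: chainS; first exact: chain0.
  move=> s s0 s1; rewrite /p' addrAC subrr add0r scalerA.
  move: s0; rewrite le_eqVlt => /predU1P[<-|s0]; first by rewrite mul0r scale0r addr0.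
  by move=> /SN; apply: Ht0; [exact: mulr_gt0|apply: le_trans tt0; rewrite ler_piMl// ltW].
apply: (chain_support (N := ball_null f) (p := p') (rho := rho - t * en v) cf) => //.
- by apply: dN_ball_null => //; exact: Ht0.
- move=> l x hc lr; apply: (Hc (en (p' - p) + l)); last by rewrite ep -ltrBrDl.
  by apply: (chain_cat hop); apply: chain_sub hc => y Ny /SN.
- have := en_split q p p'; rewrite (enC p) ep; have := qr; lra.
Qed.

End ZeroSets.

Theorem theorem17 (R : realType) (n : nat) :
  (forall (S : set 'rV[R]_n) (f : 'rV[R]_n -> R),
     continuous f -> (exists x, f x != 0) -> exp_decaying f -> RS_zero S f ->
     forall p, ~ S p -> dist_S S p (supp f) = dist p (supp f)) /\
  (forall (S : set 'rV[R]_n) (f : 'rV[R]_n -> R),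
     algebraic_hypersurface S -> continuous f -> RS_zero S f ->
     forall p, ~ S p -> dist_S S p (supp f) = dist p (supp f)).
Proof.
split=> [S f cf [x0 fx0] [C [a [C0 a0 fC]]] HR p Sp|S f [P [_ SE]] cf HR p Sp].
  have fM y : `|f y| <= C.
    apply: le_trans (fC y) _; apply: ler_piMr; first exact: ltW.
    rewrite -[leRHS]expR0 ler_expR oppr_le0; apply: mulr_ge0; first exact: ltW.
    by rewrite e2normE en_ge0.
  apply: dist_S_eq => // rho q.
  exact: chain_support_bounded (continuous_scont cf) fM fx0 HR Sp.
apply: dist_S_eq => // rho q.
apply: chain_support_closed (continuous_scont cf) HR _; rewrite SE.
by apply: dN_zero_set; [exact: scont_meval|apply/eqP => Pp; apply: Sp; rewrite SE].
Qed.
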